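(* Let $Y,U,Z$ be separable complex Hilbert spaces, let $A\colon \mathcal{D}(A)\subset Y\to Y$ be the generator of an exponentially stable $C_0$-semigroup $\{e^{At}\}_{t\ge 0}$ on $Y$ (i.e. $\|e^{At}\|_{\mathcal{L}(Y)}\le M e^{-\omega t}$ for all $t\ge 0$, for some $M\ge 1$, $\omega>0$), let $B\in \mathcal{L}(U,[\mathcal{D}(A^* )]')$ (equivalently $A^{-1}B\in\mathcal{L}(U,Y)$), and let $R\in\mathcal{L}(Y,Z)$. For $\vartheta>0$ write $A^{\vartheta}:=(-A)^{\vartheta}$ and ${A^*}^{\vartheta}:=(-A^* )^{\vartheta}$. Assume that $$B^*e^{A^*t}x=F(t)x+G(t)x,\qquad t\ge 0,\ x\in\mathcal{D}(A^* ),$$ where $F(t)\colon Y\to U$ and $G(t)\colon\mathcal{D}(A^* )\to U$, $t>0$, are bounded linear operators such that: 1. there exist constants $\gamma\in(0,1)$ and $N,\eta>0$ with $\|F(t)\|_{\mathcal{L}(Y,U)}\le N t^{-\gamma}e^{-\eta t}$ for all $t>0$; 2. there exists $T>0$ such that $G(\cdot)\in\mathcal{L}(Y,L^p(0,T;U))$ for all $p\in[1,\infty)$; 3. with $T$ as in 2., there exists $\epsilon>0$ such that: (a) $G(\cdot){A^*}^{-\epsilon}\in\mathcal{L}(Y,C([0,T];U))$, with $\sup_{t\in[0,T]}\|G(t){A^*}^{-\epsilon}\|_{\mathcal{L}(Y,U)}<\infty$; (b) $R^*R\in\mathcal{L}(\mathcal{D}(A^{\epsilon}),\mathcal{D}({A^*}^{\epsilon}))$,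 i.e. $\|{A^*}^{\epsilon}R^*RA^{-\epsilon}\|_{\mathcal{L}(Y)}<\infty$; (c) there exists $q\in(1,2)$ such that the map $x\mapsto B^*e^{A^*t}{A^*}^{\epsilon}x$ has an extension belonging to $\mathcal{L}(Y,L^q(0,T;U))$. Consider the problem of minimizing, over $u\in L^2(0,\infty;U)$, the functional $$J(u)=\int_0^\infty\big(\|Ry(t)\|_Z^2+\|u(t)\|_U^2\big)\,dt,$$ where $y$ is the mild solution of $y'=Ay+Bu$ on $(0,\infty)$, $y(0)=y_0\in Y$. Let $P\in\mathcal{L}(Y)$ be the corresponding optimal cost operator, and let $A_P\colon\mathcal{D}(A_P)\subset Y\to Y$ be the infinitesimal generator of the optimal state semigroup $\Phi(t)=e^{A_Pt}$, $t\ge 0$, on $Y$. If $\epsilon<1-\gamma$, then $$\mathcal{D}(A_P)=\bigcap_{\vartheta\in(0,1-\gamma)}\big\{x\in\mathcal{D}(A^{\vartheta})\colon\ x-A^{-1}B\,B^*Px\in\mathcal{D}(A)\big\}.$$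
   Context: **Duality conventions.** $[\mathcal{D}(A^* )]'$ is the dual of $\mathcal{D}(A^* )$ (graph norm) with respect to the pivot space $Y$ (an extrapolation space containing $Y$). The semigroup $e^{At}$ and the operator $A^{-1}$ extend to it, with $A^{-1}\colon[\mathcal{D}(A^* )]'\to Y$. The operator $B^*\in\mathcal{L}(\mathcal{D}(A^* ),U)$ is defined by $(u,B^*z)_U=\langle Bu,z\rangle$ for $u\in U$, $z\in\mathcal{D}(A^* )$. **Fractional powers.** By exponential stability, $-A$ and $-A^*$ are positive operators, so their fractional powers are defined. $\mathcal{D}(A^\vartheta)$ is the domain of $(-A)^\vartheta$ with norm $\|(-A)^\vartheta x\|_Y$. In hypotheses 2 and 3(c), membership in $\mathcal{L}(Y,L^p(0,T;U))$ (resp. $\mathcal{L}(Y,L^q(0,T;U))$) means that the map, initially defined on a dense subspace of smooth vectors, extends to a bounded operator on $Y$. **Mild solution.** For $y_0\in Y$ and $u\in L^2(0,\infty;U)$, $$y(t)=e^{At}y_0+\int_0^te^{A(t-s)}Bu(s)\,ds,\qquad t\ge 0,$$ where the integral is a priori meaningful in $[\mathcal{D}(A^* )]'$. **Optimal state semigroup and optimal cost operator.** Under the hypotheses listed in the claim (without $\epsilon<1-\gamma$), the following facts are known and make the objects in the claim well defined. - For each $y_0\in Y$ there is a unique minimizer $\hat u=\hat u(\cdot;y_0)\in L^2(0,\infty;U)$ of $J$. The corresponding mild solution $\hat y=\hat y(\cdot;y_0)$ belongs to $C_b([0,\infty);Y)\cap L^2(0,\infty;Y)$. - $\Phi(t)y_0:=\hat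 y(t;y_0)$ defines an exponentially stable $C_0$-semigroup $\{\Phi(t)\}_{t\ge0}$ on $Y$, the optimal state semigroup. It maps $\mathcal{D}(A^\epsilon)$ into itself. $A_P$ denotes its infinitesimal generator. - The optimal cost operator is the self-adjoint non-negative operator $P\in\mathcal{L}(Y)$ given by $$Py_0=\int_0^\infty e^{A^*t}R^*R\,\Phi(t)y_0\,dt,\qquad y_0\in Y.$$ - The gain operator $B^*P$ is well defined on $\mathcal{D}(A^\epsilon)$ and $B^*P\in\mathcal{L}(\mathcal{D}(A^\epsilon),U)$. Explicitly, $B^*Px=\int_0^\infty B^*e^{A^*t}R^*R\,\Phi(t)x\,dt$ for $x\in\mathcal{D}(A^\epsilon)$, where for $t>0$ the operator $B^*e^{A^*t}$ denotes its bounded extension from $\mathcal{D}(A^* )$ to $\mathcal{D}({A^*}^\epsilon)$. For $y_0\in\mathcal{D}(A^\epsilon)$, the optimal control satisfies $\hat u(t)=-B^*P\hat y(t)$ for a.e. $t>0$. **Reading of the right-hand side of the identity.** Since $\epsilon<1-\gamma$, any $x$ belonging to $\mathcal{D}(A^\vartheta)$ for all $\vartheta\in(0,1-\gamma)$ lies in $\mathcal{D}(A^\epsilon)$, so $B^*Px\in U$ and $A^{-1}BB^*Px\in Y$ are meaningful. Thus the intersection is the set of all $x\in\bigcap_{\vartheta\in(0,1-\gamma)}\mathcal{D}(A^\vartheta)$ such that $x-A^{-1}BB^*Px\in\mathcal{D}(A)$. *)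

(* Defs.v *)
From HB Require Import structures.
From mathcomp Require Import all_boot all_order all_algebra.
From mathcomp Require Import sesquilinear.
From mathcomp Require Import complex.
From mathcomp Require Import all_classical all_reals all_analysis.

Set Implicit Arguments.
Unset Strict Implicit.
Unset Printing Implicit Defensive.

Import Order.TTheory GRing.Theory Num.Theory.
Import numFieldTopology.Exports numFieldNormedType.Exports.

Local Open Scope classical_set_scope.
Local Open Scope complex_scope.
Local Open Scope ring_scope.

(* The inner product [hdot x y] is linear in [x] and conjugate-linear in [y]. *)
HB.mixin Record NormedModule_isHilbert (R : realType) H
    of CompleteNormedModule R[i] H := {
  hdot : {dot H for (@Num.conj R[i])} ;
  hdot_norm : forall x : H, hdot x x = `|x| ^+ 2 }.

#[short(type="hilbertType")]
HB.structure Definition Hilbert (R : realType) :=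
  { H of NormedModule_isHilbert R H & CompleteNormedModule R[i] H }.

Definition separable (T : topologicalType) :=
  exists2 D : set T, countable D & dense D.

(* Norms of [R[i]]-normed spaces are [R[i]]-valued; [nrm] is the norm in [R]. *)
Definition nrm (R : realType) (V : normedZmodType R[i]) (x : V) : R :=
  complex.Re `|x|.

Section BoundedOperators.
Context {R : realType}.

Definition bounded_op (V W : hilbertType R) (T : V -> W) :=
  linear T /\ continuous T.

(* Meaningful for bounded [T], where the set below is a singleton. *)
Definition adj (V W : hilbertType R) (T : V -> W) (y : W) : V :=
  xget 0 [set w | forall x, hdot (T x) y = hdot x w].

End BoundedOperators.

Section UnboundedOperators.
Context {R : realType}.

(* The values of [opval] outside [dom] are irrelevant. *)
Record unbounded_op (V : Type) := UnboundedOp {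
  dom : set V ;
  opval :> V -> V }.

Definition adj_op (V : hilbertType R) (A : unbounded_op V) : unbounded_op V :=
  {| dom := [set z | exists w, forall x, dom A x -> hdot (A x) z = hdot x w] ;
     opval := fun z =>
       xget 0 [set w | forall x, dom A x -> hdot (A x) z = hdot x w] |}.

Definition graph_norm (V : hilbertType R) (A : unbounded_op V) (x : V) : R :=
  nrm x + nrm (A x).

Definition graph_bounded (V W : hilbertType R) (A : unbounded_op V)
    (T : V -> W) :=
  (forall a x y, dom A x -> dom A y -> T (a *: x + y) = a *: T x + T y) /\
  (exists C : R, forall x, dom A x -> nrm (T x) <= C * graph_norm A x).

End UnboundedOperators.

Section Semigroups.
Context {R : realType} {V : hilbertType R}.

(* Semigroups are functions of [t : R], used for [0 <= t] only. *)
Definition C0_semigroup (S : R -> V -> V) :=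
  [/\ forall t, 0 <= t -> bounded_op (S t),
      forall x, S 0 x = x,
      forall s t x, 0 <= s -> 0 <= t -> S (s + t) x = S s (S t x)
    & forall x, S t x @[t --> (0 : R)^'+] --> x].

Definition exp_stable (S : R -> V -> V) :=
  exists M omega : R, [/\ 1 <= M, 0 < omega
    & forall t x, 0 <= t -> nrm (S t x) <= M * expR (- omega * t) * nrm x].

Definition generator (S : R -> V -> V) : unbounded_op V :=
  let quot x (t : R) := t^-1%:C *: (S t x - x) in
  {| dom := [set x | cvg (quot x t @[t --> (0 : R)^'+])] ;
     opval := fun x => lim (quot x t @[t --> (0 : R)^'+]) |}.

Definition adj_semigroup (S : R -> V -> V) (t : R) : V -> V := adj (S t).

End Semigroups.

Section Integration.
Context {R : realType}.
Notation mu := (@lebesgue_measure R).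

Definition cintegral (D : set R) (h : R -> R[i]) : R[i] :=
  (\int[mu]_(t in D) complex.Re (h t))%R +i*
  (\int[mu]_(t in D) complex.Im (h t))%R.

Context {V : hilbertType R}.

(* In a separable space, Borel measurability is strong measurability. *)
Definition vmeasurable (D : set R) (f : R -> V) :=
  forall O : set V, open O ->
    measurable (D `&` f @^-1` O : set (measurableTypeR R)).

Definition in_Lp (p : R) (D : set R) (f : R -> V) :=
  vmeasurable D f /\ (\int[mu]_(t in D) (nrm (f t) `^ p)%:E < +oo)%E.

(* Bochner integral: integrability is [in_Lp 1]; the value is then the vector
   that Riesz' theorem attaches to [z |-> \int (f t, z) dt]. *)
Definition is_vintegral (D : set R) (f : R -> V) (x : V) :=
  in_Lp 1 D f /\ forall z, hdot x z = cintegral D (fun t => hdot (f t) z).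

Definition vintegral (D : set R) (f : R -> V) : V :=
  xget 0 [set x | is_vintegral D f x].

End Integration.

Section FractionalPowers.
Context {R : realType} {V : hilbertType R}.

Definition Gamma_fun (th : R) : R :=
  (\int[@lebesgue_measure R]_(t in `]0%R, +oo[) (t `^ (th - 1) * expR (- t)))%R.

(* For an exponentially stable semigroup [S] with generator [A] and [th > 0]:
   (-A)^(-th) = 1/Gamma(th) \int_0^oo t^(th-1) e^(At) dt, and (-A)^th is the
   inverse of this injective bounded operator. *)
Definition fracinv (S : R -> V -> V) (th : R) (x : V) : V :=
  (Gamma_fun th)^-1%:C *:
    vintegral `]0, +oo[ (fun t => (t `^ (th - 1))%:C *: S t x).

Definition fracpow (S : R -> V -> V) (th : R) : unbounded_op V :=
  {| dom := range (fracinv S th) ;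
     opval := fun x => xget 0 [set y | fracinv S th y = x] |}.

End FractionalPowers.

(* [g t x] is given for [x] in [D]; the map [x |-> g(.) x] extends to an
   element of L(Y, L^p(0,T;U)). *)
Definition extends_to_Lp (R : realType) (Y U : hilbertType R) (D : set Y)
    (g : R -> Y -> U) (p T : R) :=
  exists E : Y -> R -> U,
  [/\ forall x, in_Lp p `]0, T[ (E x),
      forall a x y, {ae @lebesgue_measure R, forall t, t \in `]0, T[ ->
        E (a *: x + y) t = a *: E x t + E y t},
      exists C : R, 0 <= C /\ forall x,
        (\int[@lebesgue_measure R]_(t in `]0%R, T[) (nrm (E x t) `^ p)%:E
          <= ((C * nrm x) `^ p)%:E)%E
    & forall x, D x -> {ae @lebesgue_measure R, forall t, t \in `]0, T[ ->
        E x t = g t x}].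

Section ControlSystem.
Context {R : realType} {Y U Z : hilbertType R}.
Variable S : R -> Y -> Y.
Notation A := (generator S).
Notation Astar := (adj_op (generator S)).
Notation Sstar := (adj_semigroup S).

(* The elements of the dual of D(Astar) are functionals on D(Astar), bounded for
   the graph norm. With Y as pivot, y is identified with z |-> (y, z), so they
   are conjugate-linear. Values outside D(Astar) are irrelevant. *)
Definition in_dual (f : Y -> R[i]) :=
  (forall a z w, dom Astar z -> dom Astar w ->
     f (a *: z + w) = a^* * f z + f w) /\
  (exists C : R, forall z, dom Astar z -> nrm (f z) <= C * graph_norm Astar z).

(* [B u z] is the pairing <B u, z>. *)
Definition control_op (B : U -> Y -> R[i]) :=
  [/\ forall u, in_dual (B u),
      forall a u v z, dom Astar z -> B (a *: u + v) z = a * B u z + B v z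
    & exists C : R, forall u z, dom Astar z ->
        nrm (B u z) <= C * nrm u * graph_norm Astar z].

Definition Bstar (B : U -> Y -> R[i]) (z : Y) : U :=
  xget 0 [set v | forall u, hdot u v = B u z].

(* The extension of A^-1 to the dual of D(Astar), by duality. *)
Definition Ainv (f : Y -> R[i]) : Y :=
  xget 0 [set y | forall z, dom Astar z -> hdot y (Astar z) = f z].

(* The mild solution has the value [w] in Y at time [t], i.e.
   w = e^(At) y0 + \int_0^t e^(A(t-s)) B u(s) ds in the dual of D(Astar), where
   e^(At) acts by <e^(At) f, z> = <f, e^(At)^* z>. *)
Definition mild_value (B : U -> Y -> R[i]) (y0 : Y) (u : R -> U) (t : R)
    (w : Y) :=
  forall z, dom Astar z ->
    hdot w z = hdot (S t y0) z +
      cintegral `]0, t[ (fun s => B (u s) (Sstar (t - s) z)).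

Definition mild_solution (B : U -> Y -> R[i]) (y0 : Y) (u : R -> U)
    (y : R -> Y) :=
  vmeasurable `[0, +oo[ y /\
  {ae @lebesgue_measure R, forall t, 0 <= t -> mild_value B y0 u t (y t)}.

Definition cost (Robs : Y -> Z) (u : R -> U) (y : R -> Y) : \bar R :=
  (\int[@lebesgue_measure R]_(t in `[0%R, +oo[)
     (nrm (Robs (y t)) ^+ 2 + nrm (u t) ^+ 2)%R%:E)%E.

Definition admissible (B : U -> Y -> R[i]) (y0 : Y) (u : R -> U)
    (y : R -> Y) :=
  in_Lp 2 `[0, +oo[ u /\ mild_solution B y0 u y.

Definition optimal_pair (B : U -> Y -> R[i]) (Robs : Y -> Z) (y0 : Y)
    (u : R -> U) (y : R -> Y) :=
  admissible B y0 u y /\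
  forall v w, admissible B y0 v w -> (cost Robs u y <= cost Robs v w)%E.

Definition optimal_state_semigroup (B : U -> Y -> R[i]) (Robs : Y -> Z)
    (Phi : R -> Y -> Y) :=
  [/\ C0_semigroup Phi, exp_stable Phi
    & forall y0, exists u : R -> U,
        optimal_pair B Robs y0 u (Phi ^~ y0) /\
        forall t, 0 <= t -> mild_value B y0 u t (Phi t y0)].

(* For [t > 0], the extension of [fun z => Bstar B (Sstar t z)] from D(Astar) to
   the domain of (-Astar)^eps, by continuity for the norm of that domain. *)
Definition BstarS (B : U -> Y -> R[i]) (eps t : R) (z : Y) : U :=
  xget 0 [set v | dom (fracpow Sstar eps) z /\ exists z_ : nat -> Y,
    [/\ forall n, dom Astar (z_ n) /\ dom (fracpow Sstar eps) (z_ n),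
        fracpow Sstar eps (z_ n) @[n --> \oo] --> fracpow Sstar eps z
      & Bstar B (Sstar t (z_ n)) @[n --> \oo] --> v]].

Definition cost_integral (H : hilbertType R) (K : R -> Y -> H) (Robs : Y -> Z)
    (Phi : R -> Y -> Y) (x : Y) : H :=
  vintegral `]0, +oo[ (fun t => K t (adj Robs (Robs (Phi t x)))).

Definition optimal_cost_op (Robs : Y -> Z) (Phi : R -> Y -> Y) : Y -> Y :=
  cost_integral Sstar Robs Phi.

(* B^* P on D(A^eps): the range of P need not lie in D(Astar), and B^* P is
   obtained by moving B^* inside the integral that defines P. *)
Definition gain_op (B : U -> Y -> R[i]) (eps : R) (Robs : Y -> Z)
    (Phi : R -> Y -> Y) : Y -> U :=
  cost_integral (BstarS B eps) Robs Phi.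

End ControlSystem.

(* Main.v *)
(* Everything is expressed through bounded operators: A^-1, the negative powers
   A^-th, and D = A^-1 B. Perturbing the optimal control by multiples of
   characteristic functions shows that, for x = A_P^-1 v, the optimal control is
   C Phi(t) v with C bounded, whence A_P^-1 = A^-1 - D C. By hypotheses 1 and 2
   the range of D lies in that of A^-th for th < 1 - gamma, and hence so does
   D(A_P); as C v = - B'P A_P^-1 v, this gives the first inclusion.
   For the converse, let x = A^-eps y be such that x - D B'P x lies in D(A), and
   let r in D(A_P) solve (l - A_P) r = l x - A (x - D B'P x). The difference
   e = x - r satisfies e + D u = l A^-1 e, where |u| <= c |A^eps e|, while
   hypothesis 3(c) gives |A^eps e| <= kappa(l) |u| with kappa(l) -> 0; so e = 0
   for l large. The same resolvent estimate shows that A^eps D(A_P) is dense,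
   which extends to D(A^eps) the bounds on the gain B'P and on A^eps Phi(t) A^-eps
   that are first obtained on D(A_P). *)

From HB Require Import structures.
Require Import Defs.
From mathcomp Require Import all_boot all_order all_algebra.
From mathcomp Require Import sesquilinear complex.
From mathcomp Require Import all_classical all_reals all_analysis.
From mathcomp Require Import measurable_realfun ring lra.

Import Order.TTheory GRing.Theory Num.Theory.
Import numFieldTopology.Exports numFieldNormedType.Exports.

Set Implicit Arguments.
Unset Strict Implicit.
Unset Printing Implicit Defensive.

Local Open Scope classical_set_scope.
Local Open Scope complex_scope.
Local Open Scope ring_scope.

(** * The real inner product *)

(** No bound on [B'P] is assumed: [Phi] is only known to be optimal, so every bound on the gain is
    derived. The way in is D(A_P): for [x = A_P^-1 v] the function [A^eps Phi(t) x] is bounded in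
    time, since [A^eps A_P^-1] is a bounded operator when [eps < 1 - gamma]. Its supremum is finite
    and can be absorbed. Hypotheses 1 and 3(a) give an integrable kernel, which with 3(b) bounds the
    feedback by this supremum; comparison with the zero control bounds it in L^2 by |x|. As q < 2,
    the exponent conjugate to q exceeds 2, so pairing the feedback with the kernel of 3(c) costs a
    small multiple of the supremum plus a multiple of |A^eps x|. The decay of kappa(l) has the same
    source, exp(-l t) being small in the conjugate space. Membership in a domain is membership in
    the range of an injective bounded operator, usually deduced by Douglas' lemma from an estimate
    on adjoints. Vectors are identified by testing, so that only real scalar integrals are computed;
    complex scalars return when the definitions of the statement are translated. *)

Section RealInnerProduct.
Context {R : realType} {V : hilbertType R}.
Implicit Types (x y z : V) (r : R) (c : R[i]).

(** The real part makes a complex Hilbert space a real one with the same norm. Integrands become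
    real-valued, and Riesz representatives and adjoints for [ip] serve the complex structure as
    well, since [hdotE] recovers [hdot]. *)
Definition ip x y : R := complex.Re (hdot x y).

Lemma ReD (a b : R[i]) : complex.Re (a + b) = complex.Re a + complex.Re b.
Proof. by case: a; case: b. Qed.

Lemma ReN (a : R[i]) : complex.Re (- a) = - complex.Re a.
Proof. by case: a. Qed.

Lemma ReZ r (a : R[i]) : complex.Re (r%:C * a) = r * complex.Re a.
Proof. by case: a => u v /=; rewrite mul0r subr0. Qed.

Lemma conjCE (a : R[i]) : Num.conj a = conjc a.
Proof. by []. Qed.

Lemma ipDl x y z : ip (x + y) z = ip x z + ip y z.
Proof. by rewrite /ip linearDl ReD. Qed.
Lemma ipDr x y z : ip x (y + z) = ip x y + ip x z.
Proof. by rewrite /ip linearDr ReD. Qed.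
Lemma ipNl x y : ip (- x) y = - ip x y.
Proof. by rewrite /ip linearNl ReN. Qed.
Lemma ipNr x y : ip x (- y) = - ip x y.
Proof. by rewrite /ip linearNr ReN. Qed.
Lemma ip0l x : ip 0 x = 0.
Proof. by rewrite /ip linear0l. Qed.
Lemma ip0r x : ip x 0 = 0.
Proof. by rewrite /ip linear0r. Qed.
Lemma ipZl r x y : ip (r%:C *: x) y = r * ip x y.
Proof. by rewrite /ip linearZl_LR /= ReZ. Qed.
Lemma ipZr r x y : ip x (r%:C *: y) = r * ip x y.
Proof. by rewrite /ip linearZr_LR/= conjCE conjc_real ReZ. Qed.
Lemma ipBl x y z : ip (x - y) z = ip x z - ip y z.
Proof. by rewrite ipDl ipNl. Qed.
Lemma ipBr x y z : ip x (y - z) = ip x y - ip x z.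
Proof. by rewrite ipDr ipNr. Qed.
Lemma ipC x y : ip x y = ip y x.
Proof. by rewrite /ip hermC /= expr0 mul1r conjCE; case: (hdot y x). Qed.

Lemma hdotE x y : hdot x y = ip x y +i* ip x ('i%C *: y).
Proof.
rewrite /ip linearZr_LR/= conjCE.
by case: (hdot x y) => a b /=; rewrite mul0r sub0r mulN1r opprK.
Qed.

Lemma ipiN x y : ip ('i%C *: x) y = - ip x ('i%C *: y).
Proof.
rewrite /ip linearZl_LR linearZr_LR/= conjCE.
by case: (hdot x y) => a b /=; rewrite !mul0r !sub0r mul1r mulN1r opprK.
Qed.

Lemma nrmE x : `|x| = (nrm x)%:C.
Proof.
rewrite /nrm; have := normr_ge0 x; case: `|x| => a b.
by rewrite lecE /= => /andP[/eqP-> _].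
Qed.

Lemma ip_nrm x : ip x x = nrm x ^+ 2.
Proof. by rewrite /ip hdot_norm nrmE -rmorphXn. Qed.

Lemma nrm_ge0 x : 0 <= nrm x.
Proof. by rewrite -ler0c -nrmE. Qed.

Lemma nrm0 : nrm (0 : V) = 0.
Proof. by rewrite /nrm normr0. Qed.

Lemma nrm0_eq0 x : nrm x = 0 -> x = 0.
Proof. by move=> h; apply/eqP; rewrite -normr_eq0 nrmE h. Qed.

Lemma nrmD x y : nrm (x + y) <= nrm x + nrm y.
Proof. by have := ler_normD x y; rewrite !nrmE -rmorphD lecR. Qed.

Lemma nrmN x : nrm (- x) = nrm x.
Proof. by rewrite /nrm normrN. Qed.

Lemma nrmB x y : nrm (x - y) <= nrm x + nrm y.
Proof. by rewrite -(nrmN y); exact: nrmD. Qed.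

Lemma nrmBC x y : nrm (x - y) = nrm (y - x).
Proof. by rewrite -nrmN opprB. Qed.

Lemma nrmZc c x : nrm (c *: x) = complex.Re `|c| * nrm x.
Proof. by rewrite /nrm normrZ normc_def ReZ. Qed.

Lemma nrmZ r x : nrm (r%:C *: x) = `|r| * nrm x.
Proof. by rewrite nrmZc normc_def /= expr0n addr0 sqrtr_sqr. Qed.

Lemma nrmi x : nrm ('i%C *: x) = nrm x.
Proof. by rewrite nrmZc normc_def /= expr0n add0r expr1n sqrtr1 mul1r. Qed.

Lemma nrm_triangle x y z : nrm (x - z) <= nrm (x - y) + nrm (y - z).
Proof. by have := nrmD (x - y) (y - z); rewrite subrKA. Qed.

Lemma nrm_rev x y : `|nrm x - nrm y| <= nrm (x - y).
Proof.
have h (u v : V) : nrm u - nrm v <= nrm (u - v).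
  by have := nrmD (u - v) v; rewrite subrK -lerBlDr.
by rewrite ler_norml h andbT lerNl opprB nrmBC h.
Qed.

Lemma ip_eq x y : (forall z, ip x z = ip y z) -> x = y.
Proof.
move=> h; apply/eqP; rewrite -subr_eq0; apply/eqP/nrm0_eq0/eqP.
by rewrite -sqrf_eq0 -ip_nrm ipBl h subrr.
Qed.

Lemma ip_le x y : `|ip x y| <= nrm x * nrm y.
Proof.
have [y0|y0] := eqVneq (nrm y) 0.
  by rewrite (nrm0_eq0 y0) ip0r normr0 nrm0 mulr0.
have [x0|x0] := eqVneq (nrm x) 0.
  by rewrite (nrm0_eq0 x0) ip0l normr0 nrm0 mul0r.
have a0 : 0 < nrm x by rewrite lt_def x0 nrm_ge0.
have b0 : 0 < nrm y by rewrite lt_def y0 nrm_ge0.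
(* With [a] and [b] the norms, [|b x - s a y|^2 = 2 a b (a b - s (ip x y))] when [s^2 = 1]; the
   signs 1 and -1 give the two bounds. *)
have h s : s ^+ 2 = 1 -> s * ip x y <= nrm x * nrm y.
  move=> s1; set a := nrm x; set b := nrm y.
  have := sqr_ge0 (nrm (b%:C *: x - (s * a)%:C *: y)).
  rewrite -ip_nrm !(ipBl, ipBr, ipZl, ipZr) !ip_nrm (ipC y x) -/a -/b => g.
  have ab : 0 < a * b by rewrite mulr_gt0.
  rewrite -(ler_pM2l ab); nra.
rewrite ler_norml lerNl -mulN1r; apply/andP; split; first by apply: h; ring.
by rewrite -[X in X <= _]mul1r; apply: h; ring.
Qed.

Lemma ip_le_nrm x y : ip x y <= nrm x * nrm y.
Proof. exact: le_trans (ler_norm _) (ip_le _ _). Qed.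

Lemma nrm_le_ip x (C : R) : 0 <= C -> (forall z, ip x z <= C * nrm z) -> nrm x <= C.
Proof.
move=> C0 /(_ x); rewrite ip_nrm expr2.
have [->|x0] := eqVneq (nrm x) 0; first by [].
by rewrite ler_pM2r // lt_def x0 nrm_ge0.
Qed.

Lemma parallelogram x y :
  nrm (x + y) ^+ 2 + nrm (x - y) ^+ 2 = 2 * (nrm x ^+ 2 + nrm y ^+ 2).
Proof.
by rewrite -!ip_nrm !(ipBl, ipBr, ipDl, ipDr) (ipC y x); ring.
Qed.

Lemma cvg_nrmP (T : Type) (F : set_system T) {FF : Filter F} (f : T -> V) (l : V) :
  f @ F --> l <-> (fun t => nrm (f t - l)) @ F --> (0 : R).
Proof.
split=> [/cvgrPdist_lt h|/cvgrPdist_lt h].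
  apply/cvgrPdist_lt => e e0; have e0' : 0 < e%:C :> R[i] by rewrite ltcR.
  have := h _ e0'; apply: filterS => t; rewrite nrmE ltcR sub0r normrN.
  by rewrite ger0_norm ?nrm_ge0 // nrmBC.
apply/cvgrPdist_lt => e e0.
(* Being positive in [R[i]] forces a vanishing imaginary part, so the radius is a real number. *)
have e_real : e = (complex.Re e)%:C.
  by move: e0; case: (e) => a b; rewrite ltcE /= => /andP[/eqP-> _].
have e0' : 0 < complex.Re e by rewrite -ltcR -e_real.
have := h _ e0'; apply: filterS => t; rewrite nrmE e_real ltcR sub0r normrN.
by rewrite ger0_norm ?nrm_ge0 // nrmBC.
Qed.

Lemma cauchy_nrm (u : nat -> V) :
  (forall e : R, 0 < e -> exists N, forall n m, (N <= n)%N -> (N <= m)%N ->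
    nrm (u n - u m) < e) -> exists l : V, u @ \oo --> l.
Proof.
move=> h; apply/cvg_ex/cauchy_cvgP/cauchy_exP => e e0.
have e_real : e = (complex.Re e)%:C.
  by move: e0; case: (e) => a b; rewrite ltcE /= => /andP[/eqP-> _].
have e0' : 0 < complex.Re e by rewrite -ltcR -e_real.
have [N hN] := h _ e0'; exists (u N), N => //= m Nm.
by rewrite /= -ball_normE /= nrmE e_real ltcR hN.
Qed.

End RealInnerProduct.

Lemma hdot_eq (R : realType) (V W : hilbertType R) (x y : V) (x' y' : W) :
  ip x y = ip x' y' -> ip x ('i%C *: y) = ip x' ('i%C *: y') ->
  hdot x y = hdot x' y'.
Proof. by move=> h1 h2; rewrite hdotE h1 h2 -hdotE. Qed.

(** * Bounded real-linear operators *)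

Section Riesz.
Context {R : realType} {V : hilbertType R}.

Definition subspace (K : set V) :=
  K 0 /\ forall r x y, K x -> K y -> K (r%:C *: x + y).

(* The energy [|x|^2 - 2 f x] has a minimizing sequence in [K], which is Cauchy
   by the parallelogram identity. *)
Lemma riesz_closure (K : set V) (f : V -> R) (C : R) : subspace K -> 0 <= C ->
  (forall r x y, K x -> K y -> f (r%:C *: x + y) = r * f x + f y) ->
  (forall x, K x -> f x <= C * nrm x) ->
  exists p, [/\ forall k, K k -> f k = ip k p,
    forall e : R, 0 < e -> exists2 k, K k & nrm (p - k) < e & nrm p <= C].
Proof.
move=> [K0 Kl] C0 fl fb.
have f0 : f 0 = 0.
  have := fl 1 0 0 K0 K0; rewrite scaler0 addr0 mul1r => h.
  by move: h => /eqP; rewrite -subr_eq0 opprD addNKr oppr_eq0 => /eqP.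
have KZ r x : K x -> K (r%:C *: x) by move=> Kx; rewrite -[X in K X]addr0; exact: Kl.
have fZ r x : K x -> f (r%:C *: x) = r * f x.
  by move=> Kx; rewrite -[X in f X]addr0 fl // f0 addr0.
have fD x y : K x -> K y -> f (x + y) = f x + f y.
  by move=> Kx Ky; have := fl 1 x y Kx Ky; rewrite scale1r mul1r.
have KD x y : K x -> K y -> K (x + y).
  by move=> Kx Ky; have := Kl 1 x y Kx Ky; rewrite scale1r.
pose phi x : R := nrm x ^+ 2 - 2 * f x.
pose E := [set phi x | x in K].
have phi_lb x : K x -> - C ^+ 2 <= phi x.
  move=> /fb h; rewrite /phi; have := sqr_ge0 (nrm x - C); nra.
have hE : has_inf E.
  split; first by exists (phi 0), 0.
  by exists (- C ^+ 2) => _ [x Kx <-]; exact: phi_lb.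
pose m := inf E.
have m_le x : K x -> m <= phi x by move=> Kx; apply: ge_inf; [case: hE|exists x].
pose d (n : nat) : R := n.+1%:R^-1.
have ex n : exists x, K x /\ phi x < m + d n.
  have [] := @inf_adherent R E (d n) _ hE; first by rewrite invr_gt0.
  by move=> _ [x Kx <-] h; exists x.
pose u n := projT1 (cid (ex n)).
have Ku n : K (u n) by rewrite /u; case: cid => x [].
have pu n : phi (u n) < m + d n by rewrite /u; case: cid => x [].
have par x y : K x -> K y -> nrm (x - y) ^+ 2 <= 2 * (phi x + phi y - 2 * m).
  move=> Kx Ky; have := m_le (2^-1%:C *: (x + y)) (KZ _ _ (KD _ _ Kx Ky)).
  rewrite /phi nrmZ fZ ?fD//; last exact: KD.
  rewrite ger0_norm ?invr_ge0// exprMn => h.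
  have := parallelogram x y; move: h; set a := nrm (x + y); set b := nrm (x - y).
  by rewrite exprVn; lra.
have inv_lt (e : R) : 0 < e -> exists N, forall n, (N <= n)%N -> d n < e.
  move=> e0; have /cvgrPdist_lt/(_ _ e0)[N _ hN] := @cvg_harmonic R.
  by exists N => n /hN; rewrite /= sub0r normrN ger0_norm.
have [p up] : exists l : V, u @ \oo --> l.
  apply: cauchy_nrm => e e0.
  have [N hN] := inv_lt (e ^+ 2 / 4) (divr_gt0 (exprn_gt0 _ e0) (ltr0n _ 4)).
  exists N => i j Ni Nj.
  have := par _ _ (Ku i) (Ku j); have := pu i; have := pu j.
  have := hN i Ni; have := hN j Nj => h1 h2 h3 h4 h5.
  rewrite -(@ltr_pXn2r _ 2) ?nnegrE ?nrm_ge0 ?ltW//.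
  by lra.
have near_p (e : R) : 0 < e -> exists N, forall n, (N <= n)%N -> nrm (p - u n) < e.
  move=> e0; move/cvg_nrmP : up => /cvgrPdist_lt/(_ _ e0)[N _ hN].
  exists N => n /hN; rewrite /= sub0r normrN ger0_norm ?nrm_ge0//.
  by rewrite nrmBC.
have key k : K k -> f k = ip k p.
  move=> Kk; apply/eqP; rewrite -subr_eq0; apply/eqP.
  (* The energy of [u n + t k] is at least [m], that of [u n] is at most [m + d n]; for large [n]
     their comparison gives this inequality up to [e]. *)
  have lim_le (t : R) : 0 <= t ^+ 2 * nrm k ^+ 2 - 2 * t * (f k - ip k p).
    apply/ler_addgt0Pr => e e0.
    pose c := e / (4 * (1 + `|t| * nrm k)).
    have den : 0 < 4 * (1 + `|t| * nrm k).
      by rewrite mulr_gt0// ltr_pwDl// mulr_ge0// nrm_ge0.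
    have c0 : 0 < c by rewrite divr_gt0.
    have [N1 hN1] := inv_lt _ (divr_gt0 e0 (ltr0n _ 2)).
    have [N2 hN2] := near_p _ c0.
    pose n := maxn N1 N2.
    have hn1 := hN1 n (leq_maxl _ _); have hn2 := hN2 n (leq_maxr _ _).
    have := m_le _ (Kl t k (u n) Kk (Ku n)); have := pu n.
    rewrite /phi fl// -!ip_nrm !(ipDl, ipDr, ipZl, ipZr) (ipC (u n) k) => h1 h2.
    have h3 : t * ip k (u n) - t * ip k p <= `|t| * nrm k * c.
      rewrite -mulrBr -ipBr; apply: le_trans (ler_norm _) _.
      rewrite normrM -mulrA ler_wpM2l//; apply: le_trans (ip_le _ _) _.
      by rewrite ler_wpM2l ?nrm_ge0// nrmBC ltW.
    have h4 : 4 * (1 + `|t| * nrm k) * c = e.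
      by rewrite /c mulrC divfK// gt_eqF.
    have h5 : 0 <= `|t| * nrm k by rewrite mulr_ge0// nrm_ge0.
    by nra.
  set g := f k - ip k p in lim_le *.
  have [k0|k0] := eqVneq (nrm k) 0.
    by have := lim_le g; rewrite k0; nra.
  have q0 : 0 < nrm k ^+ 2 by rewrite exprn_gt0// lt_def k0 nrm_ge0.
  (* This [t] minimizes the quadratic, whose value there is [- g^2 / |k|^2]. *)
  have := lim_le (g / nrm k ^+ 2); set q := nrm k ^+ 2 in q0 *.
  have -> : (g / q) ^+ 2 * q - 2 * (g / q) * g = - (g ^+ 2 / q).
    by field; rewrite gt_eqF.
  rewrite oppr_ge0 pmulr_lle0 ?invr_gt0// => h; apply/eqP.
  by rewrite -sqrf_eq0 eq_le h sqr_ge0.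
exists p; split => //.
  by move=> e e0; have [N hN] := near_p _ e0; exists (u N) => //; exact: hN.
have [//|Cp] := leP (nrm p) C.
suff h : forall e : R, 0 < e -> nrm p * (nrm p - C) <= e * (2 * nrm p + 2 * C).
  have np : 0 < nrm p by apply: le_lt_trans Cp.
  pose e := nrm p * (nrm p - C) / (2 * (2 * nrm p + 2 * C)).
  have a0 : 0 < 2 * nrm p + 2 * C by rewrite ltr_pwDl ?mulr_gt0// mulr_ge0.
  have x0 : 0 < nrm p * (nrm p - C) by rewrite mulr_gt0// subr_gt0.
  have := h e (divr_gt0 x0 (mulr_gt0 (ltr0n _ 2) a0)).
  have -> : e * (2 * nrm p + 2 * C) = nrm p * (nrm p - C) / 2.
    by rewrite /e; field; rewrite gt_eqF.
  by lra.
move=> e e0; have [N hN] := near_p _ e0.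
have := fb _ (Ku N); rewrite key//.
have := hN N (leqnn _); have := ip_le_nrm (p - u N) p; rewrite ipBl ip_nrm => h1 h2 h3.
have h4 : nrm (u N) <= nrm p + nrm (p - u N).
  by have := nrmB p (p - u N); rewrite opprB addrC subrK.
have := nrm_ge0 p; have := nrm_ge0 (p - u N); nra.
Qed.

Lemma riesz (f : V -> R) (C : R) : 0 <= C ->
  (forall r x y, f (r%:C *: x + y) = r * f x + f y) ->
  (forall x, f x <= C * nrm x) ->
  exists2 p, forall x, f x = ip x p & nrm p <= C.
Proof.
move=> C0 fl fb.
have [] := @riesz_closure setT f C; rewrite ?/subspace//.
by move=> p [h _ np]; exists p => // x; exact: h.
Qed.

(** The Riesz representative [p] of [ip ^~ y] on [K] is approximated by elements of [K], and [y - p]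
    is orthogonal to [K]; hence [y = p]. *)
Lemma dense_of_orth (K : set V) : subspace K ->
  (forall y, (forall k, K k -> ip k y = 0) -> y = 0) ->
  forall y (e : R), 0 < e -> exists2 k, K k & nrm (y - k) < e.
Proof.
move=> sK orth y e e0.
have [||p [h1 h2 _]] := @riesz_closure K (ip ^~ y) (nrm y) sK (nrm_ge0 _).
- by move=> r x z _ _; rewrite ipDl ipZl.
- by move=> x _; rewrite mulrC; exact: ip_le_nrm.
suff -> : y = p by exact: h2.
apply/eqP; rewrite -subr_eq0; apply/eqP/orth => k Kk.
by rewrite ipBr h1// subrr.
Qed.

End Riesz.

Section BoundedLinear.
Context {R : realType}.

(* Adjoints are taken for the real inner product [ip], so real linearity is
   enough. *)
Definition blin (V W : hilbertType R) (T : V -> W) :=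
  (forall r x y, T (r%:C *: x + y) = r%:C *: T x + T y) /\
  exists2 C, 0 <= C & forall x, nrm (T x) <= C * nrm x.

Definition radj (V W : hilbertType R) (T : V -> W) (y : W) : V :=
  xget 0 [set w | forall x, ip (T x) y = ip x w].

Lemma xgetPP {T : choiceType} (P : set T) (d : T) : (exists x, P x) -> P (xget d P).
Proof. by move=> [x Px]; exact: (xgetI d Px). Qed.

Section Theory.
Context {V W X : hilbertType R}.
Implicit Types (T : V -> W).

Lemma blin0 T : blin T -> T 0 = 0.
Proof.
move=> [h _]; have := h 1 0 0; rewrite !scale1r addr0 => h1.
by apply: (addrI (T 0)); rewrite -h1 addr0.
Qed.

Lemma blinZ T r x : blin T -> T (r%:C *: x) = r%:C *: T x.
Proof. by move=> bT; have := bT.1 r x 0; rewrite !addr0 blin0// addr0. Qed.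

Lemma blinD T x y : blin T -> T (x + y) = T x + T y.
Proof. by move=> bT; have := bT.1 1 x y; rewrite !scale1r. Qed.

Lemma blinN T x : blin T -> T (- x) = - T x.
Proof.
by move=> bT; have := blinZ (-1) x bT; rewrite rmorphN1 !scaleN1r.
Qed.

Lemma blinB T x y : blin T -> T (x - y) = T x - T y.
Proof. by move=> bT; rewrite blinD// blinN. Qed.

Lemma blin_comp (S : W -> X) T : blin S -> blin T -> blin (S \o T).
Proof.
move=> [Sl [C C0 SC]] [Tl [D D0 TD]]; split=> [r x y /=|]; first by rewrite Tl Sl.
exists (C * D); first exact: mulr_ge0.
by move=> x /=; apply: le_trans (SC _) _; rewrite -mulrA ler_wpM2l.
Qed.

Lemma blin_add T1 T2 : blin T1 -> blin T2 -> blin (fun x => T1 x + T2 x).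
Proof.
move=> [Sl [C C0 SC]] [Tl [D D0 TD]]; split=> [r x y /=|].
  by rewrite Tl Sl scalerDr addrACA.
exists (C + D); first exact: addr_ge0.
move=> x /=; rewrite mulrDl; apply: le_trans (nrmD _ _) _.
by rewrite lerD.
Qed.

Lemma blin_scale r T : blin T -> blin (fun x => r%:C *: T x).
Proof.
move=> [Tl [D D0 TD]]; split=> [s x y /=|].
  by rewrite Tl scalerDr !scalerA mulrC.
exists (`|r| * D); first exact: mulr_ge0.
by move=> x /=; rewrite nrmZ -mulrA ler_wpM2l.
Qed.

Lemma radjP T : blin T -> forall x y, ip (T x) y = ip x (radj T y).
Proof.
move=> bT x y.
have : [set w | forall x, ip (T x) y = ip x w] (radj T y); last by exact.
rewrite /radj; apply: xgetPP.
have [Tl [C C0 TC]] := bT.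
have [|||p hp _] := @riesz R V (fun x => ip (T x) y) (C * nrm y).
- by rewrite mulr_ge0// nrm_ge0.
- by move=> r u v; rewrite Tl ipDl ipZl.
- move=> u; apply: le_trans (ip_le_nrm _ _) _.
  by rewrite mulrAC ler_wpM2r ?nrm_ge0.
by exists p.
Qed.

Lemma radj_unique T y w : blin T -> (forall x, ip (T x) y = ip x w) -> radj T y = w.
Proof. by move=> bT h; apply: ip_eq => z; rewrite ipC -radjP// h ipC. Qed.

Lemma radj_bound T (C : R) : blin T -> 0 <= C -> (forall x, nrm (T x) <= C * nrm x) ->
  forall y, nrm (radj T y) <= C * nrm y.
Proof.
move=> bT C0 TC y; apply: nrm_le_ip; first by rewrite mulr_ge0// nrm_ge0.
move=> z; rewrite ipC -radjP//; apply: le_trans (ip_le_nrm _ _) _.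
by rewrite mulrAC ler_wpM2r ?nrm_ge0.
Qed.

Lemma blin_radj T : blin T -> blin (radj T).
Proof.
move=> bT; split.
  move=> r x y; apply: radj_unique => // z.
  by rewrite !(ipDr, ipZr) !radjP.
by have [_ [C C0 TC]] := bT; exists C => //; exact: radj_bound.
Qed.

End Theory.

Lemma radjK (V W : hilbertType R) (T : V -> W) : blin T -> radj (radj T) = T.
Proof.
move=> bT; apply/funext => x; apply: radj_unique; first exact: blin_radj.
by move=> y; rewrite ipC -radjP// ipC.
Qed.

Lemma radj_comp (V W X : hilbertType R) (S : W -> X) (T : V -> W) :
  blin S -> blin T -> radj (S \o T) = radj T \o radj S.
Proof.
move=> bS bT; apply/funext => x; apply: radj_unique; first exact: blin_comp.
by move=> y /=; rewrite !radjP.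
Qed.

Lemma bounded_op_nrm (V W : hilbertType R) (T : V -> W) : bounded_op T ->
  exists2 C, 0 <= C & forall x, nrm (T x) <= C * nrm x.
Proof.
move=> [Tl Tc].
have T0 : T 0 = 0 by have := Tl (-1) 0 0; rewrite !scaleN1r oppr0 addr0 addNr.
have TZ (r : R) x : T (r%:C *: x) = r%:C *: T x.
  by have := Tl r%:C x 0; rewrite !addr0 T0 addr0.
have /cvg_nrmP/cvgrPdist_lt/(_ 1 ltr01) := Tc 0.
rewrite -nbhs_nearE => /nbhs_normP[e e0 he].
have er : e = (complex.Re e)%:C.
  by move: e0; case: (e) => a b; rewrite /= ltcE /= => /andP[/eqP-> _].
have e0' : 0 < complex.Re e by rewrite -ltcR -er.
set d := complex.Re e in er e0'.
exists (2 / d); first by rewrite divr_ge0// ltW.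
move=> x; have [x0|x0] := eqVneq (nrm x) 0.
  by rewrite (nrm0_eq0 x0) T0 !nrm0 mulr0.
have n0 : 0 < nrm x by rewrite lt_def x0 nrm_ge0.
pose r := d / 2 / nrm x.
have r0 : 0 < r by rewrite !divr_gt0.
have := he (r%:C *: x); rewrite /= sub0r normrN nrmE er ltcR => /(_ _)/wrap[].
  by rewrite nrmZ gtr0_norm// /r divfK// ltr_pdivrMr// ltr_pMr// ltr1n.
rewrite T0 subr0 sub0r normrN ger0_norm ?nrm_ge0// TZ nrmZ gtr0_norm// => h.
rewrite -(ler_pM2l r0); apply: (le_trans (ltW h)).
suff -> : r * (2 / d * nrm x) = 1 by [].
by rewrite /r; field; rewrite !gt_eqF.
Qed.

Lemma bounded_op_blin (V W : hilbertType R) (T : V -> W) : bounded_op T -> blin T.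
Proof.
by move=> bT; split; [move=> r x y; rewrite (bT.1)|exact: bounded_op_nrm].
Qed.

(** Complex linearity upgrades the identity for [ip] to one for [hdot]: testing with [i z] supplies
    the imaginary parts. *)
Lemma adj_radj (V W : hilbertType R) (T : V -> W) : bounded_op T -> adj T = radj T.
Proof.
move=> bT; have bl := bounded_op_blin bT.
apply/funext => y; symmetry; apply: radj_unique => // x.
have : [set w | forall x, hdot (T x) y = hdot x w] (adj T y).
  apply: xgetPP; exists (radj T y) => z; apply: hdot_eq; first exact: radjP.
  have iT u : T ('i%C *: u) = 'i%C *: T u.
    by have := bT.1 'i%C u 0; rewrite !addr0 blin0// addr0.
  have := radjP bl ('i%C *: z) y; rewrite iT !ipiN => h.
  by apply: oppr_inj; rewrite h.
by move=> /(_ x); rewrite /ip => ->.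
Qed.

(* Douglas' range inclusion lemma, for one vector. *)
Lemma douglas (V W : hilbertType R) (T : V -> W) (y : W) (C : R) : blin T -> 0 <= C ->
  (forall z, ip y z <= C * nrm (radj T z)) ->
  exists2 x, T x = y & nrm x <= C.
Proof.
move=> bT C0 h; have bA := blin_radj bT.
pose K := range (radj T).
pose s k := xget 0 [set z | radj T z = k].
have sK k : K k -> radj T (s k) = k.
  move=> [z _ zk]; apply: (@xgetPP W [set z | radj T z = k] 0).
  by exists z.
have e0 z : radj T z = 0 -> ip y z = 0.
  move=> z0; apply/eqP; rewrite eq_le; apply/andP; split.
    by apply: le_trans (h z) _; rewrite z0 nrm0 mulr0.
  have := h (- z); rewrite ipNr blinN// z0 oppr0 nrm0 mulr0.
  by rewrite lerNl oppr0.
have e1 z z' : radj T z = radj T z' -> ip y z = ip y z'.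
  move=> zz; apply/eqP; rewrite -subr_eq0 -ipBr; apply/eqP/e0.
  by rewrite blinB// zz subrr.
have lK : subspace K.
  split; first by exists 0 => //; rewrite blin0.
  move=> r _ _ [u _ <-] [v _ <-]; exists (r%:C *: u + v) => //.
  exact: bA.1.
(* On the range of [radj T] the functional [radj T z |-> ip y z] is well defined by [e1] and bounded
   by [C]; its Riesz representative is the solution. *)
have [||p [hp _ np]] := @riesz_closure R V K (fun k => ip y (s k)) C lK C0.
- move=> r a b Ka Kb; rewrite -ipZr -ipDr; apply: e1.
  by rewrite bA.1 !sK//; apply: lK.2.
- by move=> k Kk; apply: le_trans (h _) _; rewrite sK.
exists p => //; apply: ip_eq => z; rewrite radjP// ipC -hp; last by exists z.
by apply: e1; rewrite sK//; exists z.
Qed.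

Lemma blin_cvg (V W : hilbertType R) (T : V -> W) (I : Type) (F : set_system I)
    {FF : Filter F} (f : I -> V) (l : V) :
  blin T -> f @ F --> l -> (fun t => T (f t)) @ F --> T l.
Proof.
move=> bT; have [Tl [C C0 TC]] := bT.
move=> /cvg_nrmP h; apply/cvg_nrmP.
apply: (@squeeze_cvgr _ _ _ _ (cst 0) (fun t => C * nrm (f t - l))).
- by apply: nearW => t; rewrite nrm_ge0/= -blinB// TC.
- exact: cvg_cst.
- by rewrite -(mulr0 C); apply: cvgMr.
Qed.

End BoundedLinear.

(** * Integrals over half-lines *)

Section HalfLine.
Context {R : realType}.
Notation mu := (@lebesgue_measure R).
Implicit Types (f g : R -> R) (D : set R).

(** Only positive times are concerned: the kernels to come may blow up like [t^-gamma] at 0, and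
    semigroups carry no information at negative times. *)
Definition pos_cont (T : topologicalType) (f : R -> T) :=
  forall t, 0 < t -> {for t, continuous f}.

Definition intg D f := mu.-integrable (D : set (measurableTypeR R)) (EFin \o f).

Definition mble D := measurable (D : set (measurableTypeR R)).

Lemma msub_pos D f : D `<=` `]0, +oo[ -> pos_cont f ->
  measurable_fun (D : set (measurableTypeR R)) f.
Proof.
move=> sD cf; apply: (measurable_funS _ sD); first exact: measurable_itv.
apply: open_continuous_measurable_fun; first exact: interval_open.
by move=> t; rewrite inE /= in_itv/= andbT => /cf.
Qed.

Lemma intg_le D f g : mble D -> measurable_fun (D : set (measurableTypeR R)) f ->
  (forall t, D t -> `|f t| <= g t) -> intg D g -> intg D f.
Proof.
move=> mD mf fg; apply: le_integrable => //; first exact/measurable_EFinP.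
move=> t Dt; rewrite /= lee_fin; apply: (le_trans (fg t Dt)); exact: ler_norm.
Qed.

Lemma intgS D E f : mble D -> mble E -> D `<=` E -> intg E f -> intg D f.
Proof. by move=> mD mE DE h; exact: (integrableS mE mD DE h). Qed.

Lemma intg_meas D f : intg D f -> measurable_fun (D : set (measurableTypeR R)) f.
Proof. by move=> /measurable_int/measurable_EFinP. Qed.

Lemma intg_abs D f : intg D f -> intg D (fun t => `|f t|).
Proof. by move=> h; have := integrable_norm h. Qed.

Lemma intgZ D f r : mble D -> intg D f -> intg D (fun t => r * f t).
Proof.
move=> mD h; have := integrableZl mD r h.
by apply: eq_integrable => // t _; rewrite /= EFinM.
Qed.

Lemma intgD D f g : mble D -> intg D f -> intg D g -> intg D (fun t => f t + g t).
Proof.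
move=> mD hf hg; have := integrableD mD hf hg.
by apply: eq_integrable => // t _; rewrite /= EFinD.
Qed.

Lemma intgB D f g : mble D -> intg D f -> intg D g -> intg D (fun t => f t - g t).
Proof.
move=> mD hf hg; have := integrableB mD hf hg.
by apply: eq_integrable => // t _; rewrite /= EFinB.
Qed.

Lemma intg_cst a b (c : R) : intg `]a, b[ (cst c).
Proof.
apply/integrableP; split; first exact/measurable_EFinP/measurable_cst.
under eq_integral do rewrite /=.
rewrite integral_cst//= lebesgue_measure_itv/=; case: ifP => _.
  by rewrite -EFinB -EFinM ltry.
by rewrite mule0 ltry.
Qed.

Lemma Rint_abs_le D f g : mble D -> intg D f -> intg D g ->
  (forall t, D t -> `|f t| <= g t) ->
  `|\int[mu]_(t in D) f t| <= \int[mu]_(t in D) g t.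
Proof.
move=> mD hf hg fg; apply: le_trans (le_normr_Rintegral mD hf) _.
by apply: le_Rintegral => //; exact: intg_abs.
Qed.

Lemma Rint_subset D E f : mble D -> mble E -> D `<=` E -> intg E f ->
  (forall t, E t -> 0 <= f t) ->
  \int[mu]_(t in D) f t <= \int[mu]_(t in E) f t.
Proof.
move=> mD mE DE hf f0; rewrite /Rintegral fine_le//.
- by apply: integrable_fin_num => //; apply: intgS hf.
- exact: integrable_fin_num.
by apply: ge0_subset_integral => //; exact: measurable_int hf.
Qed.

Lemma Rint_cst a b (c : R) : a <= b -> \int[mu]_(t in `]a, b[) c = c * (b - a).
Proof.
move=> ab; rewrite Rintegral_cst//= lebesgue_measure_itv/= lte_fin.
by case: ltgtP ab => // -> _; rewrite subrr.
Qed.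

Lemma intg_set0 f : intg set0 f.
Proof. exact: integrable_set0. Qed.

Lemma mble_itv (i : interval R) : mble [set` i].
Proof. exact: measurable_itv. Qed.

Hint Extern 0 (mble _) => exact: mble_itv : core.

Section affine.
Variables (a b : R).
Hypothesis a0 : a != 0.
Let phi : measurableTypeR R -> measurableTypeR R := fun t => a * t + b.
Let mphi : measurable_fun setT phi.
Proof.
apply: measurable_funD; last exact: measurable_cst.
by apply: measurable_funM; [exact: measurable_cst|exact: measurable_id].
Qed.

(** [|a|] times the image of Lebesgue measure under [phi] has the right value on half-open
    intervals, so uniqueness applies. A negative [a] exchanges the open and the closed end, which
    changes no length. *)
Lemma lebesgue_measure_affine (A : set R) : mble A ->
  (mu (phi @^-1` A) = `|a|^-1%:E * mu A)%E.
Proof.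
move=> mA.
pose nu' : {measure set (measurableTypeR R) -> \bar R} := pushforward mu phi.
pose nu := nu' mphi.
pose r : {nonneg R} := NngNum (normr_ge0 a).
have an0 : 0 < `|a| by rewrite normr_gt0.
suff h : mu A = (`|a|%:E * mu (phi @^-1` A))%E.
  by rewrite h muleA -EFinM mulVf ?gt_eqF// mul1e.
apply: (@lebesgue_measure_unique R (mscale r nu)) => //= _ [[x y]] _ <-.
rewrite /mscale/= /pushforward/=.
case: (ltgtP a 0) a0 => // ha _.
  have -> : phi @^-1` `]x, y] = `[(y - b) / a, (x - b) / a[%classic.
    apply/seteqP; split=> t /=; rewrite !in_itv/=.
      by rewrite ler_ndivrMr// ltr_ndivlMr// lerBrDr ltrBlDr mulrC /phi andbC.
    by rewrite ler_ndivrMr// ltr_ndivlMr// lerBrDr ltrBlDr mulrC /phi andbC.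
  rewrite !lebesgue_measure_itv/= !lte_fin ltr_nM2r ?invr_lt0// ltrD2r.
  case: ifP => // _; last by rewrite mule0.
  rewrite -!EFinB -EFinM; congr EFin; rewrite ltr0_norm//.
  by field; rewrite lt_eqF.
have -> : phi @^-1` `]x, y] = `](x - b) / a, (y - b) / a]%classic.
  apply/seteqP; split=> t /=; rewrite !in_itv/=.
    by rewrite ler_pdivlMr// ltr_pdivrMr// lerBrDr ltrBlDr mulrC /phi.
  by rewrite ler_pdivlMr// ltr_pdivrMr// lerBrDr ltrBlDr mulrC /phi.
rewrite !lebesgue_measure_itv/= !lte_fin ltr_pM2r ?invr_gt0// ltrD2r.
case: ifP => // _; last by rewrite mule0.
rewrite -!EFinB -EFinM; congr EFin; rewrite gtr0_norm//.
by field; rewrite gt_eqF.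
Qed.

Lemma ge0_integral_affine D (f : R -> \bar R) : mble D ->
  measurable_fun (D : set (measurableTypeR R)) f ->
  (forall t, D t -> (0 <= f t)%E) ->
  (\int[mu]_(t in phi @^-1` D) f (phi t) = `|a|^-1%:E * \int[mu]_(t in D) f t)%E.
Proof.
move=> mD mf f0.
pose nu' : {measure set (measurableTypeR R) -> \bar R} := pushforward mu phi.
pose nu := nu' mphi.
pose r : {nonneg R} := NngNum (normr_ge0 a).
have an0 : 0 < `|a| by rewrite normr_gt0.
have -> : (\int[mu]_(t in D) f t = \int[mscale r nu]_(t in D) f t)%E.
  apply: eq_measure_integral => A mA _.
  have h := lebesgue_measure_affine mA.
  rewrite /= /mscale/= /pushforward/=; rewrite h muleA -EFinM mulfV ?gt_eqF//.
  by rewrite mul1e.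
rewrite ge0_integral_mscale//= muleA -EFinM mulVf ?gt_eqF// mul1e.
rewrite ge0_integral_pushforward//.
by move=> t; rewrite inE => /f0.
Qed.

Lemma intg_affine D f : mble D -> intg D f -> intg (phi @^-1` D) (f \o phi).
Proof.
move=> mD /integrableP[mf fi].
have mD' : mble (phi @^-1` D) by rewrite -[X in mble X]setTI; exact: mphi.
apply/integrableP; split.
  apply: (measurable_comp mD _ mf); last by apply: measurable_funS mphi.
  by move=> _ [t Dt <-].
under eq_integral do rewrite /=.
rewrite (@ge0_integral_affine D (fun t => `|(f t)%:E|)%E)//.
  by apply: lte_mul_pinfty => //; rewrite lee_fin invr_ge0.
by apply: measurableT_comp.
Qed.

Lemma Rint_affine D f : mble D -> intg D f ->
  \int[mu]_(t in phi @^-1` D) f (phi t) = `|a|^-1 * \int[mu]_(t in D) f t.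
Proof.
move=> mD hf; have mf := measurable_int _ hf.
rewrite /Rintegral integralE [in RHS]integralE.
under [X in fine (X - _)]eq_integral do rewrite -/((EFin \o f) \o phi) funepos_comp/=.
under [X in fine (_ - X)]eq_integral do rewrite -/((EFin \o f) \o phi) funeneg_comp/=.
rewrite !ge0_integral_affine//; last 2 first.
- exact: measurable_funeneg.
- exact: measurable_funepos.
have h1 := integrable_pos_fin_num mD hf; have h2 := integrable_neg_fin_num mD hf.
have E c (X Y : \bar R) : X \is a fin_num -> Y \is a fin_num ->
  fine (c%:E * X - c%:E * Y)%E = c * fine (X - Y)%E.
  by case: X => //; case: Y => // x y _ _ /=; rewrite mulrBr.
exact: E.
Qed.

End affine.

Lemma intg_expR w : 0 < w -> intg `]0, +oo[ (fun t => expR (- w * t)) /\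
  \int[mu]_(t in `]0, +oo[) expR (- w * t) = w^-1.
Proof.
move=> w0.
have c : continuous (fun t : R => expR (- w * t)).
  move=> t; apply: continuous_comp; last exact: continuous_expR.
  by apply: continuousM; [exact: cst_continuous|exact: cvg_id].
have d (t : R) : is_derive t 1 (fun t => - (expR (- w * t) / w)) (expR (- w * t)).
  apply: is_derive_eq; rewrite /GRing.scale/=.
  by field; rewrite gt_eqF.
have key : (\int[mu]_(t in `[0%R, +oo[) (expR (- w * t))%:E = (w^-1)%:E)%E.
  rewrite (@ge0_continuous_FTC2y _ _ (fun t => - (expR (- w * t) / w)) _ 0)//.
  - by rewrite mulr0 expR0 mul1r -EFinB sub0r opprK.
  - exact: continuous_subspaceT.
  - rewrite -oppr0 -(mul0r w^-1); apply: cvgN; apply: cvgMl.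
    rewrite (_ : (fun x => expR (- w * x)) =
               (fun z => expR (- z)) \o (fun z => w * z)); last first.
      by apply: eq_fun => x; rewrite mulNr.
    apply: (@cvg_comp _ _ _ _ _ _ (pinfty_nbhs R)); last exact: cvgr_expR.
    exact: gt0_cvgMry.
  - by apply: cvg_at_right_filter; apply: cvgN; apply: cvgMl; exact: c.
  - by move=> t _; rewrite derive1E; have -> := @derive_val _ _ _ _ _ _ _ (d t).
have key2 : (\int[mu]_(t in `]0%R, +oo[) (expR (- w * t))%:E = (w^-1)%:E)%E.
  rewrite integral_itv_obnd_cbnd//.
  by apply/measurable_EFinP; apply: measurable_funTS; exact: continuous_measurable_fun.
split; last by rewrite /Rintegral key2.
apply/integrableP; split.
  by apply/measurable_EFinP; apply: measurable_funTS; exact: continuous_measurable_fun.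
under eq_integral do rewrite /= ger0_norm ?expR_ge0//.
by rewrite key2 ltry.
Qed.


(** The power may be unbounded near 0, so the integral is exhausted by the intervals from
    [1 / (n + 1)] to [T], on each of which the antiderivative [t^a / a] bounds it by [T^a / a]. *)
Lemma intg_powR (a T : R) : 0 < a -> intg `]0, T] (fun t => t `^ (a - 1)).
Proof.
move=> a0; have [T0|T0] := leP T 0.
  by rewrite set_itv_ge ?bnd_simp ?real_leNgt// -?leNgt//; exact: intg_set0.
have mf D : D `<=` `]0, +oo[ -> measurable_fun (D : set (measurableTypeR R))
    (fun t : R => t `^ (a - 1)).
  move=> sD; apply: msub_pos => // t t0.
  by apply: differentiable_continuous; apply/derivable1_diffP/derivable_powR; rewrite in_itv/= t0.
have sub x : 0 <= x -> `]x, T] `<=` `]0, +oo[.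
  by move=> x0 t /=; rewrite !in_itv/= andbT => /andP[/(le_lt_trans x0)].
have m0 := mf _ (sub 0 (lexx _)).
apply/integrableP; split; first exact/measurable_EFinP.
under eq_integral do rewrite /= ger0_norm ?powR_ge0//.
pose F (n : nat) : set R := `]n.+1%:R^-1, T]%classic.
have FE : `]0%R, T]%classic = \bigcup_n F n.
  apply/seteqP; split => t /=.
    rewrite in_itv/= => /andP[t0 tT].
    have /cvgrPdist_lt/(_ _ t0)[N _ hN] := @cvg_harmonic R.
    exists N => //; rewrite /F /= in_itv/= tT andbT.
    by have := hN N (leqnn _); rewrite /= sub0r normrN ger0_norm.
  move=> [n _]; rewrite /F /= !in_itv/= => /andP[h ->]; rewrite andbT.
  by apply: lt_trans h; rewrite invr_gt0.
rewrite FE.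
have : (\int[mu]_(t in F i) (t `^ (a - 1))%:E)%E @[i --> \oo] -->
    (\int[mu]_(t in \bigcup_i F i) (t `^ (a - 1))%:E)%E.
  apply: ge0_nondecreasing_set_cvg_integral.
  - move=> n m nm; apply/subsetPset => t; rewrite /F /= !in_itv/= => /andP[h ->].
    rewrite andbT; apply: le_lt_trans h.
    by rewrite lef_pV2 ?posrE// ler_nat.
  - by move=> i; exact: measurable_itv.
  - by move=> i; apply/measurable_EFinP; apply: mf; apply: sub; rewrite invr_ge0.
  - by move=> i t _; rewrite lee_fin powR_ge0.
move=> hc; apply: (@le_lt_trans _ _ (T `^ a / a)%:E); last by rewrite ltry.
move/cvg_lim : (hc) => <- //; apply: lime_le; first by apply/cvg_ex; eexists; exact: hc.
apply: nearW => n; rewrite /F; set x : R := n.+1%:R^-1.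
have x0 : 0 < x by rewrite invr_gt0.
have [Tx|xT] := leP T x.
  by rewrite set_itv_ge ?bnd_simp -?leNgt// integral_set0 lee_fin divr_ge0 ?powR_ge0// ltW.
rewrite integral_itv_obnd_cbnd; last first.
  by apply/measurable_EFinP; apply: mf; apply: sub; exact: ltW.
have dF (t : R) : 0 < t -> is_derive t 1 (fun t : R => t `^ a / a) (t `^ (a - 1)).
  move=> t0; have := is_derive1_powR a t0 => h; apply: is_derive_eq.
  by rewrite /GRing.scale/=; field; rewrite gt_eqF.
have cF (t : R) : 0 < t -> {for t, continuous (fun t : R => t `^ a / a)}.
  move=> t0; apply: differentiable_continuous; apply/derivable1_diffP.
  by have [] := dF t t0.
rewrite (@continuous_FTC2 _ _ (fun t : R => t `^ a / a))//.
- by rewrite -EFinB lee_fin gerBl divr_ge0 ?powR_ge0// ltW.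
- apply: derivable_within_continuous => t; rewrite in_itv/= => /andP[xt _].
  by apply: derivable_powR; rewrite in_itv/= andbT (lt_le_trans x0).
- split.
  + move=> t; rewrite in_itv/= => /andP[xt _].
    by have [] := dF t (lt_trans x0 xt).
  + by apply: cvg_at_right_filter; exact: cF.
  + by apply: cvg_at_left_filter; apply: cF; exact: lt_trans xT.
- move=> t; rewrite in_itv/= => /andP[xt _].
  by rewrite derive1E; have [_ ->] := dF t (lt_trans x0 xt).
Qed.

(** Cut at 1: before it the exponential is at most 1 and the power is integrable; after it the power
    is at most 1 because [a <= 1]. *)
Lemma intg_powR_expR (a w : R) : 0 < a -> a <= 1 -> 0 < w ->
  intg `]0, +oo[ (fun t => t `^ (a - 1) * expR (- w * t)).
Proof.
move=> a0 a1 w0; have [ie _] := intg_expR w0.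
have cp : pos_cont (fun t : R => t `^ (a - 1) * expR (- w * t)).
  move=> t t0; apply: continuousM.
    by apply: differentiable_continuous; apply/derivable1_diffP/derivable_powR; rewrite in_itv/= t0.
  apply: continuous_comp; last exact: continuous_expR.
  by apply: continuousM; [exact: cst_continuous|exact: cvg_id].
rewrite (_ : `]0, +oo[%classic = `]0, 1] `|` `]1, +oo[); last first.
  by rewrite -itv_bndbnd_setU// bnd_simp.
have h1 : intg `]0, 1] (fun t => t `^ (a - 1) * expR (- w * t)).
  apply: intg_le (intg_powR 1 a0); first exact: mble_itv.
    by apply: msub_pos => // t /=; rewrite !in_itv/= andbT => /andP[].
  move=> t; rewrite /= in_itv/= => /andP[t0 _].
  rewrite ger0_norm ?mulr_ge0 ?powR_ge0 ?expR_ge0// ler_piMr ?powR_ge0//.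
  by rewrite -expR0 ler_expR mulNr oppr_le0 mulr_ge0// ltW.
have h2 : intg `]1, +oo[ (fun t => t `^ (a - 1) * expR (- w * t)).
  have s1 : (`]1, +oo[ : set R) `<=` `]0, +oo[.
    by move=> t /=; rewrite !in_itv/= !andbT => /(lt_trans ltr01).
  apply: (@intg_le _ _ (fun t => expR (- w * t))); first exact: mble_itv.
  - by apply: msub_pos.
  - move=> t; rewrite /= in_itv/= andbT => t1.
    rewrite ger0_norm ?mulr_ge0 ?powR_ge0 ?expR_ge0// ler_piMl ?expR_ge0//.
    rewrite -[X in _ <= X](powRr0 t); apply: ler_powR; first exact: ltW.
    by rewrite subr_le0.
  - by apply: intgS ie => //; exact: mble_itv.
apply/integrableP; split.
  apply/measurable_funU; [exact: measurable_itv|exact: measurable_itv|].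
  by split; [case/integrableP : h1|case/integrableP : h2].
rewrite ge0_integral_setU//.
- by case/integrableP : h1 => _ h; case/integrableP : h2 => _ h'; rewrite lte_add_pinfty.
- apply: measurableT_comp => //; apply/measurable_funU.
  + exact: measurable_itv.
  + exact: measurable_itv.
  + by split; [case/integrableP : h1|case/integrableP : h2].
- apply/disj_setPS => t /=; rewrite !in_itv/= => -[/andP[_ h]] /andP[h' _].
  by have := lt_le_trans h' h; rewrite ltxx.
Qed.

End HalfLine.

#[global] Hint Extern 0 (mble _) => exact: mble_itv : core.

(** * Vector-valued integrals *)

Section VectorIntegral.
Context {R : realType}.
Notation mu := (@lebesgue_measure R).

Section continuity.
Context {V W : hilbertType R}.

Lemma cvg_nrm (I : Type) (F : set_system I) {FF : Filter F} (f : I -> V) (a : V) :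
  f @ F --> a -> (fun t => nrm (f t)) @ F --> nrm a.
Proof.
move=> /cvg_nrmP/cvgrPdist_lt h; apply/cvgrPdist_lt => e e0.
have := h e e0; apply: filterS => t; rewrite sub0r normrN ger0_norm ?nrm_ge0//.
by apply: le_lt_trans; rewrite distrC; exact: nrm_rev.
Qed.

Lemma ip_polar (x y : V) : ip x y = 4^-1 * (nrm (x + y) ^+ 2 - nrm (x - y) ^+ 2).
Proof.
rewrite -!ip_nrm !(ipBl, ipBr, ipDl, ipDr) (ipC y x).
by field.
Qed.

(** Polarization reduces the joint continuity of [ip] to the continuity of the norm. *)
Lemma cvg_ip (I : Type) (F : set_system I) {FF : Filter F} (f g : I -> V) (a b : V) :
  f @ F --> a -> g @ F --> b -> (fun t => ip (f t) (g t)) @ F --> ip a b.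
Proof.
move=> hf hg; rewrite (_ : (fun t => _) = (fun t => 4^-1 * (nrm (f t + g t) ^+ 2 - nrm (f t - g t) ^+ 2))); last first.
  by apply/funext => t; exact: ip_polar.
rewrite ip_polar; apply: cvgMr; apply: cvgB; rewrite expr2;
  under eq_cvg do rewrite expr2; apply: cvgM; apply: cvg_nrm;
  by [exact: cvgD|exact: cvgB].
Qed.

Lemma pos_cont_ip (f g : R -> V) : pos_cont f -> pos_cont g ->
  pos_cont (fun t => ip (f t) (g t)).
Proof. by move=> hf hg t t0; apply: cvg_ip; [exact: hf|exact: hg]. Qed.

Lemma pos_cont_nrm (f : R -> V) : pos_cont f -> pos_cont (fun t => nrm (f t)).
Proof. by move=> hf t t0; apply: cvg_nrm; exact: hf. Qed.

Lemma pos_cont_blin (T : V -> W) (f : R -> V) : blin T -> pos_cont f ->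
  pos_cont (fun t => T (f t)).
Proof. by move=> bT hf t t0; apply: blin_cvg => //; exact: hf. Qed.

Lemma pos_cont_cst (x : V) : pos_cont (fun _ : R => x).
Proof. by move=> t _; exact: cst_continuous. Qed.

Lemma pos_contD (f g : R -> V) : pos_cont f -> pos_cont g ->
  pos_cont (fun t => f t + g t).
Proof. by move=> hf hg t t0; apply: cvgD; [exact: hf|exact: hg]. Qed.

Lemma cvg_scal (I : Type) (F : set_system I) {FF : Filter F} (r : I -> R) (f : I -> V)
   (c : R) (a : V) :
  r @ F --> c -> f @ F --> a -> (fun t => (r t)%:C *: f t) @ F --> c%:C *: a.
Proof.
move=> hr hf; apply/cvg_nrmP.
have h1 : (fun t => `|r t| * nrm (f t - a) + `|r t - c| * nrm a) @ F --> (0 : R).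
  rewrite -(addr0 0); apply: cvgD.
    rewrite -(mulr0 `|c|); apply: cvgM; first exact: cvg_norm.
    by apply/cvg_nrmP.
  rewrite -(mul0r (nrm a)); apply: cvgMl; rewrite -(normr0 R); apply: cvg_norm.
  by rewrite -(subrr c); apply: cvgB => //; exact: cvg_cst.
apply: squeeze_cvgr (cvg_cst 0) h1; apply: nearW => t; rewrite nrm_ge0/=.
have -> : (r t)%:C *: f t - c%:C *: a = (r t)%:C *: (f t - a) + (r t - c)%:C *: a.
  by rewrite scalerBr rmorphB scalerBl addrA subrK.
by rewrite -!nrmZ; exact: nrmD.
Qed.

Lemma pos_contZ (r : R -> R) (f : R -> V) : pos_cont r -> pos_cont f ->
  pos_cont (fun t => (r t)%:C *: f t).
Proof. by move=> hr hf t t0; apply: cvg_scal; [exact: hr|exact: hf]. Qed.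

Lemma pos_contM (f g : R -> R) : pos_cont f -> pos_cont g ->
  pos_cont (fun t => f t * g t).
Proof. by move=> hf hg t t0; apply: cvgM; [exact: hf|exact: hg]. Qed.

Lemma vmeas_open (D : set R) (f : R -> V) : open D -> (forall t, D t -> {for t, continuous f}) ->
  vmeasurable D f.
Proof.
move=> oD cf U oU; apply: open_measurable; rewrite openE => t [Dt Uft].
apply: filterI; first exact: oD.
by apply: (cf t Dt); move: oU; rewrite openE => /(_ _ Uft).
Qed.

Lemma vmeas_pos (f : R -> V) : pos_cont f -> vmeasurable `]0, +oo[ f.
Proof.
move=> cf; apply: vmeas_open; first exact: interval_open.
by move=> t /=; rewrite in_itv/= andbT; exact: cf.
Qed.

Lemma vmeasS (D E : set R) (f : R -> V) : mble D -> D `<=` E -> vmeasurable E f ->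
  vmeasurable D f.
Proof.
move=> mD DE mf U /mf h; rewrite (_ : _ `&` _ = D `&` (E `&` f @^-1` U)).
  exact: measurableI.
by rewrite setIA (setIidl DE).
Qed.

Lemma vmeas_pos0 (f : R -> V) : pos_cont f -> vmeasurable `[0, +oo[ f.
Proof.
move=> cf U oU.
have -> : `[0, +oo[ `&` f @^-1` U = (`]0, +oo[ `&` f @^-1` U) `|` ([set 0] `&` f @^-1` U).
  rewrite -setIUl; congr (_ `&` _); apply/seteqP; split => t /=.
    by rewrite !in_itv/= !andbT le_eqVlt => /orP[/eqP<-|]; [right|left].
  by rewrite !in_itv/= !andbT => -[/ltW//|->].
apply: measurableU; first exact: vmeas_pos.
have [h|h] := pselect (U (f 0)).
  rewrite (_ : _ `&` _ = [set 0]); first exact: measurable_set1.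
  by apply/seteqP; split => [t []//|t /= ->].
by rewrite (_ : _ `&` _ = set0)//; apply/seteqP; split => // t [/= ->].
Qed.

Lemma vmeas_meas (D : set R) (f : R -> V) (phi : V -> R) : mble D -> vmeasurable D f ->
  continuous phi -> measurable_fun (D : set (measurableTypeR R)) (fun t => phi (f t)).
Proof.
move=> mD mf cphi _; apply: (measurability _ (RGenOpens.measurableE R)); last exact: mD.
move=> _ [_ [a [b ->] <-]].
rewrite (_ : D `&` _ = D `&` f @^-1` (phi @^-1` `]a, b[))//.
by apply: mf; apply: open_comp => //; exact: interval_open.
Qed.

Lemma ip_continuous (z : V) : continuous (ip ^~ z).
Proof. by move=> x; apply: cvg_ip; [exact: cvg_id|exact: cvg_cst]. Qed.

Lemma nrm_continuous : continuous (@nrm R V).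
Proof. by move=> x; apply: cvg_nrm; exact: cvg_id. Qed.

Lemma in_Lp1P (D : set R) (f : R -> V) : mble D ->
  in_Lp 1 D f <-> (vmeasurable D f /\ intg D (fun t => nrm (f t))).
Proof.
move=> mD; split=> -[mf h]; split=> //.
  apply/integrableP; split.
    by apply/measurable_EFinP; apply: vmeas_meas nrm_continuous.
  move: h; under eq_integral do rewrite powRr1 ?nrm_ge0//.
  by under [in X in _ -> X]eq_integral do rewrite /= ger0_norm ?nrm_ge0//.
case/integrableP : h => _.
under eq_integral do rewrite /= ger0_norm ?nrm_ge0//.
by under [in X in _ -> X]eq_integral do rewrite powRr1 ?nrm_ge0//.
Qed.

Lemma intg_ip (D : set R) (f : R -> V) z : mble D -> in_Lp 1 D f ->
  intg D (fun t => ip (f t) z).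
Proof.
move=> mD /(in_Lp1P _ mD)[mf h]; apply: (intg_le mD _ _ (intgZ (nrm z) mD h)).
  by apply: (@vmeas_meas D f (fun x => ip x z) mD mf); exact: ip_continuous.
by move=> t _; rewrite mulrC; exact: ip_le.
Qed.

(** The real condition at [i z] carries the imaginary part of the complex one. *)
Lemma is_vintegralP (D : set R) (f : R -> V) x : in_Lp 1 D f ->
  is_vintegral D f x <-> forall z, ip x z = \int[mu]_(t in D) ip (f t) z.
Proof.
move=> L1; split=> [[_ h] z|h].
  by rewrite /ip h.
split=> // z; rewrite hdotE !h /cintegral; congr (_ +i* _).
by apply: eq_Rintegral => t _; rewrite hdotE.
Qed.

Lemma vintegral_unique (D : set R) (f : R -> V) x : in_Lp 1 D f ->
  (forall z, ip x z = \int[mu]_(t in D) ip (f t) z) -> vintegral D f = x.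
Proof.
move=> L1 h; have ix : is_vintegral D f x by apply/is_vintegralP.
have : is_vintegral D f (vintegral D f).
  by apply: (@xgetPP _ [set x | is_vintegral D f x]); exists x.
by move=> /(is_vintegralP _ L1) h'; apply: ip_eq => z; rewrite h' h.
Qed.

(** What has to be shown is that the vector exists: [z |-> \int ip (f t) z] is linear and bounded by
    [\int |f|], so Riesz represents it. *)
Lemma vintegralP (D : set R) (f : R -> V) : mble D -> in_Lp 1 D f ->
  forall z, ip (vintegral D f) z = \int[mu]_(t in D) ip (f t) z.
Proof.
move=> mD L1; have [mf inf] := (in_Lp1P f mD).1 L1.
have [|||p hp _] := @riesz R V (fun z => \int[mu]_(t in D) ip (f t) z)
    (\int[mu]_(t in D) nrm (f t)).
- by apply: Rintegral_ge0 => t _; exact: nrm_ge0.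
- move=> r x y; rewrite -RintegralZl//; last exact: intg_ip.
  rewrite -RintegralD//; last 2 first.
  + by apply: (intgZ _ mD); exact: intg_ip.
  + exact: intg_ip.
  by apply: eq_Rintegral => t _; rewrite ipDr ipZr.
- move=> z; rewrite mulrC -RintegralZl//.
  apply: le_trans (ler_norm _) _; apply: Rint_abs_le => //.
  + exact: intg_ip.
  + exact: intgZ.
  by move=> t _; rewrite mulrC; exact: ip_le.
rewrite (@vintegral_unique _ _ p L1)//.
  by move=> z; rewrite hp ipC.
by move=> z; rewrite ipC -hp.
Qed.

Lemma vintegral_le (D : set R) (f : R -> V) (g : R -> R) : mble D -> in_Lp 1 D f ->
  intg D g -> (forall t, D t -> nrm (f t) <= g t) ->
  nrm (vintegral D f) <= \int[mu]_(t in D) g t.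
Proof.
move=> mD L1 ig fg; have [mf inf] := (in_Lp1P f mD).1 L1.
apply: nrm_le_ip.
  by apply: Rintegral_ge0 => t /fg; apply: le_trans; exact: nrm_ge0.
move=> z; rewrite vintegralP// mulrC -RintegralZl//.
apply: le_trans (ler_norm _) _; apply: Rint_abs_le => //.
- exact: intg_ip.
- exact: intgZ.
move=> t Dt; apply: le_trans (ip_le _ _) _.
by rewrite mulrC ler_wpM2l ?nrm_ge0// fg.
Qed.

Lemma in_Lp1_dom (D : set R) (f : R -> V) (g : R -> R) : mble D -> vmeasurable D f ->
  intg D g -> (forall t, D t -> nrm (f t) <= g t) -> in_Lp 1 D f.
Proof.
move=> mD mf ig fg; apply/in_Lp1P => //; split=> //.
apply: (intg_le mD _ _ ig); first by apply: vmeas_meas nrm_continuous.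
by move=> t Dt; rewrite ger0_norm ?nrm_ge0// fg.
Qed.

End continuity.

End VectorIntegral.

(** * Exponentially stable semigroups *)

Section IntervalIntegrals.
Context {R : realType}.
Notation mu := (@lebesgue_measure R).
Implicit Types (f g : R -> R).

Lemma itv_sub_pos (a : R) (b : itv_bound R) : 0 <= a ->
  [set` Interval (BRight a) b] `<=` `]0, +oo[.
Proof.
move=> a0 t /=; rewrite !itv_boundlr/= !bnd_simp => /andP[at_ _].
by rewrite (le_lt_trans a0).
Qed.

Lemma intg_itv f (a : R) (b : itv_bound R) : 0 <= a -> intg `]0, +oo[ f ->
  intg [set` Interval (BRight a) b] f.
Proof. by move=> a0; apply: intgS; [exact: mble_itv|exact: mble_itv|exact: itv_sub_pos]. Qed.

Lemma Rint_cut f (a b : R) (c : itv_bound R) : 0 <= a -> a <= b -> (BRight b <= c)%O ->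
  intg [set` Interval (BRight a) c] f ->
  \int[mu]_(t in [set` Interval (BRight a) c]) f t =
  \int[mu]_(t in `]a, b[) f t + \int[mu]_(t in [set` Interval (BRight b) c]) f t.
Proof.
move=> a0 ab bc hf.
have := Rintegral_itvB hf (_ : (BRight a <= BRight b)%O) bc; rewrite bnd_simp => /(_ ab) <-.
rewrite [X in _ = X + _](@Rintegral_itv_bndo_bndc _ (BRight a) b f).
  by rewrite addrC subrK.
apply: intgS hf; [exact: mble_itv|exact: mble_itv|].
by apply: subset_itvl; apply: le_trans bc; rewrite bnd_simp.
Qed.

Lemma preim_shift (h : R) (a : R) : (fun t => 1 * t + h) @^-1` `]a + h, +oo[ = `]a, +oo[%classic.
Proof. by apply/seteqP; split=> t /=; rewrite !in_itv/= !andbT mul1r ltrD2r. Qed.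

Lemma Rint_shift f (h : R) : 0 <= h -> intg `]0, +oo[ f ->
  \int[mu]_(t in `]0, +oo[) f (t + h) = \int[mu]_(t in `]h, +oo[) f t.
Proof.
move=> h0 hf; have := @Rint_affine R 1 h (oner_neq0 _) `]0 + h, +oo[%classic f (mble_itv _).
rewrite preim_shift => /(_ _)/wrap[]; first by apply: intg_itv; rewrite ?add0r.
rewrite normr1 invr1 mul1r add0r => <-.
by apply: eq_Rintegral => t _; rewrite mul1r.
Qed.

Lemma preim_refl (s a b : R) : (fun t => -1 * t + s) @^-1` `]a, b[ = `]s - b, s - a[%classic.
Proof.
apply/seteqP; split=> t /=; rewrite !in_itv/= mulN1r => /andP[h1 h2]; apply/andP; split; lra.
Qed.

Lemma intg_refl f (s a b : R) : intg `]a, b[ f -> intg `]s - b, s - a[ (fun t => f (s - t)).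
Proof.
move=> hf; have a1 : -1 != 0 :> R by rewrite oppr_eq0 oner_neq0.
have := @intg_affine R (-1) s a1 `]a, b[%classic f (mble_itv _) hf.
rewrite preim_refl.
by rewrite (_ : f \o _ = (fun t => f (s - t)))//; apply/funext => t /=; rewrite mulN1r addrC.
Qed.

Lemma Rint_refl f (s a b : R) : intg `]a, b[ f ->
  \int[mu]_(t in `]s - b, s - a[) f (s - t) = \int[mu]_(t in `]a, b[) f t.
Proof.
move=> hf; have a1 : -1 != 0 :> R by rewrite oppr_eq0 oner_neq0.
have := @Rint_affine R (-1) s a1 `]a, b[%classic f (mble_itv _) hf.
rewrite preim_refl normrN normr1 invr1 mul1r => <-.
by apply: eq_Rintegral => t _; rewrite mulN1r addrC.
Qed.

End IntervalIntegrals.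

Section RealSemigroup.
Context {R : realType} {V : hilbertType R}.
Notation mu := (@lebesgue_measure R).

(** With real-linear operators and explicit constants, the same theory applies to the given
    semigroup, its adjoint, its exponential rescalings and the optimal state semigroup. *)
Definition rsg (S : R -> V -> V) (M w : R) :=
  [/\ forall t, 0 <= t -> blin (S t),
      forall x, S 0 x = x,
      forall s t x, 0 <= s -> 0 <= t -> S (s + t) x = S s (S t x),
      forall x, S t x @[t --> (0 : R)^'+] --> x
    & [/\ 1 <= M, 0 < w & forall t x, 0 <= t ->
        nrm (S t x) <= M * expR (- w * t) * nrm x]].

Definition isgen (S : R -> V -> V) (x y : V) :=
  t^-1%:C *: (S t x - x) @[t --> (0 : R)^'+] --> y.

Section basic.
Context (S : R -> V -> V) (M w : R).
Hypothesis hS : rsg S M w.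

Let M0 : 0 <= M. Proof. by case: hS => _ _ _ _ [h _ _]; apply: le_trans h. Qed.
Let w0 : 0 < w. Proof. by case: hS => _ _ _ _ []. Qed.
Lemma rsg_blin t : 0 <= t -> blin (S t). Proof. by case: hS => h _ _ _ _; exact: h. Qed.
Lemma rsg0 x : S 0 x = x. Proof. by case: hS. Qed.
Lemma rsgD s t x : 0 <= s -> 0 <= t -> S (s + t) x = S s (S t x).
Proof. by case: hS => _ _ h _ _; exact: h. Qed.
Lemma rsg_exp t x : 0 <= t -> nrm (S t x) <= M * expR (- w * t) * nrm x.
Proof. by case: hS => _ _ _ _ [_ _ h]; exact: h. Qed.

Lemma rsgC s t x : 0 <= s -> 0 <= t -> S s (S t x) = S t (S s x).
Proof. by move=> s0 t0; rewrite -rsgD// addrC rsgD. Qed.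

Lemma rsg_le t x : 0 <= t -> nrm (S t x) <= M * nrm x.
Proof.
move=> t0; apply: le_trans (rsg_exp _ t0) _; rewrite ler_wpM2r ?nrm_ge0//.
by rewrite ler_piMr// -expR0 ler_expR mulNr oppr_le0 mulr_ge0// ltW.
Qed.

(** Factoring out the earlier time makes strong continuity at 0 uniform along the whole orbit. *)
Lemma rsg_mod s t x : 0 <= s -> 0 <= t ->
  nrm (S s x - S t x) <= M * nrm (S `|s - t| x - x).
Proof.
wlog st : s t / s <= t => [h s0 t0|s0 t0].
  have [st|/ltW st] := leP s t; first exact: h.
  by rewrite nrmBC distrC; exact: h.
have -> : S t x = S s (S `|s - t| x).
  rewrite -rsgD ?normr_ge0//; congr (S _ x).
  by rewrite ler0_norm ?subr_le0// opprB subrKC.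
by rewrite -(blinB _ _ (rsg_blin s0)) [X in _ <= _ * X]nrmBC; exact: rsg_le.
Qed.

Lemma rsg_near0 x (e : R) : 0 < e ->
  exists2 d, 0 < d & forall h, 0 <= h -> h < d -> nrm (S h x - x) < e.
Proof.
move=> e0; case: hS => _ _ _ c _.
have /cvg_nrmP/cvgrPdist_lt/(_ _ e0) := c x.
rewrite -nbhs_nearE => /nbhs_right0P[d d0 hd].
exists d => // h; rewrite le_eqVlt => /predU1P[<- _|h0 hlt].
  by rewrite rsg0 subrr nrm0.
have hb : ball_ Num.norm 0 d h by rewrite /ball_/= sub0r normrN gtr0_norm.
by have := hd h hb h0; rewrite sub0r normrN add0r ger0_norm ?nrm_ge0.
Qed.

Lemma rsg_cont x : pos_cont (fun t => S t x).
Proof.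
move=> t t0; apply/cvg_nrmP/cvgrPdist_lt => e e0.
have M1 : 0 < M + 1 by rewrite ltr_wpDl.
have [d d0 hd] := @rsg_near0 x (e / (M + 1)) (divr_gt0 e0 M1).
near=> s.
rewrite sub0r normrN ger0_norm ?nrm_ge0//.
have s0 : 0 <= s by apply: ltW; near: s; exact: lt_nbhsr.
apply: le_lt_trans (rsg_mod _ s0 (ltW t0)) _.
have h : nrm (S `|s - t| x - x) < e / (M + 1).
  by apply: hd => //; near: s; exists d => //= u; rewrite /ball/= distrC.
move: h; rewrite ltr_pdivlMr// => h; apply: le_lt_trans h.
by rewrite mulrC ler_wpM2l ?nrm_ge0// lerDl.
Unshelve. all: by end_near. Qed.

Definition weight (r : R -> R) :=
  pos_cont r /\ intg `]0, +oo[ (fun t => `|r t| * expR (- w * t)).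

(** One integral serves three purposes: the weight 1 gives [- A^-1], the weight [exp(-l t)] the
    resolvent at [l], and the weight [t^(th - 1)] the fractional power [(-A)^-th] up to its Gamma
    factor. *)
Definition wint (r : R -> R) (x : V) : V :=
  vintegral `]0, +oo[ (fun t => (r t)%:C *: S t x).

Lemma wint_L1 r x : weight r -> in_Lp 1 `]0, +oo[ (fun t => (r t)%:C *: S t x).
Proof.
move=> [cr ir].
apply: (in_Lp1_dom (mble_itv _) _ (intgZ (M * nrm x) (mble_itv _) ir)).
  by apply: vmeas_pos; apply: pos_contZ => //; exact: rsg_cont.
move=> t /=; rewrite in_itv/= andbT => t0.
rewrite nrmZ; have := rsg_exp x (ltW t0); have := normr_ge0 (r t).
by set a := nrm _; set b := nrm _; set c := expR _ => h1 h2; nra.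
Qed.

Lemma wintP r x z : weight r ->
  ip (wint r x) z = \int[mu]_(t in `]0, +oo[) (r t * ip (S t x) z).
Proof.
move=> wr; rewrite (vintegralP (mble_itv _) (wint_L1 x wr)).
by apply: eq_Rintegral => t _; rewrite ipZl.
Qed.

Lemma wint_intg r x z : weight r -> intg `]0, +oo[ (fun t => r t * ip (S t x) z).
Proof.
move=> wr; have := intg_ip z (mble_itv _) (wint_L1 x wr).
by apply: eq_integrable => // t _; rewrite /= ipZl.
Qed.

Lemma wint_le r x : weight r ->
  nrm (wint r x) <= M * (\int[mu]_(t in `]0, +oo[) (`|r t| * expR (- w * t))) * nrm x.
Proof.
move=> wr; rewrite mulrAC -RintegralZl//; last exact: wr.2.
apply: (vintegral_le (mble_itv _) (wint_L1 x wr)).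
  by apply: (intgZ _ (mble_itv _)); exact: wr.2.
move=> t /=; rewrite in_itv/= andbT => t0.
rewrite nrmZ; have := rsg_exp x (ltW t0); have := normr_ge0 (r t).
by set a := nrm _; set b := nrm _; set c := expR _ => h1 h2; nra.
Qed.

Lemma wint_blin r : weight r -> blin (wint r).
Proof.
move=> wr; split; last first.
  exists (M * (\int[mu]_(t in `]0, +oo[) (`|r t| * expR (- w * t)))).
    by rewrite mulr_ge0// Rintegral_ge0// => t _; rewrite mulr_ge0// expR_ge0.
  by move=> x; exact: wint_le.
move=> a x y; apply: ip_eq => z; rewrite ipDl ipZl !wintP// -RintegralZl//; last exact: wint_intg.
rewrite -RintegralD//; last 2 first.
- by apply: (intgZ _ (mble_itv _)); exact: wint_intg.
- exact: wint_intg.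
apply: eq_Rintegral => t; rewrite inE/= in_itv/= andbT => t0.
by rewrite (rsg_blin (ltW t0)).1 ipDl ipZl; ring.
Qed.

Lemma wint_comm r (T : V -> V) x : weight r -> blin T ->
  (forall t y, 0 < t -> T (S t y) = S t (T y)) -> T (wint r x) = wint r (T x).
Proof.
move=> wr bT com; apply: ip_eq => z; rewrite radjP// !wintP//.
apply: eq_Rintegral => t; rewrite inE/= in_itv/= andbT => t0.
by rewrite -radjP// com.
Qed.

Lemma weight1 : weight (cst 1).
Proof.
split; first by move=> t _; exact: cst_continuous.
have := (intg_expR w0).1; apply: eq_integrable => // t _ /=.
by rewrite normr1 mul1r.
Qed.

(* [A^-1], where [A] is the generator of [S]. *)
Definition Ainvs (x : V) : V := - wint (cst 1) x.

Lemma Ainvs_blin : blin Ainvs.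
Proof.
have := blin_scale (-1) (wint_blin weight1).
by rewrite rmorphN1; under eq_fun do rewrite scaleN1r.
Qed.

Lemma AinvsP x z : ip (Ainvs x) z = - \int[mu]_(t in `]0, +oo[) ip (S t x) z.
Proof.
rewrite ipNl wintP//; last exact: weight1.
by congr (- _); apply: eq_Rintegral => t _; rewrite mul1r.
Qed.

Lemma orbit_intg x z : intg `]0, +oo[ (fun t => ip (S t x) z).
Proof.
have := wint_intg x z weight1; apply: eq_integrable => // t _.
by rewrite /= mul1r.
Qed.

Lemma Ainvs_le x : nrm (Ainvs x) <= M / w * nrm x.
Proof.
rewrite nrmN; apply: le_trans (wint_le _ weight1) _; rewrite -(intg_expR w0).2.
rewrite le_eqVlt; apply/orP; left; apply/eqP; congr (_ * _ * _).
by apply: eq_Rintegral => t _; rewrite normr1 mul1r.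
Qed.

Lemma Ainvs_comm (T : V -> V) x : blin T ->
  (forall t y, 0 < t -> T (S t y) = S t (T y)) -> T (Ainvs x) = Ainvs (T x).
Proof. by move=> bT com; rewrite blinN// (wint_comm _ weight1). Qed.

Lemma SAinvs t x : 0 <= t -> S t (Ainvs x) = Ainvs (S t x).
Proof.
move=> t0; apply: Ainvs_comm => [|s y s0]; first exact: rsg_blin.
by rewrite rsgC// ltW.
Qed.

Lemma SAinvs_tail t x z : 0 <= t ->
  ip (S t (Ainvs x)) z = - \int[mu]_(s in `]t, +oo[) ip (S s x) z.
Proof.
move=> t0; rewrite SAinvs// AinvsP.
rewrite -(@Rint_shift R (fun s => ip (S s x) z) t)//; last exact: orbit_intg.
congr (- _); apply: eq_Rintegral => s; rewrite inE/= in_itv/= andbT => s0.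
by rewrite rsgD// ltW.
Qed.

(** Integrated form of [d/dt S(t) A^-1 x = S(t) x], obtained as a difference of two tails of the
    integral that defines [A^-1]. *)
Lemma SAinvsB s t x z : 0 <= s -> s <= t ->
  ip (S t (Ainvs x) - S s (Ainvs x)) z = \int[mu]_(r in `]s, t[) ip (S r x) z.
Proof.
move=> s0 st; rewrite ipBl !SAinvs_tail//; last exact: le_trans st.
rewrite (@Rint_cut _ _ s t)//; last by apply: intg_itv => //; exact: orbit_intg.
by ring.
Qed.

(** By [SAinvsB] the difference quotient is the mean of the orbit of [y] over []0, h[], which tends
    to [y]. *)
Lemma isgen_Ainvs y : isgen S (Ainvs y) y.
Proof.
apply/cvg_nrmP/cvgrPdist_le => e e0.
have [d d0 hd] := @rsg_near0 y e e0.
near=> h; have h0 : 0 < h by near: h; exact: nbhs_right_gt.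
have hd' : h < d by near: h; exact: nbhs_right_lt.
rewrite sub0r normrN ger0_norm ?nrm_ge0//; apply: nrm_le_ip; first exact: ltW.
have h0' : 0 <= h := ltW h0.
move=> z; rewrite ipBl ipZl -[X in S h _ - X]rsg0 SAinvsB//.
have -> : ip y z = h^-1 * \int[mu]_(r in `]0, h[) (cst (ip y z) r).
  by rewrite Rint_cst// subr0; field; rewrite gt_eqF.
have i1 : intg `]0, h[ (fun t => ip (S t y) z) by apply: intg_itv => //; exact: orbit_intg.
rewrite -mulrBr -RintegralB//; last exact: intg_cst.
rewrite ler_pdivrMl//.
have -> : h * (e * nrm z) = \int[mu]_(r in `]0, h[) cst (e * nrm z) r.
  by rewrite Rint_cst// subr0 mulrC.
apply: le_trans (ler_norm _) _; apply: Rint_abs_le => //.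
- by apply: intgB => //; exact: intg_cst.
- exact: intg_cst.
move=> t /=; rewrite in_itv/= => /andP[t0 th]; rewrite -ipBl; apply: le_trans (ip_le _ _) _.
by rewrite ler_wpM2r ?nrm_ge0//; apply/ltW/hd; [exact: ltW|exact: lt_trans th _].
Unshelve. all: by end_near. Qed.

Lemma isgen_unique x y y' : isgen S x y -> isgen S x y' -> y = y'.
Proof. by move=> h h'; apply: (cvg_unique _ h h'); exact: norm_hausdorff. Qed.

(** [Ainvs] commutes with [S], so it maps the difference quotients of [x] to those of [Ainvs S x];
    the former limit is [Ainvs S y], the latter [x]. *)
Lemma Ainvs_isgen x y : isgen S x y -> Ainvs y = x.
Proof.
move=> h; have h1 : isgen S (Ainvs x) x := @isgen_Ainvs x.
have h2 : t^-1%:C *: (S t (Ainvs x) - Ainvs x) @[t --> (0 : R)^'+] --> Ainvs y.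
  apply: (cvg_trans _ (blin_cvg Ainvs_blin h)); apply: near_eq_cvg.
  near=> t; have t0 : 0 < t by near: t; exact: nbhs_right_gt.
  rewrite blinZ; last exact: Ainvs_blin.
  by rewrite blinB ?SAinvs ?ltW//; exact: Ainvs_blin.
by apply: (cvg_unique _ h2 h1); exact: norm_hausdorff.
Unshelve. all: by end_near. Qed.

Lemma isgenP x y : isgen S x y <-> x = Ainvs y.
Proof. by split=> [/Ainvs_isgen//|->]; exact: isgen_Ainvs. Qed.

Lemma Ainvs_inj y y' : Ainvs y = Ainvs y' -> y = y'.
Proof.
move=> h; have h1 : isgen S (Ainvs y) y := @isgen_Ainvs y.
by apply: (isgen_unique h1); rewrite h; exact: isgen_Ainvs.
Qed.

End basic.
End RealSemigroup.

(* Abstracting the inner products first keeps [ring] from comparing the vectors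
   inside them up to conversion. *)
Ltac vec := apply: ip_eq => ?; rewrite !(ipBl, ipDl, ipNl, ipZl, ip0l);
  repeat (match goal with |- context [ip ?a ?b] => generalize (ip a b) => ? end); ring.

(** * The adjoint semigroup and density of ranges *)

Section SemigroupAdjoint.
Context {R : realType} {V : hilbertType R}.
Notation mu := (@lebesgue_measure R).
Context {S : R -> V -> V} {M w : R}.
Hypothesis hS : rsg S M w.
Let M0 : 0 <= M. Proof. by case: hS => _ _ _ _ [h _ _]; apply: le_trans h. Qed.
Let w0 : 0 < w. Proof. by case: hS => _ _ _ _ []. Qed.
Let bAi := Ainvs_blin hS.

(** [Ainvs] applied to the difference quotients of [y] gives those of [Ainvs S y], which converge to
    [y]. *)
Lemma dense_range_Ainvs (y : V) (e : R) : 0 < e -> exists v, nrm (y - Ainvs S v) < e.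
Proof.
move=> e0; have : isgen S (Ainvs S y) y := isgen_Ainvs hS (y := y).
move=> /cvg_nrmP/cvgrPdist_lt/(_ _ e0) h.
near (0 : R)^'+ => t; have t0 : 0 < t by near: t; exact: nbhs_right_gt.
exists (t^-1%:C *: (S t y - y)).
rewrite (blinZ _ _ bAi) (blinB _ _ bAi) -(SAinvs hS); last exact: ltW.
have : `|0 - nrm (t^-1%:C *: (S t (Ainvs S y) - Ainvs S y) - y)| < e.
  by near: t; exact: h.
by rewrite sub0r normrN ger0_norm ?nrm_ge0// nrmBC.
Unshelve. all: by end_near. Qed.

Lemma orth_range (T : V -> V) (z : V) :
  (forall y (e : R), 0 < e -> exists v, nrm (y - T v) < e) ->
  (forall v, ip (T v) z = 0) -> z = 0.
Proof.
move=> hd hz; apply: nrm0_eq0; apply/eqP; rewrite eq_le nrm_ge0 andbT.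
apply/ler_addgt0Pr => e e0; rewrite add0r.
have [v hv] := hd z e e0.
have := ip_le_nrm (z - T v) z; rewrite ipBl hz subr0 ip_nrm expr2.
have [->|n0] := eqVneq (nrm z) 0; first by move=> _; exact: ltW.
have n1 : 0 < nrm z by rewrite lt_def n0 nrm_ge0.
by rewrite ler_pM2r// => h; apply: le_trans h (ltW hv).
Qed.

Lemma radj_Ainvs_inj (y y' : V) : radj (Ainvs S) y = radj (Ainvs S) y' -> y = y'.
Proof.
move=> h; apply/eqP; rewrite -subr_eq0; apply/eqP.
apply: (orth_range dense_range_Ainvs) => v.
by rewrite radjP// blinB ?h ?subrr ?ip0r//; exact: blin_radj.
Qed.

(** The orthogonal complement of the range of [radj T] is the kernel of [T]. *)
Lemma dense_range_radj (T : V -> V) : blin T -> (forall y, T y = 0 -> y = 0) ->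
  forall y (e : R), 0 < e -> exists v, nrm (y - radj T v) < e.
Proof.
move=> bT inj y e e0; have bA := blin_radj bT.
have [||_ [v _ <-] h] := @dense_of_orth R V (range (radj T)) _ _ y e e0.
- split; first by exists 0 => //; rewrite blin0.
  by move=> r _ _ [a _ <-] [b _ <-]; exists (r%:C *: a + b) => //; exact: bA.1.
- move=> z hz; apply: inj; apply: ip_eq => v; rewrite ip0l ipC -(radjK bT) -radjP//.
  by rewrite hz//; exists v.
- by exists v.
Qed.

Lemma dense_range_Ainvs_adj (y : V) (e : R) : 0 < e ->
  exists v, nrm (y - radj (Ainvs S) v) < e.
Proof.
apply: dense_range_radj => // z z0; apply: (Ainvs_inj hS).
by rewrite z0 blin0.
Qed.

Lemma SAinvs_lip t y : 0 <= t -> nrm (S t (Ainvs S y) - Ainvs S y) <= M * t * nrm y.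
Proof.
move=> t0; apply: nrm_le_ip; first by rewrite mulr_ge0 ?nrm_ge0// mulr_ge0.
move=> z; rewrite -[X in _ - X](rsg0 hS) (SAinvsB hS)//.
have -> : M * t * nrm y * nrm z = \int[mu]_(r in `]0, t[) cst (M * nrm y * nrm z) r.
  by rewrite Rint_cst// subr0; ring.
apply: le_trans (ler_norm _) _; apply: Rint_abs_le => //.
- by apply: intg_itv => //; exact: (orbit_intg hS).
- exact: intg_cst.
move=> r /=; rewrite in_itv/= => /andP[r0 _]; apply: le_trans (ip_le _ _) _.
by rewrite ler_wpM2r ?nrm_ge0// (rsg_le hS)// ltW.
Qed.

Context {S' : R -> V -> V}.
Hypothesis hS' : forall t, 0 <= t -> S' t = radj (S t).

Lemma rsg_adj : rsg S' M w.
Proof.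
have bS t (t0 : 0 <= t) : blin (S t) := rsg_blin hS t0.
have S'le t x : 0 <= t -> nrm (S' t x) <= M * expR (- w * t) * nrm x.
  move=> t0; rewrite hS'//; apply: radj_bound; first exact: bS.
    by rewrite mulr_ge0// expR_ge0.
  by move=> z; exact: (rsg_exp hS).
split.
- by move=> t t0; rewrite hS'//; apply: blin_radj; exact: bS.
- move=> x; rewrite hS'//; apply: radj_unique; first exact: bS.
  by move=> z; rewrite (rsg0 hS).
- move=> s t x s0 t0; rewrite !hS' ?addr_ge0//.
  apply: radj_unique; first by apply: bS; exact: addr_ge0.
  by move=> z; rewrite addrC (rsgD hS)// !radjP//; exact: bS.
(* Strong continuity does not pass to adjoints directly. On the dense range of [radj (Ainvs S)] it
   follows by duality from the Lipschitz estimate [SAinvs_lip]. The three errors are [M d], [d] and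
   [d] with [d = e / (M + 2)]. *)
- move=> x; apply/cvg_nrmP/cvgrPdist_le => e e0.
  have M1 : 0 < M + 2 by rewrite ltr_wpDl.
  have [v hv] := dense_range_Ainvs_adj x (divr_gt0 e0 M1).
  set u := radj (Ainvs S) v in hv.
  near=> t.
  have t0 : 0 <= t by apply: ltW; near: t; exact: nbhs_right_gt.
  have h1 : nrm (S' t x - S' t u) <= M * nrm (x - u).
    have bS' : blin (S' t) by rewrite hS'//; apply: blin_radj; exact: bS.
    rewrite -blinB//; apply: le_trans (S'le _ _ t0) _; rewrite ler_wpM2r ?nrm_ge0//.
    by rewrite ler_piMr// -expR0 ler_expR mulNr oppr_le0 mulr_ge0// ltW.
  have h2 : nrm (S' t u - u) <= M * t * nrm v.
    apply: nrm_le_ip; first by rewrite !mulr_ge0// nrm_ge0.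
    move=> z; rewrite hS'// ipC ipBr -radjP; last exact: bS.
    rewrite /u -!radjP// -ipBl -(SAinvs hS)//; apply: le_trans (ip_le_nrm _ _) _.
    by rewrite [X in _ <= X]mulrAC ler_wpM2r ?nrm_ge0//; exact: SAinvs_lip.
  have h3 : M * t * nrm v <= e / (M + 2).
    have : t <= e / (M + 2) / (M * nrm v + 1).
      near: t; apply: nbhs_right_le; rewrite !divr_gt0//.
      by rewrite ltr_wpDl// mulr_ge0// nrm_ge0.
    rewrite ler_pdivlMr; last by rewrite ltr_wpDl// mulr_ge0// nrm_ge0.
    by apply: le_trans; rewrite mulrDr mulr1 mulrCA mulrA lerDl.
  rewrite sub0r normrN ger0_norm ?nrm_ge0//.
  apply: le_trans (nrm_triangle _ (S' t u) _) _.
  apply: le_trans (lerD h1 (nrm_triangle _ u _)) _.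
  have h4 : (M + 2) * (e / (M + 2)) = e by rewrite mulrC divfK// gt_eqF.
  have := nrmBC x u; move: (nrm (x - u)) (nrm (u - x)) hv h2 h3 h4 M0.
  by move: (e / (M + 2)) (M * t * nrm v) (nrm (S' t u - u)) => a b c d d'; nra.
- by case: hS => _ _ _ _ [h1 h2 _].
Unshelve. all: by end_near. Qed.

Lemma radj_wint r : weight w r -> radj (wint S r) = wint S' r.
Proof.
move=> wr; have bw := wint_blin hS wr.
apply/funext => x; apply: radj_unique => // z.
rewrite (wintP hS)// ipC (wintP rsg_adj)//; apply: eq_Rintegral => t.
rewrite inE/= in_itv/= andbT => t0.
by rewrite hS'; [rewrite [in RHS]ipC -radjP//; apply: (rsg_blin hS); exact: ltW|exact: ltW].
Qed.

End SemigroupAdjoint.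

(** * Resolvents as inverse generators of rescaled semigroups *)

Section Resolvent.
Context {R : realType} {V : hilbertType R}.
Context {S : R -> V -> V} {M w : R}.
Hypothesis hS : rsg S M w.
Let M0 : 0 <= M. Proof. by case: hS => _ _ _ _ [h _ _]; apply: le_trans h. Qed.
Let w0 : 0 < w. Proof. by case: hS => _ _ _ _ []. Qed.
Let bAi := Ainvs_blin hS.

Definition shift_sg (l t : R) (x : V) : V := (expR (- l * t))%:C *: S t x.

Lemma rsg_shift l : 0 <= l -> rsg (shift_sg l) M (w + l).
Proof.
move=> l0; split.
- by move=> t t0; apply: blin_scale; exact: (rsg_blin hS).
- by move=> x; rewrite /shift_sg mulr0 expR0 scale1r (rsg0 hS).
- move=> s t x s0 t0; rewrite /shift_sg (rsgD hS)// blinZ; last exact: (rsg_blin hS).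
  by rewrite scalerA -rmorphM/= -expRD -mulrDr.
- move=> x; rewrite /shift_sg -[X in _ --> X]scale1r.
  have -> : 1 = (expR (- l * 0))%:C :> R[i] by rewrite mulr0 expR0.
  apply: cvg_scal; last by case: hS.
  apply: cvg_at_right_filter.
  apply: (@continuous_comp _ _ _ ( *%R (- l)) expR); last exact: continuous_expR.
  exact: mulrl_continuous.
- split => //; [by case: hS => _ _ _ _ []|by rewrite ltr_pwDl|].
  move=> t x t0; rewrite nrmZ ger0_norm ?expR_ge0// opprD mulrDl expRD.
  have := rsg_exp hS x t0; have := expR_ge0 (- l * t).
  by move: (nrm _) (nrm _) (expR _) (expR _) => a b c d; nra.
Qed.

(** A product rule: the quotient for [S] is [exp(l t)] times the quotient for the rescaled
    semigroup, plus [(exp(l t) - 1) / t] times [x]. *)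
Lemma isgen_shift l x y : isgen (shift_sg l) x y -> isgen S x (y + l%:C *: x).
Proof.
move=> h.
have h1 : (fun t : R => expR (l * t)) @ (0 : R)^'+ --> (1 : R).
  have c0 : {for 0, continuous (fun t : R => expR (l * t))}.
    by apply: continuous_comp; [exact: mulrl_continuous|exact: continuous_expR].
  by have := cvg_at_right_filter c0; rewrite mulr0 expR0.
have h2 : (fun t : R => t^-1 * (expR (l * t) - 1)) @ (0 : R)^'+ --> l.
  have d : is_derive (0 : R) 1 (fun t : R => expR (l * t)) l.
    apply: is_derive_eq; rewrite /GRing.scale/= mulr0 expR0.
    by ring.
  have [/cvg_ex[u hu] e] := d.
  have lu : l = u by rewrite -e; apply: cvg_lim hu; exact: Rhausdorff.
  rewrite [X in _ --> X]lu.
  apply: cvg_trans (cvg_dnbhs_at_right hu); apply: near_eq_cvg.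
  near=> t; rewrite /GRing.scale/= mulr1 addr0 mulr0 expR0.
  by [].
have h3 : (fun t => (expR (l * t))%:C *: (t^-1%:C *: (shift_sg l t x - x))
    + (t^-1 * (expR (l * t) - 1))%:C *: x) @ (0 : R)^'+ --> y + l%:C *: x.
  apply: cvgD; first by rewrite -[X in _ --> X]scale1r; apply: cvg_scal.
  by apply: cvg_scal => //; exact: cvg_cst.
apply: cvg_trans h3; apply: near_eq_cvg; near=> t.
rewrite /shift_sg scalerA mulrC -scalerA scalerBr scalerA -rmorphM -expRD.
rewrite mulNr addrN expR0 scale1r rmorphM -scalerA -scalerDr.
by rewrite rmorphB scalerBl scale1r addrA subrK.
Unshelve. all: by end_near. Qed.

Lemma weight_expR l : 0 <= l -> weight w (fun t => expR (- l * t)).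
Proof.
move=> l0; split.
  move=> t _; apply: continuous_comp; last exact: continuous_expR.
  exact: mulrl_continuous.
have := (intg_expR (ltr_pwDl w0 l0)).1; apply: eq_integrable => // t _ /=.
by rewrite ger0_norm ?expR_ge0// -expRD -mulrDl opprD addrC.
Qed.

(** The Laplace transform of the semigroup, that is [(l - A)^-1]. *)
Definition resol (l : R) (x : V) : V := wint S (fun t => expR (- l * t)) x.

Lemma resolE l x : resol l x = - Ainvs (shift_sg l) x.
Proof.
rewrite /Ainvs opprK /resol /wint; congr vintegral; apply/funext => t.
by rewrite /shift_sg scale1r.
Qed.

Lemma resol_blin l : 0 <= l -> blin (resol l).
Proof. by move=> l0; apply: (wint_blin hS); exact: weight_expR. Qed.

Lemma Ainvs_resol l x : 0 <= l -> Ainvs S (l%:C *: resol l x - x) = resol l x.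
Proof.
move=> l0; apply: (Ainvs_isgen hS).
have : isgen (shift_sg l) (Ainvs (shift_sg l) (- x)) (- x).
  exact: (isgen_Ainvs (rsg_shift l0)).
rewrite (blinN _ (Ainvs_blin (rsg_shift l0))) -resolE.
by move/isgen_shift; rewrite addrC.
Qed.

Lemma resol_Ainvs l y : 0 <= l -> resol l (l%:C *: Ainvs S y - y) = Ainvs S y.
Proof.
move=> l0; have bR := resol_blin l0.
have com x : resol l (Ainvs S x) = Ainvs S (resol l x).
  apply: (Ainvs_comm hS) => // t z t0.
  rewrite /resol (wint_comm hS (T := S t))//.
  - exact: weight_expR.
  - exact: (rsg_blin hS (ltW t0)).
  - by move=> s u s0; rewrite (rsgC hS)// ltW.
rewrite (blinB _ _ bR) (blinZ _ _ bR) com -(blinZ _ _ bAi).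
have := Ainvs_resol y l0; rewrite (blinB _ _ bAi) => h.
by rewrite -[X in _ - X]h; vec.
Qed.

Lemma resol_le l x : 0 <= l -> nrm (resol l x) <= M / (w + l) * nrm x.
Proof. by move=> l0; rewrite resolE nrmN; exact: (Ainvs_le (rsg_shift l0)). Qed.

(** On a vector [u = A^-1 v] the error is [(l - A)^-1 v], of order [1 / l]. Elsewhere density
    suffices, because [l (l - A)^-1] is bounded by [M] for all [l]. *)
Lemma resol_approx x (e : R) : 0 < e -> exists2 L, 0 <= L &
  forall l, L <= l -> nrm (l%:C *: resol l x - x) < e.
Proof.
move=> e0; have M1 : 0 < M + 2 by rewrite ltr_wpDl.
have [v hv] := dense_range_Ainvs hS x (divr_gt0 e0 M1).
set u := Ainvs S v in hv.
set d := e / (M + 2) in hv; have d0 : 0 < d by rewrite divr_gt0.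
have Mv : 0 <= M * nrm v by rewrite mulr_ge0// nrm_ge0.
exists (M * nrm v / d); first by rewrite divr_ge0// ltW.
move=> l hl; have l0 : 0 <= l by apply: le_trans hl; rewrite divr_ge0// ltW.
have bR := resol_blin l0.
have h1 : l%:C *: resol l u - u = resol l v.
  have := resol_Ainvs v l0; rewrite (blinB _ _ bR) (blinZ _ _ bR) -/u => h.
  by rewrite -[in X in _ - X]h opprB addrC subrK.
have wl : 0 < w + l by rewrite ltr_pwDl.
have h2 : nrm (resol l v) <= d.
  apply: le_trans (resol_le _ l0) _; rewrite mulrAC ler_pdivrMr//.
  by move: hl; rewrite ler_pdivrMr// => hl; apply: (le_trans hl); rewrite mulrC ler_wpM2l ?(ltW d0)// lerDr ltW.
have h3 : nrm (l%:C *: resol l (x - u)) <= M * nrm (x - u).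
  rewrite nrmZ ger0_norm//; apply: le_trans (ler_wpM2l l0 (resol_le _ l0)) _.
  rewrite mulrA ler_wpM2r ?nrm_ge0// mulrA ler_pdivrMr// mulrC ler_wpM2l//.
  by rewrite lerDr ltW.
have -> : l%:C *: resol l x - x = l%:C *: resol l (x - u) + (l%:C *: resol l u - u) + (u - x).
  by rewrite (blinB _ _ bR); vec.
rewrite h1; apply: le_lt_trans (nrmD _ _) _; apply: le_lt_trans (lerD (nrmD _ _) (lexx _)) _.
have h4 : (M + 2) * d = e by rewrite /d mulrC divfK// gt_eqF.
have := nrmBC x u; move: (nrm (x - u)) (nrm (u - x)) hv h2 h3 h4 M0.
by move: (nrm (resol l v)) (nrm (l%:C *: _)) d0 => a b d0 p q; nra.
Qed.

End Resolvent.

(** * Negative fractional powers *)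

Section FracFubini.
Context {R : realType}.
Notation mu := (@lebesgue_measure R).

(** The Beta value at [(th, 1 - th)], that is, the product of the Gamma values at [th] and
    [1 - th]. *)
Definition beta_cst (th : R) : R :=
  \int[mu]_(s in `]0, +oo[) (s `^ (th - 1) / (1 + s)).

Lemma pos_cont_powR (a : R) : pos_cont (fun t : R => t `^ a).
Proof.
move=> t t0; apply: differentiable_continuous; apply/derivable1_diffP/derivable_powR.
by rewrite in_itv/= t0.
Qed.

Lemma Rint_scale (f : R -> R) (a : R) : 0 < a -> intg `]0, +oo[ f ->
  intg `]0, +oo[ (fun t => f (a * t)) /\
  \int[mu]_(t in `]0, +oo[) f (a * t) = a^-1 * \int[mu]_(t in `]0, +oo[) f t.
Proof.
move=> a0 hf; have an : a != 0 by rewrite gt_eqF.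
have pre : (fun t => a * t + 0) @^-1` `]0, +oo[ = `]0, +oo[%classic.
  by apply/seteqP; split=> t /=; rewrite !in_itv/= !andbT addr0 pmulr_rgt0.
split.
  have := @intg_affine R a 0 an `]0, +oo[%classic f (mble_itv _) hf.
  by rewrite pre (_ : f \o _ = (fun t => f (a * t)))//; apply/funext => t /=; rewrite addr0.
have := @Rint_affine R a 0 an `]0, +oo[%classic f (mble_itv _) hf.
rewrite pre gtr0_norm// => <-.
by apply: eq_Rintegral => t _; rewrite addr0.
Qed.

Section fixed_exponent.
Variables (th w : R).
Hypotheses (th0 : 0 < th) (th1 : th < 1) (w0 : 0 < w).

Local Notation pos := `]0%R, +oo[%classic.
Let posP (t : R) : pos t = (0 < t) :> Prop.
Proof. by rewrite /= in_itv/= andbT. Qed.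

(** The substitution of [t s] for [s] turns [t^-th s^(th - 1) f(s + t) ds] into
    [s^(th - 1) f(t (1 + s)) ds]. In this form the integral over [t] is a plain rescaling as well,
    which produces the factor [1 / (1 + s)]. Extension by 0 lets Fubini run over the whole plane. *)
Let FF (f : R -> R) (p : R * R) : R :=
  \1_pos p.1 * (\1_pos p.2 * p.2 `^ (th - 1)) * (f \_ pos) (p.1 * (1 + p.2)).

Let FFpos f t s : 0 < t -> 0 < s -> FF f (t, s) = s `^ (th - 1) * f (t * (1 + s)).
Proof.
move=> t0 s0; rewrite /FF /= !indicE !mem_set ?posP//= !mul1r patchE mem_set// posP.
by rewrite mulr_gt0// addr_gt0.
Qed.

Let FF0l f t s : ~ 0 < t -> FF f (t, s) = 0.
Proof. by move=> t0; rewrite /FF /= indicE memNset ?posP// !mul0r. Qed.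

Let FF0r f t s : ~ 0 < s -> FF f (t, s) = 0.
Proof. by move=> t0; rewrite /FF /= !indicE [s \in _]memNset ?posP// !(mul0r,mulr0). Qed.

Let mFF f : pos_cont f ->
  measurable_fun [set: measurableTypeR R * measurableTypeR R] (FF f).
Proof.
move=> cf.
have mi : measurable_fun [set: measurableTypeR R] (\1_pos : R -> R).
  by apply: measurable_indic; exact: measurable_itv.
have mf : measurable_fun [set: measurableTypeR R] (f \_ pos).
  apply/(measurable_restrictT _ _).1; first exact: measurable_itv.
  exact: msub_pos.
apply: measurable_funM; first apply: measurable_funM.
- exact: measurableT_comp mi measurable_fst.
- apply: measurable_funM; first exact: measurableT_comp mi measurable_snd.
  by apply: (measurableT_comp (measurable_powR _)) measurable_snd.
- apply: (measurableT_comp mf).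
  apply: measurable_funM; first exact: measurable_fst.
  by apply: measurable_funD; [exact: measurable_cst|exact: measurable_snd].
Qed.

Let dom_intg (f : R -> R) (C : R) : pos_cont f -> (forall t, 0 < t -> `|f t| <= C * expR (- w * t)) ->
  intg pos f.
Proof.
move=> cf fC; have [ie _] := intg_expR w0.
apply: (intg_le (mble_itv _) _ _ (intgZ C (mble_itv _) ie)); first exact: msub_pos.
by move=> t; rewrite posP; exact: fC.
Qed.

Let dom_C (f : R -> R) (C : R) : (forall t, 0 < t -> `|f t| <= C * expR (- w * t)) -> 0 <= C.
Proof.
move=> h; have := h 1 ltr01; have := expR_gt0 (- w * 1) => e0 h1.
by rewrite -(pmulr_lge0 _ e0); apply: le_trans h1.
Qed.

Let inner_intg (f : R -> R) (C t : R) : pos_cont f -> 0 < t ->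
  (forall t, 0 < t -> `|f t| <= C * expR (- w * t)) ->
  intg pos (fun s => s `^ (th - 1) * f (s + t)).
Proof.
move=> cf t0 fC.
apply: (intg_le (mble_itv _) _ _ (intgZ C (mble_itv _) (intg_powR_expR th0 (ltW th1) w0))).
  apply: msub_pos => // s s0; apply: continuousM; first exact: pos_cont_powR.
  apply: (@continuous_comp _ _ _ (fun s => s + t) f).
    by apply: continuousD; [exact: cvg_id|exact: cst_continuous].
  by apply: cf; rewrite addr_gt0.
move=> s; rewrite posP => s0; rewrite normrM ger0_norm ?powR_ge0// mulrCA.
rewrite ler_wpM2l ?powR_ge0//; apply: le_trans (fC _ (addr_gt0 s0 t0)) _.
rewrite ler_wpM2l ?(dom_C fC)// ler_expR !mulNr lerN2 ler_pM2l// lerDl.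
exact: ltW.
Qed.

Let inner (f : R -> R) (C t : R) : pos_cont f -> 0 < t ->
  (forall t, 0 < t -> `|f t| <= C * expR (- w * t)) ->
  (\int[mu]_s (FF f (t, s))%:E =
   (t `^ (- th) * \int[mu]_(s in pos) (s `^ (th - 1) * f (s + t)))%:E)%E.
Proof.
move=> cf t0 fC; have tn : t != 0 by rewrite gt_eqF.
have h1 : intg pos (fun s => (s / t) `^ (th - 1) * f (s + t)).
  have := intgZ ((t^-1) `^ (th - 1)) (mble_itv _) (inner_intg cf t0 fC).
  apply: eq_integrable => // s; rewrite inE posP => s0 /=.
  by rewrite powRM ?(ltW s0) ?invr_ge0 ?(ltW t0)//; congr EFin; ring.
have [h2 h3] := Rint_scale t0 h1.
have e : {in pos, (fun s => (t * s / t) `^ (th - 1) * f (t * s + t)) =1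
            (fun s => FF f (t, s))}.
  move=> s; rewrite inE posP => s0; rewrite FFpos//.
  by rewrite mulrAC mulfV// mul1r; congr (_ * f _); ring.
have -> : (\int[mu]_s (FF f (t, s))%:E = \int[mu]_(s in pos) (FF f (t, s))%:E)%E.
  rewrite [RHS]integral_mkcond; apply: eq_integral => s _; rewrite patchE.
  case: ifPn => //; rewrite notin_setE posP => s0.
  by rewrite FF0r.
transitivity ((\int[mu]_(s in pos) ((t * s / t) `^ (th - 1) * f (t * s + t)))%:E).
  rewrite /Rintegral fineK; last exact: integrable_fin_num.
  by apply: eq_integral => s sp; rewrite (e s sp).
congr EFin; rewrite h3.
have e2 s : 0 < s -> (s / t) `^ (th - 1) * f (s + t) =
    t * t `^ (- th) * (s `^ (th - 1) * f (s + t)).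
  move=> s0; rewrite powRM ?(ltW s0) ?invr_ge0 ?(ltW t0)//.
  have -> : t * t `^ (- th) = t `^ (1 - th).
    by rewrite -{1}(powRr1 (ltW t0)) -powRD// tn implybT.
  have -> : t^-1 `^ (th - 1) = t `^ (1 - th).
    by rewrite -powR_inv1 ?(ltW t0)// -powRrM; congr (_ `^ _); ring.
  by ring.
have -> : \int[mu]_(s in pos) ((s / t) `^ (th - 1) * f (s + t)) =
    t * t `^ (- th) * \int[mu]_(s in pos) (s `^ (th - 1) * f (s + t)).
  rewrite -RintegralZl//; last exact: (inner_intg cf t0 fC).
  by apply: eq_Rintegral => s; rewrite inE posP => s0; exact: e2.
by move: (Rintegral _ _ _) (t `^ _) => I p; rewrite -mulrA mulKf.
Qed.

Let inner2 (f : R -> R) (C s : R) : pos_cont f -> 0 < s ->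
  (forall t, 0 < t -> `|f t| <= C * expR (- w * t)) ->
  (\int[mu]_t (FF f (t, s))%:E =
   (s `^ (th - 1) / (1 + s) * \int[mu]_(t in pos) f t)%:E)%E.
Proof.
move=> cf s0 fC; have s1 : 0 < 1 + s by rewrite addr_gt0.
have [h2 h3] := Rint_scale s1 (dom_intg cf fC).
have -> : (\int[mu]_t (FF f (t, s))%:E = \int[mu]_(t in pos) (FF f (t, s))%:E)%E.
  rewrite [RHS]integral_mkcond; apply: eq_integral => t _; rewrite patchE.
  case: ifPn => //; rewrite notin_setE posP => t0.
  by rewrite FF0l.
transitivity ((\int[mu]_(t in pos) (s `^ (th - 1) * f ((1 + s) * t)))%:E).
  rewrite /Rintegral fineK; last first.
    by apply: integrable_fin_num => //; apply: (intgZ _ (mble_itv _)).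
  by apply: eq_integral => t; rewrite inE posP => t0; rewrite FFpos// [t * _]mulrC.
by rewrite RintegralZl// h3 mulrA.
Qed.

Let FF_intg (f : R -> R) (C : R) : pos_cont f ->
  (forall t, 0 < t -> `|f t| <= C * expR (- w * t)) ->
  (mu \x mu)%E.-integrable [set: measurableTypeR R * measurableTypeR R] (EFin \o FF f).
Proof.
move=> cf fC; apply/integrable12ltyP; first by apply/measurable_EFinP; exact: mFF.
pose g t := C * expR (- w * t).
have cg : pos_cont g.
  move=> t _; apply: continuousM; first exact: cst_continuous.
  by apply: continuous_comp; [exact: mulrl_continuous|exact: continuous_expR].
have C0 := dom_C fC.
have gC t : 0 < t -> `|g t| <= C * expR (- w * t).
  by move=> t0; rewrite ger0_norm// mulr_ge0// expR_ge0.
pose K : R := \int[mu]_(s in pos) (s `^ (th - 1) * expR (- w * s)).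
have iK := intg_powR_expR th0 (ltW th1) w0.
(* Bound for the inner integral: the decay of [f(s + t)] splits into a factor in [s], integrated to
   [K], and one in [t]. The remaining power [t^-th] is integrable at 0 since [th < 1]. *)
pose H t : R := C * K * (t `^ ((1 - th) - 1) * expR (- w * t)).
have iH : intg pos H.
  apply: (intgZ _ (mble_itv _)); apply: intg_powR_expR => //; first by rewrite subr_gt0.
  by rewrite lerBlDr lerDl ltW.
apply: (@le_lt_trans _ _ (\int[mu]_t ((H \_ pos) t)%:E)%E); last first.
  have -> : (\int[mu]_t ((H \_ pos) t)%:E = \int[mu]_(t in pos) (H t)%:E)%E.
    by rewrite [RHS]integral_mkcond; apply: eq_integral => t _; rewrite !patchE; case: ifP.
  have := integrable_fin_num (mble_itv _) iH.
  by rewrite fin_numE => /andP[_]; rewrite -ltey.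
have mFa : measurable_fun [set: measurableTypeR R * measurableTypeR R] (fun p => `|(FF f p)%:E|%E).
  by apply: measurableT_comp => //; apply/measurable_EFinP; exact: mFF.
apply: ge0_le_integral => //.
- by move=> t _; apply: integral_ge0 => s _.
- have h := @measurable_fun_fubini_tonelli_F _ _ (measurableTypeR R) (measurableTypeR R) R
    mu (fun p => `|(FF f p)%:E|%E) mFa (fun p => abse_ge0 _).
  exact: h.
- apply/measurable_EFinP; apply/(measurable_restrictT _ _).1 => //.
  exact: intg_meas iH.
move=> t _; rewrite patchE; case: ifPn; last first.
  rewrite notin_setE posP => t0; rewrite integral0_eq// => s _.
  by rewrite /= FF0l// normr0.
rewrite inE posP => t0.
have FFg s : 0 <= FF g (t, s).
  have [s0|s0] := pselect (0 < s); last by rewrite FF0r.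
  by rewrite FFpos// mulr_ge0 ?powR_ge0// mulr_ge0// expR_ge0.
have mt f' : pos_cont f' -> measurable_fun [set: measurableTypeR R] (fun s => FF f' (t, s)).
  by move=> cf'; apply: (measurableT_comp (mFF cf')); exact: measurable_pair1.
apply: (@le_trans _ _ (\int[mu]_s (FF g (t, s))%:E)%E).
  apply: ge0_le_integral => //.
  - by apply: measurableT_comp => //; apply/measurable_EFinP; exact: mt.
  - by apply/measurable_EFinP; exact: mt.
  move=> s _; rewrite /= lee_fin; have [s0|s0] := pselect (0 < s); last first.
    by rewrite FF0r// normr0.
  rewrite !FFpos// normrM ger0_norm ?powR_ge0// ler_wpM2l ?powR_ge0//.
  by apply: fC; rewrite mulr_gt0// addr_gt0.
rewrite (inner cg t0 gC) lee_fin /H.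
have -> : 1 - th - 1 = - th by ring.
have -> : \int[mu]_(s in pos) (s `^ (th - 1) * g (s + t)) = C * expR (- w * t) * K.
  rewrite /K -RintegralZl//; apply: eq_Rintegral => s _.
  rewrite /g mulrDr expRD.
  by move: (expR _) (expR _) (_ `^ _) => a b c; ring.
by rewrite le_eqVlt; apply/orP; left; apply/eqP; ring.
Qed.

(** Exchanging the integrals of [FF] evaluates the composition of two complementary fractional
    powers, with [f] an orbit paired with a fixed vector. *)
Lemma frac_fubini (f : R -> R) (C : R) : pos_cont f ->
  (forall t, 0 < t -> `|f t| <= C * expR (- w * t)) ->
  intg pos (fun s => s `^ (th - 1) / (1 + s)) ->
  \int[mu]_(t in pos) (t `^ (- th) * \int[mu]_(s in pos) (s `^ (th - 1) * f (s + t)))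
  = beta_cst th * \int[mu]_(t in pos) f t.
Proof.
move=> cf fC ib; have := Fubini (FF_intg cf fC).
have -> : (\int[mu]_x \int[mu]_y (EFin \o FF f) (x, y) =
  \int[mu]_(t in pos) (t `^ (- th) * \int[mu]_(s in pos) (s `^ (th - 1) * f (s + t)))%:E)%E.
  rewrite [RHS]integral_mkcond; apply: eq_integral => t _; rewrite patchE.
  case: ifPn; last first.
    by rewrite notin_setE posP => t0; rewrite integral0_eq// => s _ /=; rewrite FF0l.
  by rewrite inE posP => t0; exact: inner cf t0 fC.
have -> : (\int[mu]_y \int[mu]_x (EFin \o FF f) (x, y) =
  \int[mu]_(s in pos) (s `^ (th - 1) / (1 + s) * \int[mu]_(t in pos) f t)%:E)%E.
  rewrite [RHS]integral_mkcond; apply: eq_integral => s _; rewrite patchE.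
  case: ifPn; last first.
    by rewrite notin_setE posP => s0; rewrite integral0_eq// => t _ /=; rewrite FF0r.
  by rewrite inE posP => s0; exact: inner2 cf s0 fC.
by move=> h; rewrite /Rintegral h -RintegralZr.
Qed.

(** Tonelli for [f = exp(-w t)]: the integrand of [beta_cst], divided by [w], is an inner integral
    of the integrable function [FF]. *)
Lemma intg_beta : intg pos (fun s => s `^ (th - 1) / (1 + s)).
Proof.
pose g (t : R) := expR (- w * t).
have cg : pos_cont g.
  by move=> t _; apply: continuous_comp; [exact: mulrl_continuous|exact: continuous_expR].
have gC t : 0 < t -> `|g t| <= 1 * expR (- w * t).
  by move=> t0; rewrite mul1r ger0_norm// expR_ge0.
have fi := FF_intg cg gC.
have mg : measurable_fun (pos : set (measurableTypeR R)) (fun s : R => s `^ (th - 1) / (1 + s)).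
  apply: msub_pos => // s s0; apply: continuousM; first exact: pos_cont_powR.
  apply: cvgV; first by rewrite gt_eqF// addr_gt0.
  by apply: cvgD; [exact: cvg_cst|exact: cvg_id].
apply/integrableP; split; first exact/measurable_EFinP.
have := integrable21ltyP _ _ _; move: fi => /[dup] fi /measurable_int mfi.
move=> /(_ _ _ _ _ _ mu mu _ mfi)[+ _] => /(_ fi).
have -> : (\int[mu]_y \int[mu]_x `|(EFin \o FF g) (x, y)| =
  \int[mu]_(s in pos) (s `^ (th - 1) / (1 + s) * w^-1)%:E)%E.
  rewrite [RHS]integral_mkcond; apply: eq_integral => s _; rewrite patchE.
  case: ifPn; last first.
    by rewrite notin_setE posP => s0; rewrite integral0_eq// => t _ /=; rewrite FF0r// normr0.
  rewrite inE posP => s0; rewrite -(intg_expR w0).2 -(inner2 cg s0 gC).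
  apply: eq_integral => t _; rewrite /= ger0_norm//.
  have [t0|t0] := pselect (0 < t); last by rewrite FF0l.
  by rewrite FFpos// mulr_ge0 ?powR_ge0// expR_ge0.
under eq_integral do rewrite EFinM.
rewrite ge0_integralZr//; last 3 first.
- exact/measurable_EFinP.
- by move=> s; rewrite posP => s0; rewrite lee_fin divr_ge0 ?powR_ge0// addr_ge0// ltW.
- by rewrite lee_fin invr_ge0 ltW.
move=> h; have -> : (\int[mu]_(x in pos) `|(EFin \o (fun s : R => (s `^ (th - 1) / (1 + s))%R)) x| =
  \int[mu]_(x in pos) (x `^ (th - 1) / (1 + x))%:E)%E.
  apply: eq_integral => s; rewrite inE posP => s0.
  by rewrite /= ger0_norm// divr_ge0 ?powR_ge0// addr_ge0// ltW.
rewrite ltey; apply/negP => /eqP e; move: h.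
by rewrite e gt0_mulye// lte_fin invr_gt0.
Qed.

Lemma beta_cst_gt0 : 0 < beta_cst th.
Proof.
have s1 : (`]0%R, 1%R[%classic : set R) `<=` pos.
  by move=> t /=; rewrite !in_itv/= andbT => /andP[].
have h : \int[mu]_(t in `]0, 1[) cst (2^-1 : R) t <= beta_cst th.
  apply: (@le_trans _ _ (\int[mu]_(s in `]0, 1[) (s `^ (th - 1) / (1 + s)))).
    apply: le_Rintegral => //; first exact: intg_cst.
      by apply: intgS intg_beta.
    move=> s /=; rewrite in_itv/= => /andP[s0 s1'].
    have a1 : 0 < 1 + s by rewrite addr_gt0.
    rewrite ler_pdivlMr// (@le_trans _ _ 1)//.
      by rewrite mulrC ler_pdivrMr// mul1r lerD2l ltW.
    rewrite -[X in X <= _](powRr0 s) /powR gt_eqF// ler_expR mul0r.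
    by rewrite mulr_le0// ?subr_le0 ?ltW// ln_lt0// s0.
  apply: Rint_subset => //; first exact: intg_beta.
  by move=> s; rewrite posP => s0; rewrite divr_ge0 ?powR_ge0// addr_ge0// ltW.
by apply: lt_le_trans h; rewrite Rint_cst// subr0 mulr1 invr_gt0.
Qed.

Lemma Gamma_fun_gt0 : 0 < Gamma_fun th.
Proof.
have i1 : intg pos (fun t => t `^ (th - 1) * expR (- t)).
  have := intg_powR_expR th0 (ltW th1) ltr01; apply: eq_integrable => // t _ /=.
  by rewrite mulN1r.
have h : \int[mu]_(t in `]0, 1[) cst (expR (- 1)) t <= Gamma_fun th.
  apply: (@le_trans _ _ (\int[mu]_(s in `]0, 1[) (s `^ (th - 1) * expR (- s)))).
    apply: le_Rintegral => //; first exact: intg_cst.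
      by apply: intgS i1 => // t /=; rewrite !in_itv/= andbT => /andP[].
    move=> s /=; rewrite in_itv/= => /andP[s0 s1'].
    rewrite -[X in X <= _]mul1r ler_pM ?expR_ge0//; last by rewrite ler_expR lerN2 ltW.
    rewrite -[X in X <= _](powRr0 s) /powR gt_eqF// ler_expR mul0r.
    by rewrite mulr_le0// ?subr_le0 ?ltW// ln_lt0// s0.
  apply: Rint_subset => //.
    by move=> t /=; rewrite !in_itv/= andbT => /andP[].
  by move=> s; rewrite posP => s0; rewrite mulr_ge0 ?powR_ge0// expR_ge0.
by apply: lt_le_trans h; rewrite Rint_cst// subr0 mulr1 expR_gt0.
Qed.

End fixed_exponent.
End FracFubini.

Lemma fracinvE (R : realType) (V : hilbertType R) (S : R -> V -> V) th x :
  fracinv S th x = (Gamma_fun th)^-1%:C *: wint S (fun t => t `^ (th - 1)) x.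
Proof. by []. Qed.

Section FractionalPowersTheory.
Context {R : realType} {V : hilbertType R}.
Notation mu := (@lebesgue_measure R).
Context (S : R -> V -> V) (M w : R).
Hypothesis hS : rsg S M w.
Let M0 : 0 <= M. Proof. by case: hS => _ _ _ _ [h _ _]; apply: le_trans h. Qed.
Let w0 : 0 < w. Proof. by case: hS => _ _ _ _ []. Qed.

Lemma weight_powR th : 0 < th -> th <= 1 -> weight w (fun t => t `^ (th - 1)).
Proof.
move=> t0 t1; split; first exact: pos_cont_powR.
have := intg_powR_expR t0 t1 w0; apply: eq_integrable => // t _ /=.
by rewrite ger0_norm ?powR_ge0.
Qed.

Lemma fracinv_blin th : 0 < th -> th <= 1 -> blin (fracinv S th).
Proof. by move=> t0 t1; apply: blin_scale; apply: (wint_blin hS); exact: weight_powR. Qed.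

Lemma fracinv_comm th (T : V -> V) x : 0 < th -> th <= 1 -> blin T ->
  (forall t y, 0 < t -> T (S t y) = S t (T y)) -> T (fracinv S th x) = fracinv S th (T x).
Proof.
move=> t0 t1 bT com; rewrite !fracinvE (blinZ _ _ bT).
by rewrite (wint_comm hS _ (weight_powR t0 t1)).
Qed.

Lemma fracinv_S th t x : 0 < th -> th <= 1 -> 0 <= t ->
  S t (fracinv S th x) = fracinv S th (S t x).
Proof.
move=> h0 h1 t0; apply: fracinv_comm => //; first exact: (rsg_blin hS).
by move=> s y s0; rewrite (rsgC hS)// ltW.
Qed.

Lemma fracinv_Ainvs th x : 0 < th -> th <= 1 ->
  Ainvs S (fracinv S th x) = fracinv S th (Ainvs S x).
Proof.
move=> h0 h1; apply: fracinv_comm => //; first exact: (Ainvs_blin hS).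
by move=> s y s0; rewrite (SAinvs hS)// ltW.
Qed.

(** The semigroup law makes the double integral one of the form of [frac_fubini]. Any positive [c]
    transfers ranges and injectivity between [A^-1] and the fractional powers. *)
Lemma fracinv_comp th : 0 < th -> th < 1 -> exists2 c : R, 0 < c &
  forall x, fracinv S (1 - th) (fracinv S th x) = (- c)%:C *: Ainvs S x.
Proof.
move=> h0 h1; have h2 : 0 < 1 - th by rewrite subr_gt0.
have h3 : 1 - th < 1 by rewrite gtrBl.
have G1 := Gamma_fun_gt0 h0 h1; have G2 := Gamma_fun_gt0 h2 h3.
have bp := beta_cst_gt0 h0 h1 w0.
exists ((Gamma_fun (1 - th))^-1 * (Gamma_fun th)^-1 * beta_cst th).
  by rewrite !mulr_gt0// invr_gt0.
have w1 := weight_powR h0 (ltW h1); have w2 := weight_powR h2 (ltW h3).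
move=> x; rewrite (fracinvE S (1 - th)) (fracinvE S th) (blinZ _ _ (wint_blin hS w2)).
apply: ip_eq => z; rewrite !ipZl (AinvsP hS) (wintP hS)//.
have cf : pos_cont (fun t => ip (S t x) z).
  by apply: pos_cont_ip; [exact: (rsg_cont hS)|exact: pos_cont_cst].
have bf t : 0 < t -> `|ip (S t x) z| <= (M * nrm x * nrm z) * expR (- w * t).
  move=> t0; apply: le_trans (ip_le _ _) _; have := rsg_exp hS x (ltW t0).
  have := nrm_ge0 z.
  by move: (nrm _) (nrm _) (nrm _) (expR _) => a b c d h h'; nra.
have := frac_fubini h0 h1 w0 cf bf (intg_beta h0 h1 w0).
have -> : \int[mu]_(t in `]0, +oo[) (t `^ (1 - th - 1) *
    ip (S t (wint S (fun t0 => t0 `^ (th - 1)) x)) z) =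
  \int[mu]_(t in `]0, +oo[) (t `^ (- th) *
    \int[mu]_(s in `]0, +oo[) (s `^ (th - 1) * ip (S (s + t) x) z)).
  apply: eq_Rintegral => t; rewrite inE/= in_itv/= andbT => t0.
  have -> : 1 - th - 1 = - th by ring.
  congr (_ * _).
  rewrite (wint_comm hS (T := S t))//; last 2 first.
  - exact: (rsg_blin hS (ltW t0)).
  - by move=> s y s0; rewrite (rsgC hS)// ltW.
  rewrite (wintP hS)//; apply: eq_Rintegral => s; rewrite inE/= in_itv/= andbT => s0.
  by rewrite (rsgD hS)// ltW.
move=> ->.
by move: (Rintegral _ _ _) (beta_cst th) (Gamma_fun _)^-1 (Gamma_fun _)^-1 => a b c d; ring.
Qed.

Lemma fracinv_inj th y y' : 0 < th -> th < 1 -> fracinv S th y = fracinv S th y' -> y = y'.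
Proof.
move=> h0 h1 e; have [c c0 h] := fracinv_comp h0 h1.
apply: (Ainvs_inj hS).
have cn : (- c)%:C != 0 :> R[i] by rewrite eq_complex /= oppr_eq0 gt_eqF.
by apply: (scalerI cn); rewrite -!h e.
Qed.

Context (S' : R -> V -> V).
Hypothesis hS' : forall t, 0 <= t -> S' t = radj (S t).

Lemma radj_fracinv th : 0 < th -> th <= 1 -> radj (fracinv S th) = fracinv S' th.
Proof.
move=> h0 h1; have wp := weight_powR h0 h1.
apply/funext => x; apply: radj_unique; first exact: fracinv_blin.
move=> z; rewrite !fracinvE ipZl ipZr -(radj_wint hS hS' wp) -radjP//.
exact: (wint_blin hS wp).
Qed.

End FractionalPowersTheory.

(* Splitting at [b = a^(1/(q-1))] turns the product into a small multiple of
   [b^q] plus a large multiple of [a^2]; this replaces interpolation. *)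
Lemma young_small (R : realType) (q eta : R) : 1 < q -> q < 2 -> 0 < eta ->
  exists2 C, 0 <= C & forall a b : R, 0 <= a -> a <= 1 -> 0 <= b ->
    a * b <= eta * b `^ q + C * a ^+ 2.
Proof.
move=> q1 q2 e0; have p0 : 0 < q - 1 by rewrite subr_gt0.
exists (eta^-1 `^ (q - 1)^-1); first exact: powR_ge0.
move=> a b a0 a1 b0.
have [h|h] := leP a (eta * b `^ (q - 1)).
  apply: (@le_trans _ _ (eta * b `^ q)).
    rewrite -(mulr_powRB1 b0 (lt_trans ltr01 q1)) [b * _]mulrC mulrA ler_wpM2r//.
  by rewrite lerDl mulr_ge0 ?powR_ge0 ?sqr_ge0.
(* Here [b^(q - 1) < a / eta]. Taking the power [1 / (q - 1)], which is at least 1 because [q < 2],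
   and using [a <= 1] leaves a bound linear in [a]. *)
have hb : b <= eta^-1 `^ (q - 1)^-1 * a.
  have h1 : b `^ (q - 1) <= eta^-1 * a by rewrite ler_pdivlMl// ltW.
  have := @ge0_ler_powR R (q - 1)^-1 _ (b `^ (q - 1)) (eta^-1 * a).
  rewrite !nnegrE powR_ge0 mulr_ge0 ?invr_ge0 ?(ltW e0)// ltW ?invr_gt0//.
  move=> /(_ _ _ _ h1); rewrite -powRrM mulfV ?gt_eqF// powRr1// => h2.
  apply: (le_trans (h2 _ _ _)) => //.
  rewrite powRM ?invr_ge0 ?(ltW e0)// ler_wpM2l ?powR_ge0//.
  move: a0; rewrite le_eqVlt => /predU1P[<-|a0].
    by rewrite powR0// invr_neq0// gt_eqF.
  rewrite -[X in _ <= X]powRr1 ?(ltW a0)// /powR gt_eqF// ler_expR.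
  rewrite mul1r ler_neMl ?ln_le0//.
  by rewrite invf_ge1// lerBlDr ltW.
apply: (@le_trans _ _ (eta^-1 `^ (q - 1)^-1 * a ^+ 2)).
  by rewrite expr2 mulrA mulrC ler_wpM2r.
by rewrite lerDr mulr_ge0 ?powR_ge0// ltW.
Qed.

(** * Estimates on the control operator *)

Section Chunks.
Context {R : realType} {V : hilbertType R}.
Notation mu := (@lebesgue_measure R).
Context (S : R -> V -> V) (M w : R).
Hypothesis hS : rsg S M w.
Let M0 : 0 <= M. Proof. by case: hS => _ _ _ _ [h _ _]; apply: le_trans h. Qed.
Let w0 : 0 < w. Proof. by case: hS => _ _ _ _ []. Qed.

(* An integral bound over one period propagates to the half-line because the
   semigroup decays exponentially. *)
Lemma chunk_bound (h : R -> V -> R) (nu : V -> R) (C q T : R) :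
  0 < T -> 0 <= C -> 1 <= q -> (forall x, 0 <= nu x) ->
  (forall t x, 0 <= t -> nu (S t x) <= M * expR (- w * t) * nu x) ->
  (forall t x, 0 <= h t x) -> (forall x, pos_cont (h ^~ x)) ->
  (forall s t x, 0 < s -> 0 <= t -> h (s + t) x = h s (S t x)) ->
  (forall x, (\int[mu]_(t in `]0%R, T[) (h t x)%:E <= (C * nu x `^ q)%:E)%E) ->
  exists2 K, 0 <= K & forall x, intg `]0, +oo[ (h ^~ x) /\
    \int[mu]_(t in `]0, +oo[) h t x <= K * nu x `^ q.
Proof.
move=> T0 C0 q1 nu0 nuS h0 ch hD hT.
pose r := expR (- w * T) `^ q.
have q0 : 0 < q by apply: lt_le_trans q1.
have r0 : 0 < r by rewrite powR_gt0// expR_gt0.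
have r1 : r < 1.
  rewrite /r /powR gt_eqF ?expR_gt0// expRK -[X in _ < X]expR0 ltr_expR.
  by rewrite pmulr_rlt0// mulNr oppr_lt0 mulr_gt0.
(* Sum of a geometric series: the period starting at [n T] sees the state [S (n T) x] and
   contributes at most [C M^q r^n nu(x)^q]. *)
pose K := C * M `^ q / (1 - r).
have r1' : 0 < 1 - r by rewrite subr_gt0.
have K0 : 0 <= K by rewrite divr_ge0 ?(ltW r1')// mulr_ge0// powR_ge0.
have mh x (D : set R) : mble D -> D `<=` `]0, +oo[ ->
    measurable_fun (D : set (measurableTypeR R)) (fun t => (h t x)%:E).
  by move=> mD sD; apply/measurable_EFinP; exact: msub_pos.
have hT' x : (\int[mu]_(t in `]0%R, T]) (h t x)%:E <= (C * nu x `^ q)%:E)%E.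
  rewrite -integral_itv_bndo_bndc//; apply: mh => //.
  by move=> t /=; rewrite !in_itv/= andbT => /andP[].
have key x n : (\int[mu]_(t in `]0%R, (n%:R * T)%R]) (h t x)%:E <=
    (K * (1 - r ^+ n) * nu x `^ q)%:E)%E.
  elim: n => [|n IH].
    by rewrite mul0r set_itv_ge ?bnd_simp -?leNgt// integral_set0 expr0 subrr mulr0 mul0r.
  have nT : 0 <= n%:R * T by rewrite mulr_ge0// ltW.
  rewrite (@itv_bndbnd_setU _ _ _ (BRight (n%:R * T))); last 2 first.
  - by rewrite bnd_simp.
  - by rewrite bnd_simp ler_wpM2r ?(ltW T0)// ler_nat.
  rewrite ge0_integral_setU//=; last 3 first.
  - apply: mh; first by apply: measurableU.
    by move=> t [|]; rewrite /= !in_itv/= andbT => /andP[]// /(le_lt_trans nT).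
  - by move=> t _; rewrite lee_fin.
  - apply/disj_setPS => t [/=]; rewrite !in_itv/= => /andP[_ h1] /andP[h2 _].
    by have := lt_le_trans h2 h1; rewrite ltxx.
  have -> : (\int[mu]_(t in `](n%:R * T)%R, (n.+1%:R * T)%R]) (h t x)%:E =
      \int[mu]_(t in `]0%R, T]) (h t (S (n%:R * T) x))%:E)%E.
    have := @ge0_integral_affine R 1 (n%:R * T) (oner_neq0 _)
      `](n%:R * T), (n.+1%:R * T)] (fun t => (h t x)%:E) (mble_itv _).
    rewrite normr1 invr1 mul1e => <-; last 2 first.
    - by apply: mh => // t /=; rewrite !in_itv/= andbT => /andP[/(le_lt_trans nT)].
    - by move=> t _; rewrite lee_fin.
    have -> : (fun t => 1 * t + n%:R * T) @^-1` `](n%:R * T), (n.+1%:R * T)] = `]0, T]%classic.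
      apply/seteqP; split=> t /=; rewrite !in_itv/= mul1r ltrDr -natr1 mulrDl mul1r;
      by rewrite [n%:R * T + T]addrC lerD2r.
    apply: eq_integral => t; rewrite inE/= in_itv/= => /andP[t0 _].
    by rewrite mul1r hD.
  have h2 : (\int[mu]_(t in `]0%R, T]) (h t (S (n%:R * T) x))%:E <=
      (C * M `^ q * r ^+ n * nu x `^ q)%:E)%E.
    apply: (le_trans (hT' _)); rewrite lee_fin -!mulrA ler_wpM2l//.
    have -> : r ^+ n = expR (- w * (n%:R * T)) `^ q.
      have pe (y : R) : expR y `^ q = expR (q * y) by rewrite /powR gt_eqF ?expR_gt0// expRK.
      by rewrite /r !pe -expRM_natl; congr expR; ring.
    rewrite -powRM ?expR_ge0// -powRM ?mulr_ge0 ?expR_ge0//.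
    apply: ge0_ler_powR; rewrite ?nnegrE ?(ltW q0)// ?mulr_ge0 ?expR_ge0//.
    by rewrite mulrA; exact: nuS.
  apply: (le_trans (leeD (IH) h2)); rewrite -EFinD lee_fin -mulrDl ler_wpM2r ?powR_ge0//.
  rewrite le_eqVlt; apply/orP; left; apply/eqP.
  rewrite exprS /K; move: (M `^ q) (r ^+ n) => a b.
  by field; rewrite gt_eqF.
exists K => // x.
have big : (\int[mu]_(t in `]0%R, +oo[) (h t x)%:E <= (K * nu x `^ q)%:E)%E.
  pose F (n : nat) : set R := `]0%R, (n%:R * T)%R]%classic.
  have FE : `]0%R, +oo[%classic = \bigcup_n F n.
    apply/seteqP; split => t /=.
      rewrite in_itv/= andbT => t0.
      exists (Num.truncn (t / T)).+1 => //; rewrite /F /= in_itv/= t0/= -ler_pdivrMr//.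
      by apply: ltW; exact: truncnS_gt.
    by move=> [n _]; rewrite /F /= !in_itv/= andbT => /andP[].
  rewrite FE.
  have : (\int[mu]_(t in F i) (h t x)%:E)%E @[i --> \oo] -->
      (\int[mu]_(t in \bigcup_i F i) (h t x)%:E)%E.
    apply: ge0_nondecreasing_set_cvg_integral.
    - move=> n m nm; apply/subsetPset => t; rewrite /F /= !in_itv/= => /andP[->]/= h1.
      by apply: le_trans h1 _; rewrite ler_wpM2r ?(ltW T0)// ler_nat.
    - by move=> i; exact: measurable_itv.
    - by move=> i; apply: mh => // t /=; rewrite !in_itv/= andbT => /andP[].
    - by move=> i t _; rewrite lee_fin.
  move=> hc; move/cvg_lim : (hc) => <- //; apply: lime_le; first by apply/cvg_ex; eexists; exact: hc.
  apply: nearW => n; apply: (le_trans (key x n)); rewrite lee_fin ler_wpM2r ?powR_ge0//.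
  by rewrite ler_piMr// lerBlDr lerDl exprn_ge0// ltW.
have ih : intg `]0, +oo[ (h ^~ x).
  apply/integrableP; split; first exact: mh.
  by under eq_integral do rewrite /= ger0_norm//; apply: le_lt_trans big _; rewrite ltry.
split => //; rewrite -lee_fin /Rintegral fineK//.
exact: integrable_fin_num.
Qed.

End Chunks.

Lemma sum4_le (R : realFieldType) (e a b c d s1 s2 s3 : R) :
  a <= e / 4 -> b <= e / 4 -> c <= e / 4 -> d <= e / 4 ->
  s1 <= a + b -> s2 <= s1 + c -> s3 <= s2 + d -> s3 <= e.
Proof. lra. Qed.

Section ControlKernel.
Context {R : realType} {Y U : hilbertType R}.
Notation mu := (@lebesgue_measure R).
Context (S S' : R -> Y -> Y) (M w : R).
Hypothesis hS : rsg S M w.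
Hypothesis hS' : forall t, 0 <= t -> S' t = radj (S t).
(* [D] stands for [A^-1 B]. *)
Context (D : U -> Y).
Hypothesis bD : blin D.
Let M0 : 0 <= M. Proof. by case: hS => _ _ _ _ [h _ _]; apply: le_trans h. Qed.
Let w0 : 0 < w. Proof. by case: hS => _ _ _ _ []. Qed.
Let bAi := Ainvs_blin hS.
Let hSd := rsg_adj hS hS'.
Notation Ai := (Ainvs S).

(* [Eop t] extends [Bstar S'(t)] to the range of [radj J]; its argument [y]
   stands for the vector [radj J y]. *)
Section extension.
Context (J : Y -> Y).
Hypotheses (bJ : blin J) (JAi : forall x, Ai (J x) = J (Ai x))
  (JS : forall t x, 0 <= t -> S t (J x) = J (S t x)).
Context (k : R -> R).
Hypotheses (k_cont : pos_cont k) (k_ge0 : forall t, 0 < t -> 0 <= k t)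
  (k_bound : forall t y v, 0 < t -> radj J y = radj Ai v ->
     nrm (radj D (S' t v)) <= k t * nrm y).

Lemma radj_JAi z : radj J (radj Ai z) = radj Ai (radj J z).
Proof.
by apply: ip_eq => x; rewrite ![ip _ x]ipC -!radjP// JAi.
Qed.

(** The extension is built from its adjoint. Formally [e = J S(t) B u], and Douglas' lemma turns
    [k_bound] into the statement that [J S(t) D u] lies in the range of [Ai]. *)
Lemma Eadj_ex t u : 0 < t -> exists2 e, Ai e = J (S t (D u)) & nrm e <= k t * nrm u.
Proof.
move=> t0; have bSt : blin (S t) := rsg_blin hS (ltW t0).
apply: douglas => //; first by rewrite mulr_ge0 ?nrm_ge0 ?k_ge0.
move=> z; rewrite radjP// radjP// radjP// -hS' ?(ltW t0)//.
apply: le_trans (ip_le_nrm _ _) _; rewrite mulrC mulrAC ler_wpM2r ?nrm_ge0//.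
exact: (k_bound t0 (radj_JAi z)).
Qed.

Definition Eadj t (u : U) : Y := xget 0 [set e | Ai e = J (S t (D u))].

Lemma EadjP t u : 0 < t -> Ai (Eadj t u) = J (S t (D u)).
Proof.
move=> t0; apply: (@xgetPP _ [set e | Ai e = J (S t (D u))]).
by have [e e1 _] := Eadj_ex u t0; exists e.
Qed.

Lemma Eadj_le t u : 0 < t -> nrm (Eadj t u) <= k t * nrm u.
Proof.
move=> t0; have [e e1 e2] := Eadj_ex u t0.
by rewrite (_ : Eadj t u = e)//; apply: (Ainvs_inj hS); rewrite EadjP.
Qed.

Lemma Eadj_blin t : 0 < t -> blin (Eadj t).
Proof.
move=> t0; have bSt : blin (S t) := rsg_blin hS (ltW t0); split.
  move=> r x y; apply: (Ainvs_inj hS); rewrite bAi.1 !EadjP//.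
  by rewrite bD.1 bSt.1 bJ.1.
by exists (k t); [exact: k_ge0|move=> u; exact: Eadj_le].
Qed.

Definition Eop t : Y -> U := radj (Eadj t).

Lemma Eop_blin t : 0 < t -> blin (Eop t).
Proof. by move=> t0; apply: blin_radj; exact: Eadj_blin. Qed.

Lemma Eop_le t y : 0 < t -> nrm (Eop t y) <= k t * nrm y.
Proof.
move=> t0; apply: radj_bound; [exact: Eadj_blin|exact: k_ge0|].
by move=> u; exact: Eadj_le.
Qed.

(** Both sides are paired with [u] through difference quotients. As [Ai e = J x], the operator [J]
    can be moved onto [y], where [radj J y = radj Ai v] lets [Ai] move back onto [x]. *)
Lemma Eop_eq t y v : 0 < t -> radj J y = radj Ai v -> Eop t y = radj D (S' t v).
Proof.
move=> t0 yv; have bSt : blin (S t) := rsg_blin hS (ltW t0).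
apply: ip_eq => u.
have -> : ip (Eop t y) u = ip y (Eadj t u) by rewrite ipC -(radjP (Eadj_blin t0)) ipC.
have -> : ip (radj D (S' t v)) u = ip v (S t (D u)).
  by rewrite ipC -radjP// hS' ?(ltW t0)// -radjP// ipC.
set e := Eadj t u; set x := S t (D u); have eE : Ai e = J x by exact: EadjP.
have h1 : (fun h : R => ip y (h^-1%:C *: (S h (Ai e) - Ai e))) @ (0 : R)^'+ --> ip y e.
  by apply: cvg_ip; [exact: cvg_cst|exact: (isgen_Ainvs hS)].
have h2 : (fun h : R => ip y (h^-1%:C *: (S h (Ai e) - Ai e))) @ (0 : R)^'+ --> ip v x.
  have h3 : (fun h : R => ip v (h^-1%:C *: (S h (Ai x) - Ai x))) @ (0 : R)^'+ --> ip v x.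
    by apply: cvg_ip; [exact: cvg_cst|exact: (isgen_Ainvs hS)].
  apply: cvg_trans h3; apply: near_eq_cvg; near=> h.
  have h0 : 0 <= h by apply: ltW; near: h; exact: nbhs_right_gt.
  rewrite eE JS// -(blinB _ _ bJ) (SAinvs hS)// -(blinB _ _ bAi) !ipZr.
  by rewrite (ipC v (Ai _)) (ipC y (J _)) (radjP bAi) (radjP bJ) yv.
by apply: (cvg_unique _ h1 h2); exact: Rhausdorff.
Unshelve. all: by end_near. Qed.

(** On the dense range of [radj Ai] the operator is [radj D (S' t (radj J u))], visibly continuous
    in [t]. Elsewhere the bound [k], at most [k t0 + 1] near [t0], makes the approximation
    uniform. *)
Lemma Eop_cont (a : R -> Y) : pos_cont a -> pos_cont (fun t => Eop t (a t)).
Proof.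
move=> ca t0 t00; apply/cvg_nrmP/cvgrPdist_le => e e0.
set k0 := k t0 + 1; have k00 : 0 < k0 by rewrite ltr_wpDl// k_ge0.
have k4 : 0 < 4 * k0 by rewrite mulr_gt0.
set d := e / (4 * k0); have d0 : 0 < d by rewrite divr_gt0.
have [u hu] := dense_range_Ainvs_adj hS (a t0) d0.
set y := radj Ai u in hu.
have Ey t : 0 < t -> Eop t y = radj D (S' t (radj J u)).
  by move=> t1; apply: Eop_eq => //; exact: radj_JAi.
have cy : (fun t => radj D (S' t (radj J u))) @ t0 --> radj D (S' t0 (radj J u)).
  by apply: blin_cvg; [exact: blin_radj|exact: (rsg_cont hSd)].
near=> t.
have t1 : 0 < t by near: t; exact: lt_nbhsr.
rewrite sub0r normrN ger0_norm ?nrm_ge0//.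
have kt : k t <= k0.
  near: t; have /cvgrPdist_le/(_ _ (@ltr01 R)) := k_cont t00.
  by apply: filterS => t; rewrite ler_distl => /andP[+ _]; rewrite lerBlDr.
have h1 : nrm (a t - a t0) <= d.
  near: t; have /cvg_nrmP/cvgrPdist_le/(_ _ d0) := ca t0 t00.
  by apply: filterS => t; rewrite sub0r normrN ger0_norm ?nrm_ge0.
have h2 : nrm (Eop t y - Eop t0 y) <= e / 4.
  near: t; have e4 : 0 < e / 4 by rewrite divr_gt0.
  move/cvg_nrmP/cvgrPdist_le : cy => /(_ _ e4) h.
  near=> t; have t1 : 0 < t by near: t; exact: lt_nbhsr.
  rewrite !Ey//; have : `|0 - nrm (radj D (S' t (radj J u)) - radj D (S' t0 (radj J u)))| <= e / 4.
    by near: t.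
  by rewrite sub0r normrN ger0_norm ?nrm_ge0.
have kd : k0 * d = e / 4 by rewrite /d; field; rewrite gt_eqF.
have b1 : nrm (Eop t (a t - a t0)) <= e / 4.
  by rewrite -kd; apply: le_trans (Eop_le _ t1) _; apply: ler_pM; rewrite ?nrm_ge0 ?k_ge0.
have b2 : nrm (Eop t (a t0 - y)) <= e / 4.
  by rewrite -kd; apply: le_trans (Eop_le _ t1) _; apply: ler_pM; rewrite ?nrm_ge0 ?k_ge0 ?(ltW hu).
have b3 : nrm (Eop t0 (a t0 - y)) <= e / 4.
  rewrite -kd; apply: le_trans (Eop_le _ t00) _; apply: ler_pM; rewrite ?nrm_ge0 ?k_ge0 ?(ltW hu)//.
  by rewrite lerDl.
have -> : Eop t (a t) - Eop t0 (a t0) = Eop t (a t - a t0) + Eop t (a t0 - y)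
    + (Eop t y - Eop t0 y) - Eop t0 (a t0 - y).
  rewrite (blinB (a t) _ (Eop_blin t1)) (blinB _ y (Eop_blin t1)) (blinB _ y (Eop_blin t00)).
  by vec.
exact: (sum4_le b1 b2 h2 b3 (nrmD _ _) (nrmD _ _) (nrmB _ _)).
Unshelve. all: by end_near. Qed.

End extension.

Section ranges.

(** Up to a constant, [A^-1] is [(-A)^-th] applied after [(-A)^-(1 - th)]. *)
Lemma range_frac_Ai th : 0 < th -> th < 1 ->
  exists2 K, 0 <= K & forall x, exists2 y, fracinv S th y = Ai x & nrm y <= K * nrm x.
Proof.
move=> h0 h1; have h2 : 0 < 1 - th by rewrite subr_gt0.
have h3 : 1 - th < 1 by rewrite gtrBl.
have [c c0 hc] := fracinv_comp hS h2 h3.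
have bJ := fracinv_blin hS h0 (ltW h1).
have [_ [k k0 hk]] := fracinv_blin hS h2 (ltW h3).
exists (c^-1 * k); first by rewrite mulr_ge0// invr_ge0 ltW.
move=> x; exists ((- c^-1)%:C *: fracinv S (1 - th) x).
  rewrite (blinZ _ _ bJ); have := hc x; rewrite subKr => ->.
  by rewrite scalerA -rmorphM mulrNN mulVf ?scale1r// gt_eqF.
rewrite nrmZ normrN ger0_norm ?invr_ge0 ?(ltW c0)// -mulrA ler_wpM2l ?hk//.
by rewrite invr_ge0 ltW.
Qed.

(** The weight [t^-th] is that of the complementary power [1 - th]. So the hypothesis is the adjoint
    estimate that places [(-A)^-(1 - th) D u] in the range of [Ai]; the injective factor
    [(-A)^-(1 - th)] is then removed. *)
Lemma range_frac_D th (C : R) : 0 < th -> th < 1 -> 0 <= C ->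
  (forall v, intg `]0, +oo[ (fun t => t `^ (- th) * nrm (radj D (S' t v))) /\
     \int[mu]_(t in `]0, +oo[) (t `^ (- th) * nrm (radj D (S' t v))) <= C * nrm (radj Ai v)) ->
  exists2 K, 0 <= K & forall u, exists2 y, fracinv S th y = D u & nrm y <= K * nrm u.
Proof.
move=> h0 h1 C0 hC; have h2 : 0 < 1 - th by rewrite subr_gt0.
have h3 : 1 - th < 1 by rewrite gtrBl.
have [c c0 hc] := fracinv_comp hS h0 h1.
have G0 := Gamma_fun_gt0 h2 h3.
have bJ := fracinv_blin hS h0 (ltW h1).
have bJ' := fracinv_blin hS h2 (ltW h3).
have wp := weight_powR hS h2 (ltW h3).
set g := (Gamma_fun (1 - th))^-1 in G0 *.
have g0 : 0 <= g by rewrite invr_ge0 ltW.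
exists (c^-1 * (g * C)); first by rewrite !mulr_ge0// invr_ge0 ltW.
move=> u.
have [||v v1 v2] := @douglas R Y Y Ai (fracinv S (1 - th) (D u)) (g * C * nrm u) bAi.
- by rewrite !mulr_ge0// nrm_ge0.
- move=> z; rewrite fracinvE ipZl -/g (wintP hS)//.
  have [i1 i2] := hC z.
  have -> : g * C * nrm u * nrm (radj Ai z) = g * (nrm u * (C * nrm (radj Ai z))) by ring.
  rewrite ler_wpM2l//; apply: le_trans (ler_wpM2l (nrm_ge0 u) i2).
  rewrite -RintegralZl//; apply: le_trans (ler_norm _) _; apply: Rint_abs_le => //.
  + exact: (wint_intg hS).
  + exact: intgZ.
  move=> t /=; rewrite in_itv/= andbT => t0.
  have -> : 1 - th - 1 = - th by ring.
  rewrite normrM ger0_norm ?powR_ge0// mulrCA ler_wpM2l ?powR_ge0//.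
  have -> : ip (S t (D u)) z = ip u (radj D (S' t z)).
    by rewrite (radjP (rsg_blin hS (ltW t0))) (radjP bD) hS' ?(ltW t0).
  exact: ip_le.
exists ((- c^-1)%:C *: v).
  apply: (fracinv_inj hS h2 h3); rewrite (blinZ _ _ bJ) (blinZ _ _ bJ') hc scalerA -v1.
  by rewrite -rmorphM mulrNN mulVf ?gt_eqF// scale1r.
rewrite nrmZ normrN ger0_norm ?invr_ge0 ?(ltW c0)// -mulrA ler_wpM2l//.
by rewrite invr_ge0 ltW.
Qed.

End ranges.

End ControlKernel.

Lemma intg_ge0_le (R : realType) (D : set R) (f : R -> R) c : mble D ->
  measurable_fun (D : set (measurableTypeR R)) f -> (forall t, D t -> 0 <= f t) ->
  (\int[@lebesgue_measure R]_(t in D) (f t)%:E <= c%:E)%E ->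
  intg D f /\ \int[@lebesgue_measure R]_(t in D) f t <= c.
Proof.
move=> mD mf f0 h.
have ih : intg D f.
  apply/integrableP; split; first exact/measurable_EFinP.
  have -> : (\int[@lebesgue_measure R]_(x in D) `|(EFin \o f) x| = \int[@lebesgue_measure R]_(t in D) (f t)%:E)%E.
    by apply: eq_integral => t; rewrite inE => Dt; rewrite /= ger0_norm// f0.
  by apply: le_lt_trans h _; rewrite ltry.
by split => //; rewrite -lee_fin /Rintegral fineK//; exact: integrable_fin_num.
Qed.

Lemma pos_cont_powRn (R : realType) (f : R -> R) q : 0 < q -> pos_cont f ->
  (forall t, 0 < t -> 0 <= f t) -> pos_cont (fun t => f t `^ q).
Proof.
move=> q0 cf f0 t t0; have [ft|] := ltP 0 (f t).
  have cp : {for f t, continuous (fun y : R => y `^ q)} by exact: pos_cont_powR ft.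
  exact: (continuous_comp (cf t t0) cp).
move=> ft; have {}ft : f t = 0 by apply/le_anti; rewrite ft f0.
apply/cvgrPdist_le => e e0; rewrite ft powR0 ?gt_eqF//.
have d0 : 0 < e `^ q^-1 by rewrite powR_gt0.
have /cvgrPdist_le/(_ _ d0) := cf t t0; rewrite ft => h.
near=> s; have s0 : 0 < s by near: s; exact: lt_nbhsr.
have hs : `|0 - f s| <= e `^ q^-1 by near: s.
rewrite sub0r normrN ger0_norm ?powR_ge0//.
rewrite sub0r normrN ger0_norm ?f0// in hs.
have := ge0_ler_powR (ltW q0) _ _ hs; rewrite !nnegrE f0// powR_ge0 => /(_ isT isT).
by rewrite -powRrM mulVf ?gt_eqF// powRr1// ltW.
Unshelve. all: by end_near. Qed.

(** * Estimates drawn from the hypotheses on [F], [G] and the observation kernel *)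

Section KernelBounds.
Context {R : realType} {Y U : hilbertType R}.
Notation mu := (@lebesgue_measure R).
Context (S S' : R -> Y -> Y) (M w : R).
Hypothesis hS : rsg S M w.
Hypothesis hS' : forall t, 0 <= t -> S' t = radj (S t).
Context (D : U -> Y).
Hypothesis bD : blin D.
Let M0 : 0 <= M. Proof. by case: hS => _ _ _ _ [h _ _]; apply: le_trans h. Qed.
Let M1 : 1 <= M. Proof. by case: hS => _ _ _ _ []. Qed.
Let w0 : 0 < w. Proof. by case: hS => _ _ _ _ []. Qed.
Let bAi := Ainvs_blin hS.
Let hSd := rsg_adj hS hS'.
Notation Ai := (Ainvs S).

Context (F G : R -> Y -> U) (gamma N eta T : R).
Hypotheses (gamma_gt0 : 0 < gamma) (gamma_lt1 : gamma < 1) (N_gt0 : 0 < N)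
  (eta_gt0 : 0 < eta) (T_gt0 : 0 < T).
Hypothesis HF : forall t x, 0 < t ->
  nrm (F t x) <= N * t `^ (- gamma) * expR (- eta * t) * nrm x.
Hypothesis HFG : forall t v, 0 < t ->
  radj D (S' t v) = F t (radj Ai v) + G t (radj Ai v).

(** The singularity [t^-gamma] comes from [F], the constant 1 from the bound on [G] over []0, T]],
    the exponential from the semigroup beyond [T]. *)
Definition decay_kernel (K t : R) : R := K * ((t `^ (- gamma) + 1) * expR (- w * t)).

Lemma kernel_cont K : pos_cont (decay_kernel K).
Proof.
move=> t t0; apply: continuousM; first exact: cst_continuous.
apply: continuousM.
  by apply: continuousD; [exact: pos_cont_powR|exact: cst_continuous].
by apply: continuous_comp; [exact: mulrl_continuous|exact: continuous_expR].
Qed.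

Lemma kernel_ge0 K t : 0 <= K -> 0 <= decay_kernel K t.
Proof. by move=> K0; rewrite !mulr_ge0 ?addr_ge0 ?powR_ge0 ?expR_ge0. Qed.

Lemma kernel_intg K : intg `]0, +oo[ (decay_kernel K).
Proof.
apply: (intgZ _ (mble_itv _)).
have a0 : 0 < 1 - gamma by rewrite subr_gt0.
have a1 : 1 - gamma <= 1 by rewrite gerBl ltW.
have i1 := intg_powR_expR a0 a1 w0.
have i2 := (intg_expR w0).1.
have := intgD (mble_itv _) i1 i2.
by apply: eq_integrable => // t _ /=; congr EFin; rewrite mulrDl mul1r addrAC subrr add0r.
Qed.

Lemma F_le t x : 0 < t -> nrm (F t x) <= N * t `^ (- gamma) * nrm x.
Proof.
move=> t0; apply: (le_trans (HF x t0)); rewrite ler_wpM2r ?nrm_ge0//.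
rewrite ler_piMr ?mulr_ge0 ?powR_ge0 ?(ltW N_gt0)//.
by rewrite -expR0 ler_expR mulNr oppr_le0 mulr_ge0// ltW.
Qed.

(** The estimate on [G] stops at [T]. For larger [t], factoring [S' t] through time [T] reduces to
    the estimate at [T], with [y] replaced by its decayed image under [S' (t - T)]. *)
Lemma kernel_bound (J : Y -> Y) (Cg : R) : blin J ->
  (forall t x, 0 <= t -> S t (J x) = J (S t x)) -> 0 <= Cg ->
  (forall t y v, 0 < t -> t <= T -> radj J y = radj Ai v ->
     nrm (G t (radj J y)) <= Cg * nrm y) ->
  exists2 K, 0 <= K & forall t y v, 0 < t -> radj J y = radj Ai v ->
    nrm (radj D (S' t v)) <= decay_kernel K t * nrm y.
Proof.
move=> bJ JS Cg0 HG; have [_ [cJ cJ0 hcJ]] := blin_radj bJ.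
pose A := N * cJ + Cg; have A0 : 0 <= A by rewrite addr_ge0// mulr_ge0// ltW.
have base t y v : 0 < t -> t <= T -> radj J y = radj Ai v ->
    nrm (radj D (S' t v)) <= A * (t `^ (- gamma) + 1) * nrm y.
  move=> t0 tT yv; rewrite HFG// -yv; apply: le_trans (nrmD _ _) _.
  have h1 := HG t y v t0 tT yv; have h2 := F_le (radj J y) t0.
  have h3 := hcJ y; have p0 := powR_ge0 t (- gamma); have y0 := nrm_ge0 y.
  have h4 : nrm (F t (radj J y)) <= N * t `^ (- gamma) * (cJ * nrm y).
    by apply: (le_trans h2); rewrite ler_wpM2l// mulr_ge0// ltW.
  apply: (le_trans (lerD h4 h1)); rewrite /A.
  have -> : (N * cJ + Cg) * (t `^ (- gamma) + 1) * nrm y =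
     N * t `^ (- gamma) * (cJ * nrm y) + Cg * nrm y + (N * cJ * nrm y + Cg * t `^ (- gamma) * nrm y).
    by ring.
  by rewrite lerDl addr_ge0// !mulr_ge0// ltW.
have A1 : 0 <= A * (T `^ (- gamma) + 1) by rewrite mulr_ge0// addr_ge0// powR_ge0.
(* The factor [expR (w * T)] offsets the decay on []0, T]] and converts decay in [t - T] into decay
   in [t] beyond. *)
exists (A * (T `^ (- gamma) + 2) * M * expR (w * T)).
  by rewrite !mulr_ge0 ?expR_ge0// addr_ge0 ?powR_ge0.
move=> t y v t0 yv; have [tT|Tt] := leP t T.
  apply: (le_trans (base t y v t0 tT yv)); rewrite ler_wpM2r ?nrm_ge0// /decay_kernel.
  have -> : A * (T `^ (- gamma) + 2) * M * expR (w * T) * ((t `^ (- gamma) + 1) * expR (- w * t))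
     = A * (t `^ (- gamma) + 1) * ((T `^ (- gamma) + 2) * M * (expR (w * T) * expR (- w * t))).
    by ring.
  have e1 : 1 <= expR (w * T) * expR (- w * t).
    by rewrite -expRD -expR0 ler_expR mulNr subr_ge0 ler_wpM2l// ltW.
  have e2 : 1 <= T `^ (- gamma) + 2 by have := powR_ge0 T (- gamma); lra.
  have e3 : 1 <= (T `^ (- gamma) + 2) * M * (expR (w * T) * expR (- w * t)).
    by apply: mulr_ege1 => //; apply: mulr_ege1.
  by rewrite ler_peMr// mulr_ge0// addr_ge0 ?powR_ge0.
have sT : 0 <= t - T by rewrite subr_ge0 ltW.
pose v' := S' (t - T) v; pose y' := S' (t - T) y.
have e1 : S' t v = S' T v' by rewrite /v' -(rsgD hSd)// ?subrKC// ltW.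
have yv' : radj J y' = radj Ai v'.
  rewrite /y' /v' hS'//; apply: ip_eq => x.
  have bs : blin (S (t - T)) := rsg_blin hS sT.
  by rewrite ![ip _ x]ipC -!radjP// JS// (SAinvs hS)// (radjP bJ) (radjP bAi) yv.
have := base T y' v' T_gt0 (lexx _) yv'; rewrite e1 => h; apply: (le_trans h).
have h2 := rsg_exp hSd y sT; rewrite -/y' in h2.
apply: (le_trans (ler_wpM2l A1 h2)).
have -> : - w * (t - T) = w * T + (- w * t) by ring.
rewrite expRD /decay_kernel !mulrA ler_wpM2r ?nrm_ge0// ler_wpM2r ?expR_ge0//.
rewrite -!mulrA ler_wpM2l//.
set a := T `^ _; set b := t `^ _; set c := expR _.
have a0 : 0 <= a := powR_ge0 _ _; have b0 : 0 <= b := powR_ge0 _ _.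
have c0 : 0 <= M * c by rewrite mulr_ge0// expR_ge0.
have -> : (a + 2) * (M * (c * (b + 1))) = M * c * ((a + 2) * (b + 1)) by ring.
by rewrite mulrC ler_wpM2l//; nra.
Qed.

(** The assumed bound on one period is hypothesis 3(c) at [radj J (radj Ai v)]; the norm of this
    vector decays along the adjoint semigroup, as [chunk_bound] requires. *)
Lemma Kq_bound (J : Y -> Y) (q C : R) : blin J ->
  (forall t x, 0 <= t -> S t (J x) = J (S t x)) -> 1 < q -> 0 <= C ->
  (forall v, (\int[mu]_(t in `]0%R, T[) (nrm (radj D (S' t v)) `^ q)%:E <=
     ((C * nrm (radj J (radj Ai v))) `^ q)%:E)%E) ->
  exists2 K, 0 <= K & forall v, intg `]0, +oo[ (fun t => nrm (radj D (S' t v)) `^ q) /\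
    \int[mu]_(t in `]0, +oo[) (nrm (radj D (S' t v)) `^ q) <= K * nrm (radj J (radj Ai v)) `^ q.
Proof.
move=> bJ JS q1 C0 hC; have q0 : 0 < q by apply: lt_trans q1.
have bd := blin_radj bD.
have commS t v : 0 <= t -> radj J (radj Ai (S' t v)) = S' t (radj J (radj Ai v)).
  move=> t0; rewrite hS'//; apply: ip_eq => x; have bs : blin (S t) := rsg_blin hS t0.
  by rewrite ![ip _ x]ipC -!radjP// (SAinvs hS)// JS.
apply: (chunk_bound hSd (nu := fun v => nrm (radj J (radj Ai v)))
   (h := fun t v => nrm (radj D (S' t v)) `^ q) T_gt0 (C := C `^ q)).
- exact: powR_ge0.
- exact: ltW.
- by move=> x; exact: nrm_ge0.
- by move=> t x t0; rewrite commS//; exact: (rsg_exp hSd).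
- by move=> t x; exact: powR_ge0.
- move=> x t t0.
  have cn : pos_cont (fun t => nrm (radj D (S' t x))).
    by apply: pos_cont_nrm; apply: pos_cont_blin => //; exact: (rsg_cont hSd).
  by apply: (pos_cont_powRn q0 cn _ t0) => s _; exact: nrm_ge0.
- by move=> s t x s0 t0; rewrite (rsgD hSd)// ltW.
- by move=> x; apply: (le_trans (hC x)); rewrite lee_fin powRM ?nrm_ge0.
Qed.

(** Near 0, [F] contributes [t^-(th + gamma)], integrable because [th < 1 - gamma], and [G] is
    handled by Young's inequality with a large exponent [p]. The function [f] is a measurable
    stand-in for [|G|], equal to it almost everywhere. *)
Lemma theta_bound th : 0 < th -> th < 1 - gamma ->
  (forall p, 1 <= p -> exists2 C, 0 <= C & forall v, exists f : R -> R,
    [/\ measurable_fun (`]0, T[ : set (measurableTypeR R)) f, forall t, 0 <= f t,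
      (\int[mu]_(t in `]0%R, T[) (f t `^ p)%:E <= ((C * nrm (radj Ai v)) `^ p)%:E)%E
    & {ae mu, forall t, t \in `]0, T[ -> nrm (G t (radj Ai v)) = f t}]) ->
  exists2 K, 0 <= K & forall v,
    intg `]0, +oo[ (fun t => t `^ (- th) * nrm (radj D (S' t v))) /\
    \int[mu]_(t in `]0, +oo[) (t `^ (- th) * nrm (radj D (S' t v))) <= K * nrm (radj Ai v).
Proof.
move=> th0 th1 HG; have g1 : 0 < 1 - gamma by rewrite subr_gt0.
have th2 : th < 1 by apply: lt_trans th1 _; rewrite gtrBl.
have th3 : 0 < 1 - th by rewrite subr_gt0.
have th4 : 0 < 1 + th by rewrite addr_gt0.
(* The conjugate exponent [p'] satisfies [th p' = (1 + th) / 2 < 1], which keeps [t^(- th p')]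
   integrable at 0. *)
pose p := (1 + th) / (1 - th); have p1 : 1 <= p by rewrite /p ler_pdivlMr//; lra.
have p0 : 0 < p by apply: lt_le_trans p1.
pose p' := (1 + th) / (2 * th); have p'0 : 0 < p' by rewrite divr_gt0// mulr_gt0.
have pp' : p^-1 + p'^-1 = 1 by rewrite /p /p'; field; rewrite !gt_eqF.
have p'1 : p'^-1 <= 1 by rewrite -pp' lerDr invr_ge0 ltW.
have pi1 : p^-1 <= 1 by rewrite invf_le1.
have [C C0 hC] := HG p p1.
have bd := blin_radj bD.
have ch v : pos_cont (fun t => nrm (radj D (S' t v))).
  by apply: pos_cont_nrm; apply: pos_cont_blin => //; exact: (rsg_cont hSd).
have cth v : pos_cont (fun t => t `^ (- th) * nrm (radj D (S' t v))).
  by move=> t t0; apply: continuousM; [exact: pos_cont_powR|exact: ch].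
have sT : `]0, T[%classic `<=` (`]0, +oo[%classic : set R).
  by move=> t /=; rewrite !in_itv/= andbT => /andP[].
have sT' : `]0, T[%classic `<=` (`]0, T]%classic : set R).
  by move=> t /=; rewrite !in_itv/= => /andP[-> /ltW].
have ip1 : intg `]0, T[ (fun t => t `^ (- (th + gamma))).
  have -> : - (th + gamma) = (1 - th - gamma) - 1 by ring.
  by apply: (intgS _ _ sT') => //; apply: intg_powR; lra.
have ip2 : intg `]0, T[ (fun t => t `^ (- (th * p'))).
  have -> : - (th * p') = (1 - th) / 2 - 1 by rewrite /p'; field; rewrite gt_eqF.
  by apply: (intgS _ _ sT') => //; apply: intg_powR; lra.
pose I1 := \int[mu]_(t in `]0, T[) t `^ (- (th + gamma)).
pose I2 := \int[mu]_(t in `]0, T[) t `^ (- (th * p')).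
have I1_0 : 0 <= I1 by apply: Rintegral_ge0 => // t _; exact: powR_ge0.
have I2_0 : 0 <= I2 by apply: Rintegral_ge0 => // t _; exact: powR_ge0.
pose K1 := N * I1 + I2 + C `^ p.
have K10 : 0 <= K1 by rewrite !addr_ge0 ?powR_ge0// mulr_ge0// ltW.
have near0 v : (\int[mu]_(t in `]0%R, T[) (t `^ (- th) * nrm (radj D (S' t v)))%:E <=
    (K1 * nrm (radj Ai v))%:E)%E.
  have [f [mf f0 hf hGf]] := hC v.
  set nu := nrm (radj Ai v) in hf *.
  have : 0 <= nu by exact: nrm_ge0.
  rewrite le_eqVlt => /predU1P[nu0|nu0].
    have v0 : v = 0.
      by apply: (radj_Ainvs_inj hS); rewrite (blin0 (blin_radj bAi)); apply: nrm0_eq0.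
    rewrite -nu0 mulr0 integral0_eq// => t; rewrite /= in_itv/= => /andP[t0 _].
    by rewrite v0 (blin0 (rsg_blin hSd (ltW t0))) (blin0 bd) nrm0 mulr0.
  (* Majorant from the bound on [F] and Young's inequality for [t^-th] times [f / nu]. Normalizing
     by [nu] produces [nu^(1 - p)] and keeps the resulting bound linear in [nu]. *)
  pose g t := (nu * N * t `^ (- (th + gamma)) + nu * t `^ (- (th * p'))) + nu `^ (1 - p) * f t `^ p.
  have mpw r : measurable_fun (`]0, T[ : set (measurableTypeR R)) (fun t : R => t `^ r).
    by apply: msub_pos => //; exact: pos_cont_powR.
  have mfp : measurable_fun (`]0, T[ : set (measurableTypeR R)) (fun t : R => f t `^ p).
    exact: (measurableT_comp (measurable_powR p) mf).
  have mg1 : measurable_fun (`]0, T[ : set (measurableTypeR R))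
      (fun t : R => nu * N * t `^ (- (th + gamma)) + nu * t `^ (- (th * p'))).
    by apply: measurable_funD; apply: measurable_funM => //; exact: measurable_cst.
  have mg2 : measurable_fun (`]0, T[ : set (measurableTypeR R)) (fun t : R => nu `^ (1 - p) * f t `^ p).
    by apply: measurable_funM => //; exact: measurable_cst.
  have n0 : 0 <= nu := ltW nu0.
  have N0 : 0 <= N := ltW N_gt0.
  apply: (@le_trans _ _ (\int[mu]_(t in `]0%R, T[) (g t)%:E)%E).
    apply: ae_ge0_le_integral => //.
    - by move=> t _; rewrite lee_fin mulr_ge0 ?powR_ge0 ?nrm_ge0.
    - by apply/measurable_EFinP; exact: msub_pos.
    - by move=> t _; rewrite lee_fin !addr_ge0 ?mulr_ge0 ?powR_ge0.
    - by apply/measurable_EFinP; apply: measurable_funD.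
    apply: (@filterS _ _ (ae_filter_ringOfSetsType mu) _ _ _ hGf) => t ht tD; have := ht tD => {}ht.
    move: tD; rewrite /= in_itv/= => /andP[t0 _]; rewrite lee_fin HFG// /g.
    have a0 : 0 <= t `^ (- th) := powR_ge0 _ _.
    apply: (le_trans (ler_wpM2l a0 (nrmD _ _))); rewrite ht mulrDr -addrA; apply: lerD.
      have -> : nu * N * t `^ (- (th + gamma)) = t `^ (- th) * (N * t `^ (- gamma) * nu).
        by rewrite opprD powRD; [ring|apply/implyP => _; rewrite gt_eqF].
      by rewrite ler_wpM2l//; exact: F_le.
    have y := @conjugate_powR R (t `^ (- th)) (f t / nu) p' p a0 (divr_ge0 (f0 t) n0) p'0 p0.
    rewrite [p'^-1 + _]addrC in y; have {}y := y pp'.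
    have -> : t `^ (- th) * f t = nu * (t `^ (- th) * (f t / nu)).
      by field; rewrite gt_eqF.
    apply: (le_trans (ler_wpM2l n0 y)); rewrite mulrDr; apply: lerD.
      by rewrite -powRrM mulNr ler_wpM2l// ler_piMr// powR_ge0.
    have -> : nu `^ (1 - p) * f t `^ p = nu * (f t / nu) `^ p.
      rewrite powRM ?invr_ge0// ?f0// -powR_inv1// -powRrM mulN1r powRD; last by apply/implyP => _; rewrite gt_eqF.
      by rewrite powRr1//; ring.
    by rewrite ler_wpM2l// ler_piMr// powR_ge0.
  rewrite /g; under eq_integral do rewrite EFinD.
  rewrite ge0_integralD//; last 4 first.
  - by move=> t _; rewrite lee_fin addr_ge0 ?mulr_ge0 ?powR_ge0.
  - exact/measurable_EFinP.
  - by move=> t _; rewrite lee_fin mulr_ge0 ?powR_ge0.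
  - exact/measurable_EFinP.
  under eq_integral do rewrite EFinD.
  rewrite ge0_integralD//; last 4 first.
  - by move=> t _; rewrite lee_fin ?mulr_ge0 ?powR_ge0.
  - by apply/measurable_EFinP; apply: measurable_funM => //; exact: measurable_cst.
  - by move=> t _; rewrite lee_fin mulr_ge0 ?powR_ge0.
  - by apply/measurable_EFinP; apply: measurable_funM => //; exact: measurable_cst.
  under eq_integral do rewrite EFinM.
  under [in X in (_ + X + _)%E]eq_integral do rewrite EFinM.
  under [in X in (_ + X)%E]eq_integral do rewrite EFinM.
  have fE (h : R -> R) : intg `]0, T[ h ->
      (\int[mu]_(t in `]0%R, T[) (h t)%:E)%E = (\int[mu]_(t in `]0, T[) h t)%:E.
    by move=> ih; rewrite /Rintegral fineK//; exact: integrable_fin_num ih.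
  rewrite !ge0_integralZl//; try by [move=> t _; rewrite lee_fin powR_ge0 | exact/measurable_EFinP
    | rewrite lee_fin ?mulr_ge0 ?powR_ge0].
  rewrite (fE _ ip1) (fE _ ip2) -/I1 -/I2.
  have h3 : ((nu `^ (1 - p))%:E * (\int[mu]_(t in `]0%R, T[) (f t `^ p)%:E) <= (C `^ p * nu)%:E)%E.
    apply: (le_trans (lee_wpmul2l _ hf)); rewrite ?lee_fin ?powR_ge0//.
    have -> : C `^ p * nu = nu `^ (1 - p) * (C * nu) `^ p; last by [].
    rewrite powRM// mulrCA -powRD; last by apply/implyP => _; rewrite gt_eqF.
    by rewrite subrK powRr1.
  apply: (le_trans (leeD (lexx _) h3)); rewrite -!EFinM -!EFinD lee_fin le_eqVlt.
  by apply/orP; left; apply/eqP; rewrite /K1; ring.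
have TT : T `^ (- th) * T `^ th = 1 by rewrite powRN mulVf// gt_eqF// powR_gt0.
(* Beyond [T] the weight is at most [T^-th], so an unweighted integral suffices there. On []0, T[]
   the unweighted integral is at most [T^th] times the weighted one, and [chunk_bound] with exponent
   1 carries it to the half-line. *)
have [||||||||K2 K20 hK2] := @chunk_bound _ _ _ _ _ hSd (fun t v => nrm (radj D (S' t v)))
   (fun v => nrm (radj Ai v)) (T `^ th * K1) 1 T T_gt0.
- by rewrite mulr_ge0 ?powR_ge0.
- by [].
- by move=> x; exact: nrm_ge0.
- move=> t x t0; rewrite hS'//.
  have -> : radj Ai (radj (S t) x) = S' t (radj Ai x).
    rewrite hS'//; apply: ip_eq => y; have bs : blin (S t) := rsg_blin hS t0.
    by rewrite ![ip _ y]ipC -!radjP// (SAinvs hS).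
  exact: (rsg_exp hSd).
- by move=> t x; exact: nrm_ge0.
- exact: ch.
- by move=> s t x s0 t0; rewrite (rsgD hSd)// ltW.
- move=> v; rewrite powRr1 ?nrm_ge0// -mulrA EFinM.
  apply: le_trans (lee_wpmul2l _ (near0 v)); last by rewrite lee_fin powR_ge0.
  rewrite -ge0_integralZl//; last 3 first.
  - by apply/measurable_EFinP; exact: msub_pos.
  - by move=> t _; rewrite lee_fin mulr_ge0 ?powR_ge0 ?nrm_ge0.
  - by rewrite lee_fin powR_ge0.
  apply: ge0_le_integral => //.
  - by move=> t _; rewrite lee_fin nrm_ge0.
  - by apply/measurable_EFinP; exact: msub_pos.
  - by apply/measurable_EFinP; apply: measurable_funM; [exact: measurable_cst|exact: msub_pos].
  move=> t /=; rewrite in_itv/= => /andP[t0 tT]; rewrite -EFinM lee_fin mulrA.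
  rewrite ler_peMl ?nrm_ge0//.
  have h : t `^ th <= T `^ th by rewrite ge0_ler_powR ?nnegrE ?ltW.
  have -> : 1 = t `^ th * t `^ (- th) by rewrite powRN mulfV// gt_eqF// powR_gt0.
  by rewrite ler_wpM2r ?powR_ge0.
exists (K1 + T `^ (- th) * K2); first by rewrite addr_ge0// mulr_ge0// powR_ge0.
move=> v; have [i2 l2] := hK2 v; rewrite powRr1 ?nrm_ge0// in l2.
have [i1 l1] := intg_ge0_le (mble_itv _) (msub_pos sT (cth v))
  (fun t _ => mulr_ge0 (powR_ge0 t (- th)) (nrm_ge0 _)) (near0 v).
have P0 : 0 <= T `^ (- th) := powR_ge0 _ _.
have fE D' (h : R -> R) : mble D' -> intg D' h ->
    (\int[mu]_(t in D') (h t)%:E)%E = (\int[mu]_(t in D') h t)%:E.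
  by move=> mD' ih; rewrite /Rintegral fineK//; exact: integrable_fin_num ih.
apply: intg_ge0_le => //.
- exact: msub_pos.
- by move=> t _; rewrite mulr_ge0 ?powR_ge0 ?nrm_ge0.
have -> : `]0, +oo[%classic = `]0, T[ `|` `[T, +oo[ :> set R.
  by rewrite -itv_bndbnd_setU// bnd_simp ltW.
rewrite ge0_integral_setU//=; last 3 first.
- apply/measurable_EFinP; apply: msub_pos => // t [|]/=; rewrite !in_itv/= ?andbT.
    by case/andP.
  exact: lt_le_trans.
- by move=> t _; rewrite lee_fin mulr_ge0 ?powR_ge0 ?nrm_ge0.
- apply/disj_setPS => t [/=]; rewrite !in_itv/= andbT => /andP[_ h1] h2.
  by have := lt_le_trans h1 h2; rewrite ltxx.
rewrite mulrDl EFinD; apply: leeD; first by rewrite (fE _ _ _ i1)// lee_fin.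
rewrite -mulrA EFinM; have P0e : (0 <= (T `^ (- th))%:E)%E by rewrite lee_fin.
apply: le_trans (lee_wpmul2l P0e (_ : (\int[mu]_(t in `]0%R, +oo[) (nrm (radj D (S' t v)))%:E <= _)%E)); last first.
  by rewrite (fE _ _ _ i2)// lee_fin.
have sub : `[T, +oo[%classic `<=` (`]0, +oo[%classic : set R).
  by move=> t /=; rewrite !in_itv/= !andbT; exact: lt_le_trans.
have m1 : measurable_fun (`]0, +oo[ : set (measurableTypeR R))
    (fun t => ((T `^ (- th))%:E * (nrm (radj D (S' t v)))%:E)%E).
  by apply/measurable_EFinP; apply: measurable_funM; [exact: measurable_cst|exact: msub_pos].
have g0 (t : R) : `]0%R, +oo[%classic t -> (0 <= (T `^ (- th))%:E * (nrm (radj D (S' t v)))%:E)%E.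
  by move=> _; rewrite -EFinM lee_fin mulr_ge0 ?nrm_ge0.
have -> : ((T `^ (- th))%:E * (\int[mu]_(t in `]0%R, +oo[) (nrm (radj D (S' t v)))%:E) =
    \int[mu]_(t in `]0%R, +oo[) ((T `^ (- th))%:E * (nrm (radj D (S' t v)))%:E))%E.
  rewrite ge0_integralZl//; last by move=> t _; rewrite lee_fin nrm_ge0.
  by apply/measurable_EFinP; exact: msub_pos.
apply: (le_trans _ (ge0_subset_integral mu (mble_itv _) (mble_itv _) m1 g0 sub)).
apply: ge0_le_integral => //.
- by move=> t _; rewrite lee_fin mulr_ge0 ?powR_ge0 ?nrm_ge0.
- by apply/measurable_EFinP; exact: msub_pos.
- exact: measurable_funS m1.
move=> t /=; rewrite in_itv/= andbT => tT; have t0 := lt_le_trans T_gt0 tT.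
rewrite -EFinM lee_fin ler_wpM2r ?nrm_ge0// !powRN lef_pV2 ?posrE ?powR_gt0//.
by apply: ge0_ler_powR; rewrite ?nnegrE ?(ltW th0) ?(ltW t0) ?(ltW T_gt0).
Qed.

End KernelBounds.

(** * Weak identification of controls *)

Lemma Rint_cvg (R : realType) (D : set R) (fn : nat -> R -> R) (f g : R -> R) : mble D ->
  (forall n, measurable_fun (D : set (measurableTypeR R)) (fn n)) ->
  measurable_fun (D : set (measurableTypeR R)) f -> intg D g ->
  (forall n t, D t -> `|fn n t| <= g t) ->
  (forall t, D t -> fn ^~ t @ \oo --> f t) ->
  intg D f /\ (fun n => \int[@lebesgue_measure R]_(t in D) fn n t) @ \oo -->
    \int[@lebesgue_measure R]_(t in D) f t.
Proof.
move=> mD mfn mf ig fg fc.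
have fc' t : D t -> (fun n => (EFin \o fn n) t) @ \oo --> (EFin \o f) t.
  by move=> Dt; apply: cvg_EFin; [exact: nearW|exact: fc].
have fg' t n : D t -> (`|(EFin \o fn n) t| <= (EFin \o g) t)%E.
  by move=> Dt; rewrite /= lee_fin fg.
have mfn' n : measurable_fun (D : set (measurableTypeR R)) (EFin \o fn n) by exact/measurable_EFinP.
have mf' : measurable_fun (D : set (measurableTypeR R)) (EFin \o f) by exact/measurable_EFinP.
have [||i1 _ i2] := dominated_convergence mD mfn' mf' _ ig _; first exact: aeW.
  exact: aeW.
split => //.
have ifn n : intg D (fn n) by apply: intg_le (fg n) ig.
have h : (\int[@lebesgue_measure R]_(t in D) (f t)%:E)%E = (\int[@lebesgue_measure R]_(t in D) f t)%:E.
  by rewrite /Rintegral fineK//; exact: integrable_fin_num i1.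
by move: i2; rewrite /= h => /fine_cvg.
Qed.

Section StepFunctions.
Context {R : realType} {V : hilbertType R}.
Notation mu := (@lebesgue_measure R).

(** Samples at the right end of the cell of width [d] containing [s]. That point is positive even in
    the first cell, so the behaviour of [g] at 0 does not matter. *)
Definition gstep (d : R) (g : R -> V) (s : R) : V :=
  g (d * (Num.truncn (s / d)).+1%:R).

Lemma gstep_itv (d : R) g (k : nat) s : 0 < d -> k%:R * d <= s -> s < k.+1%:R * d ->
  gstep d g s = g (d * k.+1%:R).
Proof.
move=> d0 h1 h2; rewrite /gstep; congr (g (d * _.+1%:R)).
by apply: truncn_def; rewrite ler_pdivlMr// h1 ltr_pdivrMr.
Qed.

Lemma gstep_near (d s : R) : 0 < d -> 0 < s ->
  s < d * (Num.truncn (s / d)).+1%:R <= s + d.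
Proof.
move=> d0 s0; have h : 0 <= s / d by rewrite divr_ge0 ?ltW.
have /andP[h1 h2] := truncn_itv h.
rewrite ler_pdivlMr// in h1; rewrite ltr_pdivrMr// in h2.
by rewrite mulrC h2/= -natr1 mulrDl mul1r lerD2r.
Qed.

Lemma gstep_cvg (g : R -> V) (d : nat -> R) s : (forall n, 0 < d n) -> d @ \oo --> (0 : R) ->
  0 < s -> {for s, continuous g} -> (fun n => gstep (d n) g s) @ \oo --> g s.
Proof.
move=> d0 d00 s0 cg.
suff h : (fun n => d n * (Num.truncn (s / d n)).+1%:R) @ \oo --> s by rewrite /gstep; apply: (@cvg_comp _ _ _ _ g _ _ _ h); exact: cg.
apply/cvgrPdist_lt => e e0; have /cvgrPdist_lt/(_ _ e0) := d00.
apply: filterS => n; rewrite sub0r normrN (ger0_norm (ltW (d0 n))) => dn.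
have /andP[h1 h2] := gstep_near (d0 n) s0.
by rewrite distrC ger0_norm ?subr_ge0 ?(ltW h1)// ltrBlDl (le_lt_trans h2)// ltrD2l.
Qed.

Lemma meas_ip_step (D : set R) (f g : R -> V) d : mble D -> D `<=` `]0, +oo[ -> 0 < d ->
  vmeasurable D f ->
  measurable_fun (D : set (measurableTypeR R)) (fun s => ip (f s) (gstep d g s)).
Proof.
move=> mD sD d0 vf.
have -> : D = \bigcup_(k in setT) (D `&` `[(k%:R * d)%R, (k.+1%:R * d)%R[).
  apply/seteqP; split => [s Ds|s [k _ []//]].
  have s0 : 0 <= s by move/sD : Ds; rewrite /= in_itv/= andbT => /ltW.
  exists (Num.truncn (s / d)) => //; split => //=; rewrite in_itv/=.
  by have := truncn_itv (divr_ge0 s0 (ltW d0)); rewrite ler_pdivlMr// ltr_pdivrMr.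
have mE k : mble (D `&` `[(k%:R * d)%R, (k.+1%:R * d)%R[) by apply: measurableI.
apply/measurable_fun_bigcup => // k.
apply: (eq_measurable_fun (fun s => ip (f s) (g (d * k.+1%:R)))).
  by move=> s /set_mem[_ /=]; rewrite in_itv/= => /andP[h1 h2]; rewrite (gstep_itv _ d0 h1 h2).
apply: (@vmeas_meas _ _ _ f (fun x => ip x _)) => //; last exact: ip_continuous.
by apply: vmeasS vf => // s [].
Qed.

Lemma seq_half_cvg (c : R) : (fun n : nat => c * n.+1%:R^-1) @ \oo --> (0 : R).
Proof.
have := @cvg_harmonic R => h; rewrite -[X in _ --> X](mulr0 c).
by apply: cvgM => //; exact: cvg_cst.
Qed.

(** Both arguments vary. Replacing [g] by its step functions leaves pairings of [f] with countably
    many fixed vectors, and the step functions converge pointwise. *)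
Lemma meas_ip (D : set R) (f g : R -> V) : mble D -> D `<=` `]0, +oo[ ->
  vmeasurable D f -> (forall s, D s -> {for s, continuous g}) ->
  measurable_fun (D : set (measurableTypeR R)) (fun s => ip (f s) (g s)).
Proof.
move=> mD sD vf cg.
have d0 n : 0 < 1 * (n.+1%:R : R)^-1 by rewrite mul1r invr_gt0.
apply: (@measurable_fun_cvg _ _ _ D (fun n s => ip (f s) (gstep (1 * n.+1%:R^-1) g s))) => //.
  by move=> n; exact: meas_ip_step.
move=> s Ds; apply: cvg_ip; first exact: cvg_cst.
apply: gstep_cvg => //; [exact: seq_half_cvg| |exact: cg].
by move/sD : Ds; rewrite /= in_itv/= andbT.
Qed.

Section weak.
Context (T C : R) (g : R -> V).
Hypotheses (T0 : 0 < T) (cg : pos_cont g) (gC : forall s, 0 < s -> s <= T -> nrm (g s) <= C).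

Let sD : `]0, T[ `<=` (`]0, +oo[%classic : set R).
Proof. by move=> t /=; rewrite !in_itv/= andbT => /andP[]. Qed.

Let d n := T * (n.+1%:R : R)^-1.
Let d0 n : 0 < d n. Proof. by rewrite divr_gt0. Qed.
Let nd n : n.+1%:R * d n = T. Proof. by rewrite /d mulrCA mulfV// mulr1. Qed.

Section one.
Context (f : R -> V).
Hypotheses (vf : vmeasurable `]0, T[ f) (intf : intg `]0, T[ (fun s => nrm (f s))).

Let fn n s := ip (f s) (gstep (d n) g s).

Let fn_le n s : `]0, T[%classic s -> `|fn n s| <= C * nrm (f s).
Proof.
rewrite /= in_itv/= => /andP[s0 sT]; apply: le_trans (ip_le _ _) _.
rewrite mulrC ler_wpM2r ?nrm_ge0//; apply: gC; first by rewrite mulr_gt0.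
rewrite /d mulrAC ler_pdivrMr// ler_wpM2l ?(ltW T0)// ler_nat.
have h : 0 <= s / d n by rewrite divr_ge0 ?ltW.
rewrite -(ltr_nat R); have /andP[h1 _] := truncn_itv h; apply: le_lt_trans h1 _.
by rewrite ltr_pdivrMr// nd.
Qed.

Let ifn n : intg `]0, T[ (fn n).
Proof.
apply: (@intg_le _ _ _ (fun s => C * nrm (f s))) => //.
- exact: meas_ip_step.
- exact: fn_le.
- exact: intgZ.
Qed.

(** The integral over a cell is a difference of integrals over intervals starting at 0, so only
    primitives of [f] against fixed vectors enter. *)
Lemma gstep_sum n k : (k <= n.+1)%N -> \int[mu]_(s in `]0, (k%:R * d n)%R[) fn n s =
  \sum_(i < k) (\int[mu]_(s in `]0, (i.+1%:R * d n)%R[) ip (f s) (g (d n * i.+1%:R)) -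
    \int[mu]_(s in `]0, (i%:R * d n)%R[) ip (f s) (g (d n * i.+1%:R))).
Proof.
elim: k => [|k IH] kn.
  by rewrite mul0r set_itv_ge ?bnd_simp ?ltxx// Rintegral_set0 big_ord0.
have kd0 : 0 <= k%:R * d n by rewrite mulr_ge0// ltW.
have kd1 : k%:R * d n < k.+1%:R * d n by rewrite ltr_pM2r// ltr_nat.
have kT : k.+1%:R * d n <= T by rewrite -(nd n) ler_wpM2r ?(ltW (d0 _))// ler_nat.
have sub : `]0, (k.+1%:R * d n)%R[ `<=` (`]0, T[%classic : set R).
  by move=> t /=; rewrite !in_itv/= => /andP[-> /lt_le_trans]; apply.
rewrite (@Rint_cut _ _ 0 (k%:R * d n)) ?bnd_simp//; last exact: intgS (ifn n).
rewrite IH; last exact: ltnW.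
rewrite big_ord_recr/=; congr (_ + _); set u := g (d n * k.+1%:R).
have iu : intg `]0, T[ (fun s => ip (f s) u).
  by apply: intg_ip => //; apply/in_Lp1P.
rewrite [in RHS](@Rint_cut _ _ 0 (k%:R * d n)) ?bnd_simp//; last exact: intgS iu.
rewrite addrAC subrr add0r; apply: eq_Rintegral => s; rewrite inE/= in_itv/= => /andP[/ltW h1 h2].
by rewrite /fn (gstep_itv _ (d0 n) h1 h2).
Qed.

Lemma gstep_lim : intg `]0, T[ (fun s => ip (f s) (g s)) /\
  (fun n => \int[mu]_(s in `]0, T[) fn n s) @ \oo --> \int[mu]_(s in `]0, T[) ip (f s) (g s).
Proof.
have mf : measurable_fun (`]0, T[ : set (measurableTypeR R)) (fun s => ip (f s) (g s)).
  by apply: meas_ip => // s /sD /=; rewrite in_itv/= andbT; exact: cg.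
apply: (Rint_cvg (mble_itv _) (fun n => intg_meas (ifn n)) mf (intgZ C (mble_itv _) intf) fn_le).
move=> s; rewrite /= in_itv/= => /andP[s0 sT]; apply: cvg_ip; first exact: cvg_cst.
by apply: gstep_cvg => //; [exact: seq_half_cvg|exact: cg].
Qed.

End one.

(* Functions with the same weak primitives have the same integrals against
   step functions, hence against continuous functions. *)
Lemma weak_eq (f1 f2 : R -> V) : vmeasurable `]0, T[ f1 -> vmeasurable `]0, T[ f2 ->
  intg `]0, T[ (fun s => nrm (f1 s)) -> intg `]0, T[ (fun s => nrm (f2 s)) ->
  (forall h u, 0 < h -> h <= T ->
     \int[mu]_(s in `]0, h[) ip (f1 s) u = \int[mu]_(s in `]0, h[) ip (f2 s) u) ->
  \int[mu]_(s in `]0, T[) ip (f1 s) (g s) = \int[mu]_(s in `]0, T[) ip (f2 s) (g s).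
Proof.
move=> v1 v2 i1 i2 f12; have [_ l1] := gstep_lim v1 i1; have [_ l2] := gstep_lim v2 i2.
have f12' h u : 0 <= h -> h <= T ->
    \int[mu]_(s in `]0, h[) ip (f1 s) u = \int[mu]_(s in `]0, h[) ip (f2 s) u.
  rewrite le_eqVlt => /predU1P[<- _|]; last exact: f12.
  by rewrite set_itv_ge ?bnd_simp ?ltxx// !Rintegral_set0.
suff e n : \int[mu]_(s in `]0, T[) ip (f1 s) (gstep (d n) g s) =
           \int[mu]_(s in `]0, T[) ip (f2 s) (gstep (d n) g s).
  have l3 : (fun n => \int[mu]_(s in `]0, T[) ip (f1 s) (gstep (d n) g s)) @ \oo -->
      \int[mu]_(s in `]0, T[) ip (f2 s) (g s) by under eq_fun do rewrite e.
  by apply: (cvg_unique _ l1 l3); exact: Rhausdorff.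
have := gstep_sum v1 i1 (leqnn n.+1); have := gstep_sum v2 i2 (leqnn n.+1).
rewrite nd => -> ->; apply: eq_bigr => i _.
have b (k : nat) : (k <= n.+1)%N -> 0 <= k%:R * d n /\ k%:R * d n <= T.
  move=> kn; rewrite mulr_ge0// ?(ltW (d0 _))//; split => //.
  by rewrite -(nd n) ler_wpM2r ?(ltW (d0 _))// ler_nat.
have [a1 a2] := b i.+1 (ltn_ord i); have [b1 b2] := b i (ltnW (ltn_ord i)).
by rewrite (f12' _ _ a1 a2) (f12' _ _ b1 b2).
Qed.

End weak.

End StepFunctions.

Lemma avg_lim (R : realType) (f : R -> R -> R) (l : R) :
  (forall t, 0 < t -> intg `]0, t[ (f t)) ->
  (forall e, 0 < e -> exists2 d, 0 < d & forall t s, 0 < s -> s < t -> t < d ->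
     `|f t s - l| <= e) ->
  (fun t => t^-1 * \int[@lebesgue_measure R]_(s in `]0, t[) f t s) @ (0 : R)^'+ --> l.
Proof.
move=> fi fl; apply/cvgrPdist_le => e e0; have [d d0 hd] := fl e e0.
near=> t.
have t0 : 0 < t by near: t; exact: nbhs_right_gt.
have td : t < d by near: t; exact: nbhs_right_lt.
have -> : l - t^-1 * \int[@lebesgue_measure R]_(s in `]0, t[) f t s =
    - (t^-1 * \int[@lebesgue_measure R]_(s in `]0, t[) (f t s - l)).
  rewrite RintegralB//; [|exact: fi|exact: intg_cst].
  by rewrite Rint_cst ?(ltW t0)// subr0; field; rewrite gt_eqF.
rewrite normrN normrM gtr0_norm ?invr_gt0// ler_pdivrMl//.
have -> : t * e = \int[@lebesgue_measure R]_(s in `]0, t[) e.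
  by rewrite Rint_cst ?(ltW t0)// subr0 mulrC.
apply: Rint_abs_le => //.
- by apply: intgB => //; [exact: fi|exact: intg_cst].
- exact: intg_cst.
- by move=> s; rewrite /= in_itv/= => /andP[s0 st]; exact: hd.
Unshelve. all: by end_near. Qed.

Lemma near0_ip (R : realType) (V : hilbertType R) (c d : R -> V) c0 d0 :
  c @ (0 : R)^'+ --> c0 -> d @ (0 : R)^'+ --> d0 ->
  forall e, 0 < e -> exists2 r, 0 < r & forall s t, 0 < s -> s < r -> 0 < t -> t < r ->
    `|ip (c s) (d t) - ip c0 d0| <= e.
Proof.
move=> hc hd e e0.
have K0 : 0 < nrm c0 + nrm d0 + 1 by rewrite ltr_wpDl// addr_ge0// nrm_ge0.
pose e1 := Num.min 1 (e / (nrm c0 + nrm d0 + 1)).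
have e10 : 0 < e1 by rewrite lt_min ltr01 divr_gt0.
have e11 : e1 <= 1 by rewrite ge_min lexx.
have e12 : e1 * (nrm c0 + nrm d0 + 1) <= e by rewrite -ler_pdivlMr// ge_min lexx orbT.
have near (a : R -> V) a0 : a @ (0 : R)^'+ --> a0 -> exists2 r, 0 < r &
    forall s, 0 < s -> s < r -> nrm (a s - a0) <= e1.
  move=> /cvg_nrmP/cvgrPdist_le/(_ _ e10)[r /= r0 hr]; exists r => // s s0 sr.
  have := hr s; rewrite /= sub0r normrN gtr0_norm// => /(_ sr s0).
  by rewrite sub0r normrN ger0_norm ?nrm_ge0.
have [r1 r10 h1] := near _ _ hc; have [r2 r20 h2] := near _ _ hd.
exists (Num.min r1 r2); first by rewrite lt_min r10.
move=> s t s0; rewrite !lt_min => /andP[sr _] t0 /andP[_ tr].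
have {h1}h1 := h1 s s0 sr; have {h2}h2 := h2 t t0 tr.
have -> : ip (c s) (d t) - ip c0 d0 = ip (c s - c0) (d t - d0) + ip (c s - c0) d0 + ip c0 (d t - d0).
  by rewrite !ipBl !ipBr; ring.
apply: le_trans (ler_normD _ _) _; apply: le_trans (lerD (ler_normD _ _) (lexx _)) _.
have n1 := nrm_ge0 (c s - c0); have n2 := nrm_ge0 (d t - d0).
have n3 := nrm_ge0 c0; have n4 := nrm_ge0 d0.
have := ip_le (c s - c0) (d t - d0); have := ip_le (c s - c0) d0; have := ip_le c0 (d t - d0).
move: `|_| `|_| `|_| n1 n2 n3 n4 h1 h2 e12 => a b g; move: (nrm _) (nrm _) (nrm _) (nrm _) => x y p q.
nra.
Qed.

Lemma bilin_op (R : realType) (V W : hilbertType R) (b : V -> W -> R) C : 0 <= C ->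
  (forall r x y z, b (r%:C *: x + y) z = r * b x z + b y z) ->
  (forall r x y z, b x (r%:C *: y + z) = r * b x y + b x z) ->
  (forall x z, b x z <= C * nrm x * nrm z) ->
  exists2 T : V -> W, blin T & forall x z, ip (T x) z = b x z.
Proof.
move=> C0 b1 b2 bC.
have ex x : exists p, (forall z, b x z = ip z p) /\ nrm p <= C * nrm x.
  have [p p1 p2] := @riesz R W (b x) (C * nrm x) (mulr_ge0 C0 (nrm_ge0 x)) (fun r y z => b2 r x y z) (bC x).
  by exists p.
pose T x := xget 0 [set p | (forall z, b x z = ip z p) /\ nrm p <= C * nrm x].
have TP x : (forall z, b x z = ip z (T x)) /\ nrm (T x) <= C * nrm x.
  exact: (@xgetPP _ [set p | (forall z, b x z = ip z p) /\ nrm p <= C * nrm x] 0 (ex x)).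
exists T; last by move=> x z; rewrite (TP x).1 ipC.
split; last by exists C => // x; exact: (TP x).2.
move=> r x y; apply: ip_eq => z.
by rewrite ipDl ipZl ![ip (T _) z]ipC -!(TP _).1 b1.
Qed.

(** At [s = - b / (|a| + 1)] the polynomial is the square of [s] times [a - 2 (|a| + 1)], which is
    negative unless [b = 0]. *)
Lemma quad0 (R : realFieldType) (a b : R) : (forall s, 0 <= 2 * s * b + s ^+ 2 * a) -> b = 0.
Proof.
move=> h; apply/eqP; case: eqVneq => // b0.
have a0 : 0 < `|a| + 1 by rewrite ltr_wpDl.
have := h (- b / (`|a| + 1)).
have -> : 2 * (- b / (`|a| + 1)) * b + (- b / (`|a| + 1)) ^+ 2 * a =
  (b / (`|a| + 1)) ^+ 2 * (a - 2 * (`|a| + 1)) by field; rewrite gt_eqF.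
have b1 : 0 < (b / (`|a| + 1)) ^+ 2 by rewrite exprn_even_gt0//= mulf_neq0// invr_eq0 gt_eqF.
rewrite pmulr_rge0//; have := ler_norm a; have := normr_ge0 a; lra.
Qed.

Lemma rsg_cont_comp (R : realType) (V : hilbertType R) (S : R -> V -> V) (M w : R) (a : R -> R) x t0 :
  rsg S M w -> (forall t, 0 <= a t) -> {for t0, continuous a} ->
  {for t0, continuous (fun t => S (a t) x)}.
Proof.
move=> hS a0 ca; apply/cvg_nrmP/cvgrPdist_le => e e0.
have M0 : 0 < M by case: hS => _ _ _ _ [h _ _]; apply: lt_le_trans h.
have e1 : 0 < e / M by rewrite divr_gt0.
have [d d0 hd] := rsg_near0 hS x e1.
have /cvgrPdist_lt/(_ _ d0) := ca; apply: filterS => t ht.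
rewrite sub0r normrN ger0_norm ?nrm_ge0//.
apply: le_trans (rsg_mod hS x (a0 t) (a0 t0)) _; rewrite -ler_pdivlMl// mulrC.
by apply/ltW/hd; rewrite // distrC.
Qed.

(** * The optimal feedback *)

Lemma Rint_0eq (R : realType) (D : set R) (f : R -> R) : (forall t, D t -> f t = 0) ->
  \int[@lebesgue_measure R]_(t in D) f t = 0.
Proof. by move=> f0; rewrite /Rintegral integral0_eq// => t Dt; rewrite f0. Qed.

Section Feedback.
Context {R : realType} {Y U Z : hilbertType R}.
Notation mu := (@lebesgue_measure R).
Context (S S' : R -> Y -> Y) (M w : R).
Hypothesis hS : rsg S M w.
Hypothesis hS' : forall t, 0 <= t -> S' t = radj (S t).
Context (D : U -> Y) (Rb : Y -> Z).
Hypotheses (bD : blin D) (bR : blin Rb).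
Context (Phi : R -> Y -> Y) (Mp wp : R).
Hypothesis hP : rsg Phi Mp wp.
Let M0 : 0 <= M. Proof. by case: hS => _ _ _ _ [h _ _]; apply: le_trans h. Qed.
Let w0 : 0 < w. Proof. by case: hS => _ _ _ _ []. Qed.
Let Mp0 : 0 <= Mp. Proof. by case: hP => _ _ _ _ [h _ _]; apply: le_trans h. Qed.
Let bAi := Ainvs_blin hS.
Let hSd := rsg_adj hS hS'.
Notation Ai := (Ainvs S).
Notation Api := (Ainvs Phi).

(** The vectors [radj Ai v] exhaust the domain of the adjoint generator, and [radj D v] is [B'] at
    [radj Ai v]; the variation of constants formula is thus stated with bounded operators. *)
Definition mild (x : Y) (u : R -> U) (t : R) (y : Y) := forall v,
  ip y (radj Ai v) = ip (S t x) (radj Ai v) +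
    \int[mu]_(s in `]0, t[) ip (u s) (radj D (S' (t - s) v)).

(** Competitors have trajectories continuous at positive times with square integrable observation,
    which makes their costs finite real integrals; the perturbations below are of this kind. *)
Definition optimal (x : Y) (u : R -> U) (y : R -> Y) :=
  [/\ vmeasurable `[0, +oo[ u, intg `]0, +oo[ (fun t => nrm (u t) ^+ 2),
     forall t, 0 < t -> mild x u t (y t)
   & forall f z, vmeasurable `[0, +oo[ f -> intg `]0, +oo[ (fun t => nrm (f t) ^+ 2) ->
       pos_cont z -> intg `]0, +oo[ (fun t => nrm (Rb (z t)) ^+ 2) ->
       (forall t, 0 < t -> mild x f t (z t)) ->
       \int[mu]_(t in `]0, +oo[) (nrm (Rb (y t)) ^+ 2 + nrm (u t) ^+ 2) <=
       \int[mu]_(t in `]0, +oo[) (nrm (Rb (z t)) ^+ 2 + nrm (f t) ^+ 2)].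

Let cobs (t : R) : `]0, +oo[%classic t -> 0 < t.
Proof. by rewrite /= in_itv/= andbT. Qed.

Lemma sq_intg (f : R -> R) K r : pos_cont f -> 0 < r ->
  (forall t, 0 < t -> `|f t| <= K * expR (- r * t)) -> intg `]0, +oo[ f.
Proof.
move=> cf r0 fK; apply: (@intg_le _ _ _ (fun t => K * expR (- r * t))) => //.
- exact: msub_pos.
- by move=> t /=; rewrite in_itv/= andbT; exact: fK.
- by apply: intgZ => //; exact: (intg_expR r0).1.
Qed.

Lemma rsg_bnd (V : hilbertType R) (T : R -> V -> V) m r x t : rsg T m r -> 0 <= t ->
  nrm (T t x) <= m * nrm x /\ nrm (T t x) <= m * nrm x * expR (- r * t).
Proof. by move=> hT t0; split; [exact: (rsg_le hT)|rewrite mulrAC; exact: (rsg_exp hT)]. Qed.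

Lemma obs_bound : exists2 C, 0 <= C & forall x z t, 0 <= t ->
  `|ip (Rb (Phi t x)) (Rb (S t z))| <= C * nrm x * nrm z * expR (- w * t).
Proof.
case: bR => _ [c c0 hc]; exists (c * Mp * (c * M)); first by rewrite !mulr_ge0.
move=> x z t t0; apply: le_trans (ip_le _ _) _.
have -> : c * Mp * (c * M) * nrm x * nrm z * expR (- w * t) =
  (c * (Mp * nrm x)) * (c * (M * nrm z * expR (- w * t))) by ring.
have [h1 _] := rsg_bnd x hP t0; have [_ h2] := rsg_bnd z hS t0.
by apply: ler_pM; rewrite ?nrm_ge0//; apply: le_trans (hc _) _; rewrite ler_wpM2l.
Qed.

Lemma pos_cont_obs x z : pos_cont (fun t => ip (Rb (Phi t x)) (Rb (S t z))).
Proof.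
apply: pos_cont_ip; apply: pos_cont_blin => //; [exact: (rsg_cont hP)|exact: (rsg_cont hS)].
Qed.

Lemma obs_intg x z : intg `]0, +oo[ (fun t => ip (Rb (Phi t x)) (Rb (S t z))).
Proof.
have [C _ hC] := obs_bound; apply: (@sq_intg _ (C * nrm x * nrm z) w) => //.
  exact: pos_cont_obs.
by move=> t t0; apply: hC; exact: ltW.
Qed.

(** The optimal cost operator in weak form: moving [S' t R'] to the other side pairs the observed
    optimal orbit of [x] with the observed free orbit of [z], a bounded bilinear form. *)
Lemma Pop_ex : exists2 P : Y -> Y, blin P &
  forall x z, ip (P x) z = \int[mu]_(t in `]0, +oo[) ip (Rb (Phi t x)) (Rb (S t z)).
Proof.
have [C C0 hC] := obs_bound.
apply: (@bilin_op _ _ _ _ (C * w^-1)).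
- by rewrite mulr_ge0// invr_ge0 ltW.
- move=> r x y z; rewrite -RintegralZl//; last exact: obs_intg.
  rewrite -RintegralD//; [|by apply: intgZ => //; exact: obs_intg|exact: obs_intg].
  apply: eq_Rintegral => t; rewrite inE => /cobs/ltW t0.
  by rewrite (rsg_blin hP t0).1 bR.1 ipDl ipZl.
- move=> r x y z; rewrite -RintegralZl//; last exact: obs_intg.
  rewrite -RintegralD//; [|by apply: intgZ => //; exact: obs_intg|exact: obs_intg].
  apply: eq_Rintegral => t; rewrite inE => /cobs/ltW t0.
  by rewrite (rsg_blin hS t0).1 bR.1 ipDr ipZr.
move=> x z; apply: le_trans (ler_norm _) _; have [ie ee] := intg_expR w0.
have -> : C * w^-1 * nrm x * nrm z =
    \int[mu]_(t in `]0, +oo[) (C * nrm x * nrm z * expR (- w * t)).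
  by rewrite RintegralZl// ee; ring.
apply: Rint_abs_le => //; [exact: obs_intg|exact: intgZ|].
by move=> t /cobs/ltW; exact: hC.
Qed.

Lemma obs_sq (T : R -> Y -> Y) m r x : rsg T m r ->
  intg `]0, +oo[ (fun t => nrm (Rb (T t x)) ^+ 2) /\
  forall c, 0 <= c -> (forall x, nrm (Rb x) <= c * nrm x) ->
    \int[mu]_(t in `]0, +oo[) (nrm (Rb (T t x)) ^+ 2) <= (c * m) ^+ 2 / r * nrm x ^+ 2.
Proof.
move=> hT; have [m0 r0] : 0 <= m /\ 0 < r.
  by case: hT => _ _ _ _ [h1 h2 _]; split=> //; apply: le_trans h1.
have cT : pos_cont (fun t => nrm (Rb (T t x)) ^+ 2).
  by apply: pos_contM; apply: pos_cont_nrm; apply: pos_cont_blin => //; exact: (rsg_cont hT).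
have le c t : 0 <= c -> (forall x, nrm (Rb x) <= c * nrm x) -> 0 < t ->
    `|nrm (Rb (T t x)) ^+ 2| <= (c * (m * nrm x)) ^+ 2 * expR (- r * t).
  move=> c0 hc t0; rewrite ger0_norm ?sqr_ge0//.
  have e0 := expR_ge0 (- r * t); have e1 : expR (- r * t) <= 1.
    by rewrite -expR0 ler_expR mulNr oppr_le0 mulr_ge0// ltW.
  have [_ h2] := rsg_bnd x hT (ltW t0).
  apply: (@le_trans _ _ ((c * (m * nrm x) * expR (- r * t)) ^+ 2)).
    rewrite ler_sqr ?nnegrE ?nrm_ge0 ?mulr_ge0 ?nrm_ge0//; apply: le_trans (hc _) _.
    by rewrite -mulrA ler_wpM2l.
  by rewrite exprMn ler_wpM2l ?sqr_ge0// expr2 ler_piMl.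
have ii : intg `]0, +oo[ (fun t => nrm (Rb (T t x)) ^+ 2).
  by case: bR => _ [c c0 hc]; apply: (@sq_intg _ ((c * (m * nrm x)) ^+ 2) r) => // t; exact: le.
split => // c c0 hc; have [ie ee] := intg_expR r0.
have -> : (c * m) ^+ 2 / r * nrm x ^+ 2 =
    \int[mu]_(t in `]0, +oo[) ((c * (m * nrm x)) ^+ 2 * expR (- r * t)).
  by rewrite RintegralZl// ee; ring.
apply: le_trans (ler_norm _) _; apply: Rint_abs_le => //; first exact: intgZ.
by move=> t /cobs; exact: le.
Qed.

Context (P : Y -> Y).
Hypotheses (bP : blin P)
  (PE : forall x z, ip (P x) z = \int[mu]_(t in `]0, +oo[) ip (Rb (Phi t x)) (Rb (S t z))).

(** Advancing both orbits by [h] removes the first [h] units of time from the integral. Its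
    derivative at 0 is the Lyapunov type equation behind [fb_gain]. *)
Lemma P_shift h x z : 0 <= h -> ip (P (Phi h x)) (S h z) = ip (P x) z -
  \int[mu]_(t in `]0, h[) ip (Rb (Phi t x)) (Rb (S t z)).
Proof.
move=> h0; rewrite !PE; have oi := obs_intg x z.
rewrite [in RHS](@Rint_cut _ _ 0 h) ?bnd_simp// addrAC subrr add0r.
rewrite -(Rint_shift h0 oi); apply: eq_Rintegral => t; rewrite inE => /cobs/ltW t0.
by rewrite (rsgD hP)// (rsgD hS).
Qed.

Section variation.
Context (x : Y) (uh : R -> U) (h : R) (u : U).
Hypotheses (opt : optimal x uh (Phi ^~ x)) (h0 : 0 < h).
Let z := D u.

Let step (t : R) : U := if t < h then u else 0.
(** The response to [step]: since [S B u] is the time derivative of [S D u], integrating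
    [S(t - s) B u] over [s] between 0 and the smaller of [t] and [h] gives this difference. The
    truncation covers [t < h]. *)
Let l (t : R) : Y := S t z - S (Num.max (t - h) 0) z.

Let max_cont (t0 : R) : {for t0, continuous (fun t : R => Num.max (t - h) 0)}.
Proof.
apply: (@continuous_max _ _ (fun t : R => t - h) (cst 0)); last exact: cst_continuous.
by apply: cvgB; [exact: cvg_id|exact: cvg_cst].
Qed.

Let l_cont : pos_cont l.
Proof.
apply: pos_contD; first exact: (rsg_cont hS).
move=> t t0; apply: continuousN; apply: (@rsg_cont_comp _ _ _ _ _ (fun t => Num.max (t - h) 0) _ _ hS); last exact: max_cont.
by move=> s; rewrite le_max lexx orbT.
Qed.

Let l_le t : 0 < t -> nrm (l t) <= (M * nrm z * (1 + expR (w * h))) * expR (- w * t).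
Proof.
move=> t0; have a0 : 0 <= Num.max (t - h) 0 by rewrite le_max lexx orbT.
have [_ h1] := rsg_bnd z hS (ltW t0); have [_ h2] := rsg_bnd z hS a0.
apply: le_trans (nrmB _ _) _; rewrite mulrDr mulr1 mulrDl; apply: lerD => //.
apply: le_trans h2 _; rewrite -[leRHS]mulrA ler_wpM2l ?mulr_ge0 ?nrm_ge0// -expRD ler_expR.
have : t - h <= Num.max (t - h) 0 by rewrite le_max lexx.
by rewrite -(ler_pM2l w0) !mulNr; lra.
Qed.

Let Rl_intg : intg `]0, +oo[ (fun t => nrm (Rb (l t)) ^+ 2).
Proof.
case: bR => _ [c c0 hc]; set K := M * nrm z * (1 + expR (w * h)).
have K0 : 0 <= K by rewrite !mulr_ge0 ?nrm_ge0// addr_ge0// expR_ge0.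
apply: (@sq_intg _ ((c * K) ^+ 2) w) => //.
  by apply: pos_contM; apply: pos_cont_nrm; apply: pos_cont_blin.
move=> t t0; rewrite ger0_norm ?sqr_ge0//.
have e0 := expR_ge0 (- w * t); have e1 : expR (- w * t) <= 1.
  by rewrite -expR0 ler_expR mulNr oppr_le0 mulr_ge0// ltW.
have cK0 : 0 <= c * K * expR (- w * t) by apply: mulr_ge0 => //; exact: mulr_ge0.
apply: (@le_trans _ _ ((c * K * expR (- w * t)) ^+ 2)).
  rewrite ler_sqr ?nnegrE ?nrm_ge0//; apply: le_trans (hc _) _.
  by rewrite -mulrA ler_wpM2l//; exact: l_le.
rewrite exprMn ler_wpM2l ?sqr_ge0// expr2 ler_piMl//.
Qed.

Let obsx_intg := (obs_sq x hP).1.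

Let step_ip (f : R -> U) : (fun t => ip (f t) (step t)) = (fun t => ip (f t) u * \1_(`]-oo, h[) t).
Proof.
apply/funext => t; rewrite /step indicE /=; case: ifPn => th.
  by rewrite mem_set ?mulr1//= in_itv.
by rewrite memNset ?mulr0 ?ip0r//= in_itv/=; exact/negP.
Qed.

Let step_meas (f : R -> U) : vmeasurable `]0, +oo[ f ->
  measurable_fun (`]0, +oo[ : set (measurableTypeR R)) (fun t => ip (f t) (step t)).
Proof.
move=> vf; rewrite step_ip; apply: measurable_funM; last exact: measurable_indic.
by apply: (@vmeas_meas _ _ _ f (fun x => ip x _)) => //; exact: ip_continuous.
Qed.

Let step_sq : (fun t => nrm (step t) ^+ 2) = (fun t => nrm u ^+ 2 * \1_(`]-oo, h[) t).
Proof.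
apply/funext => t; rewrite /step indicE /=; case: ifPn => th.
  by rewrite mem_set ?mulr1//= in_itv.
by rewrite memNset ?mulr0 ?nrm0 ?expr0n//= in_itv/=; exact/negP.
Qed.

Let int_cut (g : R -> R) : intg `]0, +oo[ g -> (forall t, h <= t -> g t = 0) ->
  \int[mu]_(t in `]0, +oo[) g t = \int[mu]_(t in `]0, h[) g t.
Proof.
move=> ig gz; rewrite (@Rint_cut _ _ 0 h) ?bnd_simp ?(ltW h0)//.
rewrite [X in _ + X](_ : _ = 0) ?addr0//; apply: Rint_0eq => t.
by rewrite /= in_itv/= andbT => /ltW; exact: gz.
Qed.

Let vuh : vmeasurable `]0, +oo[ uh.
Proof.
case: opt => vu _ _ _; apply: vmeasS vu => // t /=; rewrite !in_itv/= !andbT; exact: ltW.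
Qed.

Let uh_sq : intg `]0, +oo[ (fun t => nrm (uh t) ^+ 2).
Proof. by case: opt. Qed.

Let step_sq_intg : intg `]0, +oo[ (fun t => nrm (step t) ^+ 2).
Proof.
apply: (@intg_le _ _ _ (fun t => nrm u ^+ 2 * expR (w * h) * expR (- w * t))) => //.
- by rewrite step_sq; apply: measurable_funM; [exact: measurable_cst|exact: measurable_indic].
- move=> t _; rewrite ger0_norm ?sqr_ge0// /step -mulrA -expRD; case: ifPn => th.
    rewrite ler_peMr ?sqr_ge0// -expR0 ler_expR mulNr -mulrBr mulr_ge0 ?(ltW w0)//.
    by rewrite subr_ge0 ltW.
  by rewrite nrm0 expr0n mulr_ge0 ?sqr_ge0 ?expR_ge0.
- by apply: intgZ => //; exact: (intg_expR w0).1.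
Qed.

Let uh_step_intg : intg `]0, +oo[ (fun t => ip (uh t) (step t)).
Proof.
apply: (@intg_le _ _ _ (fun t => nrm (uh t) ^+ 2 + nrm (step t) ^+ 2)) => //.
- exact: step_meas.
- move=> t _; apply: le_trans (ip_le _ _) _.
  have := sqr_ge0 (nrm (uh t) - nrm (step t)); have := sqr_ge0 (nrm (uh t)); have := sqr_ge0 (nrm (step t)).
  by move: (nrm (uh t)) (nrm (step t)) => a b; nra.
- exact: intgD.
Qed.

Let nrm_addZ (V : hilbertType R) (a b : V) s :
  nrm (a + s%:C *: b) ^+ 2 = nrm a ^+ 2 + 2 * s * ip a b + s ^+ 2 * nrm b ^+ 2.
Proof. by rewrite -!ip_nrm ipDl !ipDr !ipZl !ipZr [ip b a]ipC; ring. Qed.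

Let f s t := uh t + s%:C *: step t.
Let y s t := Phi t x + s%:C *: l t.

Let vmeas_step (g : R -> U) s : vmeasurable `[0, +oo[ g ->
  vmeasurable `[0, +oo[ (fun t => g t + s%:C *: step t).
Proof.
move=> vu O oO.
have -> : `[0, +oo[%classic `&` (fun t => g t + s%:C *: step t) @^-1` O =
    (`[0, h[%classic `&` g @^-1` ((fun v => v + s%:C *: u) @^-1` O)) `|`
    (`[h, +oo[%classic `&` g @^-1` O).
  apply/seteqP; split=> t /=; rewrite !in_itv/= ?andbT /step.
    move=> [t0]; case: ifPn => [th hO|]; first by left; rewrite t0.
    by rewrite -leNgt scaler0 addr0 => ht hO; right.
  move=> [[/andP[t0 th] hO]|[th hO]]; first by rewrite th.
  by rewrite (le_trans (ltW h0) th) ltNge th/= scaler0 addr0.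
apply: measurableU.
  have v1 : vmeasurable `[0, h[ g.
    by apply: vmeasS vu => // t /=; rewrite !in_itv/= => /andP[->].
  apply: v1; apply: open_comp => // v _.
  by apply: cvgD; [exact: cvg_id|exact: cvg_cst].
have v2 : vmeasurable `[h, +oo[ g; last exact: v2.
apply: vmeasS vu => // t /=; rewrite !in_itv/= !andbT; exact: le_trans (ltW h0).
Qed.

Let vf s : vmeasurable `[0, +oo[ (f s).
Proof. by apply: vmeas_step; case: opt. Qed.

Let vstep : vmeasurable `]0, +oo[ step.
Proof.
have v0 : vmeasurable `[0, +oo[ (fun _ : R => 0 : U) by apply: vmeas_pos0; exact: pos_cont_cst.
have := vmeas_step 1 v0; rewrite (_ : (fun t => _) = step); last first.
  by apply/funext => t; rewrite add0r scale1r.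
by apply: vmeasS => // t /=; rewrite !in_itv/= !andbT; exact: ltW.
Qed.

Let intg_quad (q0 qb qa : R -> R) s : intg `]0, +oo[ q0 -> intg `]0, +oo[ qb -> intg `]0, +oo[ qa ->
  intg `]0, +oo[ (fun t => q0 t + 2 * s * qb t + s ^+ 2 * qa t) /\
  \int[mu]_(t in `]0, +oo[) (q0 t + 2 * s * qb t + s ^+ 2 * qa t) =
  \int[mu]_(t in `]0, +oo[) q0 t + 2 * s * \int[mu]_(t in `]0, +oo[) qb t
   + s ^+ 2 * \int[mu]_(t in `]0, +oo[) qa t.
Proof.
move=> i0 ib ia; have ib' := intgZ (2 * s) (mble_itv _) ib; have ia' := intgZ (s ^+ 2) (mble_itv _) ia.
have i1 := intgD (mble_itv _) i0 ib'; split; first exact: intgD.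
by rewrite RintegralD// RintegralD// !RintegralZl.
Qed.

Let kern_intg (g : R -> U) v t : vmeasurable `]0, +oo[ g ->
  intg `]0, +oo[ (fun t => nrm (g t) ^+ 2) -> 0 < t ->
  intg `]0, t[ (fun r => ip (g r) (radj D (S' (t - r) v))).
Proof.
move=> vg ig t0; have [_ [c c0 hc]] := blin_radj bD.
have sub : `]0, t[ `<=` (`]0, +oo[%classic : set R).
  by move=> r /=; rewrite !in_itv/= andbT => /andP[].
have m1 : measurable_fun (`]0, t[ : set (measurableTypeR R)) (fun r => ip (g r) (radj D (S' (t - r) v))).
  apply: meas_ip => //; first exact: vmeasS vg.
  move=> r; rewrite /= in_itv/= => /andP[r0 rt].
  apply: (blin_cvg (blin_radj bD)).
  have : {for r, continuous (fun r : R => t - r)} by apply: cvgB; [exact: cvg_cst|exact: cvg_id].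
  move=> c1; have c2 : {for t - r, continuous (fun r => S' r v)}.
    by apply: (rsg_cont hSd); rewrite subr_gt0.
  exact: (continuous_comp c1 c2).
apply: (@intg_le _ _ _ (fun r => c * (M * nrm v) * (nrm (g r) ^+ 2 + 1))) => //.
- move=> r; rewrite /= in_itv/= => /andP[r0 rt]; apply: le_trans (ip_le _ _) _.
  rewrite mulrC; apply: ler_pM; rewrite ?nrm_ge0//.
    apply: le_trans (hc _) _; rewrite ler_wpM2l//; apply: (rsg_le hSd).
    by rewrite subr_ge0 ltW.
  by move: (nrm (g r)) => a; nra.
- apply: intgZ => //; apply: intgD => //; last exact: intg_cst.
  exact: intgS ig.
Qed.

Let l_mild t v : 0 < t -> ip (l t) (radj Ai v) =
  \int[mu]_(r in `]0, t[) ip (step r) (radj D (S' (t - r) v)).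
Proof.
move=> t0; have eD r : r < t -> ip u (radj D (S' (t - r) v)) = ip (S (t - r) z) v.
  move=> rt; have tr : 0 <= t - r by rewrite subr_ge0 ltW.
  by rewrite -(radjP bD) hS'// -(radjP (rsg_blin hS tr)).
have oi := orbit_intg hS z v.
rewrite -(radjP bAi) (blinB _ _ bAi) -!(SAinvs hS) ?(ltW t0) ?le_max ?lexx ?orbT//.
have [th|ht] := leP t h.
  have -> : Num.max (t - h) 0 = 0 by apply/max_idPr; rewrite subr_le0.
  rewrite (SAinvsB hS)// ?(ltW t0)//.
  have i1 : intg `]0, t[ (fun r => ip (S r z) v) by apply: (@intg_itv _ _ 0).
  have := Rint_refl t i1; rewrite subrr subr0 => <-.
  apply: eq_Rintegral => r; rewrite inE/= in_itv/= => /andP[r0 rt].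
  by rewrite /step (lt_le_trans rt th) eD.
have -> : Num.max (t - h) 0 = t - h by apply/max_idPl; rewrite subr_ge0 ltW.
have th0 : 0 <= t - h by rewrite subr_ge0 ltW.
rewrite (SAinvsB hS)//; last by rewrite gerBl ltW.
have i1 : intg `](t - h), t[ (fun r => ip (S r z) v) by apply: (@intg_itv _ _ (t - h)).
have := Rint_refl t i1; rewrite subrr subKr => <-.
have i2 : intg `]0, t[ (fun r => ip (step r) (radj D (S' (t - r) v))).
  exact: kern_intg.
rewrite [RHS](@Rint_cut _ _ 0 h) ?bnd_simp ?(ltW h0)//.
rewrite [X in _ = _ + X](_ : _ = 0) ?addr0//.
  apply: eq_Rintegral => r; rewrite inE/= in_itv/= => /andP[r0 rh].
  by rewrite /step rh eD// (lt_trans rh).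
apply: Rint_0eq => r; rewrite /= in_itv/= => /andP[/ltW hr rt].
by rewrite /step ltNge hr/= ip0l.
Qed.

Let y_mild s t : 0 < t -> mild x (f s) t (y s t).
Proof.
move=> t0 v; case: opt => _ _ /(_ t t0 v) e _.
rewrite /y ipDl ipZl e l_mild// -addrA; congr (_ + _).
have i2 : intg `]0, t[ (fun r => ip (step r) (radj D (S' (t - r) v))).
  exact: kern_intg.
rewrite -RintegralZl// -RintegralD//; [|exact: (kern_intg _ vuh)|exact: intgZ].
by apply: eq_Rintegral => r _; rewrite /f ipDl ipZl.
Qed.

Let Rx t := ip (Rb (Phi t x)) (Rb (l t)).

Let Rx_intg : intg `]0, +oo[ Rx.
Proof.
apply: (@intg_le _ _ _ (fun t => nrm (Rb (Phi t x)) ^+ 2 + nrm (Rb (l t)) ^+ 2)) => //.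
- apply: msub_pos => //; apply: pos_cont_ip; apply: pos_cont_blin => //; exact: (rsg_cont hP).
- move=> t _; apply: le_trans (ip_le _ _) _.
  by move: (nrm _) (nrm _) => a b; nra.
- exact: intgD.
Qed.

Let variation : \int[mu]_(t in `]0, +oo[) (Rx t + ip (uh t) (step t)) = 0.
Proof.
pose q0 t := nrm (Rb (Phi t x)) ^+ 2 + nrm (uh t) ^+ 2.
pose qa t := nrm (Rb (l t)) ^+ 2 + nrm (step t) ^+ 2.
(* Along [f s] the cost is a quadratic polynomial in [s], minimal at [s = 0], so its linear
   coefficient vanishes. *)
apply: (@quad0 _ (\int[mu]_(t in `]0, +oo[) qa t)) => s.
have i0 : intg `]0, +oo[ q0 by exact: intgD.
have ia : intg `]0, +oo[ qa by exact: intgD.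
have ib : intg `]0, +oo[ (fun t => Rx t + ip (uh t) (step t)) by exact: intgD.
have [iq eq] := intg_quad s i0 ib ia.
have yE t : nrm (Rb (y s t)) ^+ 2 = nrm (Rb (Phi t x)) ^+ 2 + 2 * s * Rx t + s ^+ 2 * nrm (Rb (l t)) ^+ 2.
  by rewrite /y (blinD _ _ bR) (blinZ _ _ bR) nrm_addZ.
have iy : intg `]0, +oo[ (fun t => nrm (Rb (y s t)) ^+ 2).
  have := (intg_quad s obsx_intg Rx_intg Rl_intg).1.
  by apply: eq_integrable => // t _ /=; rewrite yE.
have i_f : intg `]0, +oo[ (fun t => nrm (f s t) ^+ 2).
  have := (intg_quad s uh_sq uh_step_intg step_sq_intg).1.
  by apply: eq_integrable => // t _ /=; rewrite /f nrm_addZ.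
have cy : pos_cont (y s).
  apply: pos_contD; first exact: (rsg_cont hP).
  apply: pos_contZ => //; exact: (fun t _ => @cst_continuous _ _ _ t).
case: opt => _ _ _ /(_ (f s) (y s) (vf s) i_f cy iy (y_mild s)).
rewrite [leRHS](_ : _ = \int[mu]_(t in `]0, +oo[) (q0 t + 2 * s * (Rx t + ip (uh t) (step t)) + s ^+ 2 * qa t)).
  by rewrite eq -addrA lerDl.
by apply: eq_Rintegral => t _; rewrite yE /f nrm_addZ /q0 /qa; ring.
Qed.

(** In the vanishing first variation, the delayed part of [l] is cut at [h]: before, it is the
    constant [D u]; after, a shift of time makes [P] at [Phi h x] appear. *)
Lemma variational : \int[mu]_(t in `]0, h[) ip (uh t) u = - ip (P x) (D u) +
  \int[mu]_(t in `]0, h[) ip (Rb (Phi t x)) (Rb (D u)) + ip (P (Phi h x)) (D u).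
Proof.
rewrite -/z; have := variation; rewrite RintegralD//.
rewrite (int_cut uh_step_intg); last by move=> t ht; rewrite /step ltNge ht/= ip0r.
have -> : \int[mu]_(t in `]0, h[) ip (uh t) (step t) = \int[mu]_(t in `]0, h[) ip (uh t) u.
  by apply: eq_Rintegral => t; rewrite inE/= in_itv/= /step => /andP[_ ->].
pose F t := ip (Rb (Phi t x)) (Rb (S (Num.max (t - h) 0) z)).
have RxE t : Rx t = ip (Rb (Phi t x)) (Rb (S t z)) - F t.
  by rewrite /Rx /l /F (blinB _ _ bR) ipBr.
have oi := obs_intg x z.
have iF : intg `]0, +oo[ F.
  have := intgB (mble_itv _) oi Rx_intg.
  by apply: eq_integrable => // t _ /=; congr EFin; rewrite RxE; ring.
have -> : \int[mu]_(t in `]0, +oo[) Rx t = ip (P x) z - \int[mu]_(t in `]0, +oo[) F t.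
  by rewrite PE -RintegralB//; apply: eq_Rintegral => t _; rewrite RxE.
rewrite (@Rint_cut _ F 0 h) ?bnd_simp ?(ltW h0)//.
have -> : \int[mu]_(t in `]0, h[) F t = \int[mu]_(t in `]0, h[) ip (Rb (Phi t x)) (Rb z).
  apply: eq_Rintegral => t; rewrite inE/= in_itv/= => /andP[_ th].
  by rewrite /F (_ : Num.max _ _ = 0) ?(rsg0 hS)//; apply/max_idPr; rewrite subr_le0 ltW.
have -> : \int[mu]_(t in `]h, +oo[) F t = ip (P (Phi h x)) z.
  rewrite -(Rint_shift (ltW h0) iF) PE; apply: eq_Rintegral => t; rewrite inE => /cobs t0.
  rewrite /F (rsgD hP) ?(ltW h0) ?(ltW t0)// addrK.
  by rewrite (_ : Num.max _ _ = t)//; apply/max_idPl; exact: ltW.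
move: (ip _ _) (ip _ _) (\int[mu]_(t in _) _) (\int[mu]_(t in _) _) => a b c d; lra.
Qed.

End variation.

Hypothesis opt_ex : forall x, exists uh, optimal x uh (Phi ^~ x).
Let bApi := Ainvs_blin hP.

(* The feedback in terms of [v = A_P x]: the optimal control of [x] is
   [t |-> fb (Phi t v)]. *)
Definition fb (v : Y) : U := radj D (P v + radj Rb (Rb (Api v))).

Lemma fb_blin : blin fb.
Proof.
apply: (blin_comp (blin_radj bD)); apply: blin_add => //.
by apply: (blin_comp (blin_radj bR)); exact: blin_comp.
Qed.

Let fb_cont v : pos_cont (fun t => fb (Phi t v)).
Proof. by apply: pos_cont_blin; [exact: fb_blin|exact: (rsg_cont hP)]. Qed.

(** The increment of the orbit of [Api v] over []0, h[] is the integral of [Phi t v], so every term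
    of [variational] becomes an integral of the feedback. *)
Lemma fb_ident v uh h u : optimal (Api v) uh (Phi ^~ (Api v)) -> 0 < h ->
  \int[mu]_(t in `]0, h[) ip (uh t) u = \int[mu]_(t in `]0, h[) ip (fb (Phi t v)) u.
Proof.
move=> opt h0; rewrite (variational u opt h0).
have -> : - ip (P (Api v)) (D u) + \int[mu]_(t in `]0, h[) ip (Rb (Phi t (Api v))) (Rb (D u))
   + ip (P (Phi h (Api v))) (D u) = ip (Phi h (Api v) - Phi 0 (Api v)) (radj P (D u))
   + \int[mu]_(t in `]0, h[) ip (Phi t v) (radj Api (radj Rb (Rb (D u)))).
  rewrite (rsg0 hP) -(radjP bP) (blinB _ _ bP) ipBl.
  have -> : \int[mu]_(t in `]0, h[) ip (Rb (Phi t (Api v))) (Rb (D u)) =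
      \int[mu]_(t in `]0, h[) ip (Phi t v) (radj Api (radj Rb (Rb (D u)))).
    apply: eq_Rintegral => t; rewrite inE/= in_itv/= => /andP[/ltW t0 _].
    by rewrite (SAinvs hP)// -(radjP bApi) -(radjP bR).
  by ring.
rewrite (SAinvsB hP)// ?(ltW h0)//.
have ii z : intg `]0, h[ (fun t => ip (Phi t v) z).
  by apply: (@intg_itv _ _ 0) => //; exact: (orbit_intg hP).
rewrite -RintegralD//; [|exact: ii|exact: ii].
apply: eq_Rintegral => t _.
rewrite /fb [RHS]ipC -(radjP bD) [RHS]ipC ipDl -(radjP bP) -(radjP bApi) -(radjP bR).
by rewrite [ip (radj Rb _) _]ipC -(radjP bR) [ip (Rb (D u)) _]ipC.
Qed.

Section optimal_orbit.
Context (v : Y) (uh : R -> U).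
Hypothesis opt : optimal (Api v) uh (Phi ^~ (Api v)).

Let vuh : vmeasurable `]0, +oo[ uh.
Proof.
case: opt => vu _ _ _; apply: vmeasS vu => // t /=; rewrite !in_itv/= !andbT; exact: ltW.
Qed.

Let bnd : exists2 K, 0 <= K & forall t, 0 < t -> nrm (fb (Phi t v)) <= K.
Proof.
have [_ [c c0 hc]] := fb_blin; exists (c * (Mp * nrm v)); first by rewrite !mulr_ge0// nrm_ge0.
move=> t t0; apply: le_trans (hc _) _; rewrite ler_wpM2l//.
by apply: (rsg_le hP); exact: ltW.
Qed.

Let sub (T : R) : `]0, T[ `<=` (`]0, +oo[%classic : set R).
Proof. by move=> r /=; rewrite !in_itv/= andbT => /andP[]. Qed.

Let vuT T : vmeasurable `]0, T[ uh.
Proof. exact: (vmeasS (mble_itv _) (@sub T) vuh). Qed.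

Let vfb : vmeasurable `]0, +oo[ (fun t => fb (Phi t v)).
Proof. exact: vmeas_pos. Qed.

Let iuh T : intg `]0, T[ (fun t => nrm (uh t)).
Proof.
apply: (@intg_le _ _ _ (fun t => nrm (uh t) ^+ 2 + 1)) => //.
- apply: (@vmeas_meas _ _ _ uh (@nrm R U)) => //; last exact: nrm_continuous.
- move=> t _; rewrite ger0_norm ?nrm_ge0//; move: (nrm _) => a; nra.
- apply: intgD => //; last exact: intg_cst.
  by case: opt => _ i _ _; exact: intgS i.
Qed.

Let ifb T : intg `]0, T[ (fun t => nrm (fb (Phi t v))).
Proof.
have [K K0 hK] := bnd; apply: (@intg_le _ _ _ (cst K)) => //; last exact: intg_cst.
  by apply: msub_pos => //; exact: pos_cont_nrm.
by move=> t /sub/cobs t0; rewrite ger0_norm ?nrm_ge0// hK.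
Qed.

Let weak T (g : R -> U) C : 0 < T -> pos_cont g -> (forall s, 0 < s -> s <= T -> nrm (g s) <= C) ->
  \int[mu]_(t in `]0, T[) ip (uh t) (g t) = \int[mu]_(t in `]0, T[) ip (fb (Phi t v)) (g t).
Proof.
move=> T0 cg gC; apply: (weak_eq T0 cg gC) => //.
  exact: (vmeasS (mble_itv _) (@sub T) vfb).
by move=> h u h0 _; exact: fb_ident.
Qed.

(** [uh] is known only through its primitives. The kernel of the mild formula is continuous in [s],
    so [weak_eq] replaces [uh] by the feedback. *)
Lemma fb_mild t : 0 < t -> mild (Api v) (fun s => fb (Phi s v)) t (Phi t (Api v)).
Proof.
move=> t0 z; case: opt => _ _ /(_ t t0 z) -> _; congr (_ + _).
have [_ [c c0 hc]] := blin_radj bD.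
(* Truncation at 0 extends the kernel continuously to all positive times and changes nothing on []0,
   t[]. *)
pose g s := radj D (S' (Num.max (t - s) 0) z).
have m0 s : 0 <= Num.max (t - s) 0 by rewrite le_max lexx orbT.
have cg : pos_cont g.
  move=> s _; apply: (blin_cvg (blin_radj bD)).
  apply: (@rsg_cont_comp _ _ _ _ _ (fun s => Num.max (t - s) 0) _ _ hSd) => //.
  apply: (@continuous_max _ _ (fun s : R => t - s) (cst 0)); last exact: cst_continuous.
  by apply: cvgB; [exact: cvg_cst|exact: cvg_id].
have gC s : 0 < s -> s <= t -> nrm (g s) <= c * (M * nrm z).
  move=> _ _; apply: le_trans (hc _) _; rewrite ler_wpM2l//; exact: (rsg_le hSd).
have E (f : R -> U) : \int[mu]_(s in `]0, t[) ip (f s) (radj D (S' (t - s) z)) =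
    \int[mu]_(s in `]0, t[) ip (f s) (g s).
  apply: eq_Rintegral => s; rewrite inE/= in_itv/= => /andP[_ st].
  by rewrite /g (_ : Num.max _ _ = t - s)//; apply/max_idPl; rewrite subr_ge0 ltW.
by rewrite !E; exact: weak t0 cg gC.
Qed.

(** Testing [uh] against the continuous feedback shows that their pairing is the energy of the
    feedback. Expanding the nonnegative energy of the difference then bounds it by the energy of
    [uh], itself at most the optimal cost. *)
Lemma fb_sq_le T : 0 < T -> \int[mu]_(t in `]0, T[) nrm (fb (Phi t v)) ^+ 2 <=
  \int[mu]_(t in `]0, +oo[) (nrm (Rb (Phi t (Api v))) ^+ 2 + nrm (uh t) ^+ 2).
Proof.
move=> T0; have [K K0 hK] := bnd; case: (opt) => _ iu _ _.
have iw : intg `]0, T[ (fun t => ip (uh t) (fb (Phi t v))).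
  by have [] := gstep_lim T0 (@fb_cont v) (fun s s0 _ => hK s s0) (vuT T) (iuh T).
have ic : intg `]0, T[ (fun t => nrm (fb (Phi t v)) ^+ 2).
  apply: (@intg_le _ _ _ (cst (K ^+ 2))) => //; last exact: intg_cst.
    by apply: msub_pos => //; apply: pos_contM; exact: pos_cont_nrm.
  by move=> t /sub/cobs t0; rewrite ger0_norm ?sqr_ge0// ler_sqr ?nnegrE ?nrm_ge0// hK.
have iu' : intg `]0, T[ (fun t => nrm (uh t) ^+ 2) by exact: intgS iu.
have i0 := (obs_sq (Api v) hP).1.
have e1 : \int[mu]_(t in `]0, T[) ip (uh t) (fb (Phi t v)) = \int[mu]_(t in `]0, T[) (nrm (fb (Phi t v)) ^+ 2).
  rewrite (weak T0 (@fb_cont v) (fun s s0 _ => hK s s0)).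
  by apply: eq_Rintegral => t _; rewrite ip_nrm.
have e2 : 0 <= \int[mu]_(t in `]0, T[) (nrm (uh t) ^+ 2 + ((- 2) * ip (uh t) (fb (Phi t v)) + nrm (fb (Phi t v)) ^+ 2)).
  apply: Rintegral_ge0 => t _.
  have -> : nrm (uh t) ^+ 2 + ((- 2) * ip (uh t) (fb (Phi t v)) + nrm (fb (Phi t v)) ^+ 2)
     = nrm (uh t - fb (Phi t v)) ^+ 2.
    by rewrite -!ip_nrm !ipBl !ipBr [ip (fb _) (uh t)]ipC; ring.
  exact: sqr_ge0.
rewrite RintegralD// in e2; last by apply: intgD => //; exact: intgZ.
rewrite RintegralD// in e2; last exact: intgZ.
rewrite RintegralZl// e1 in e2.
have e3 : \int[mu]_(t in `]0, T[) (nrm (uh t) ^+ 2) <= \int[mu]_(t in `]0, +oo[) (nrm (uh t) ^+ 2).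
  by apply: Rint_subset => // t _; exact: sqr_ge0.
have e4 : 0 <= \int[mu]_(t in `]0, +oo[) (nrm (Rb (Phi t (Api v))) ^+ 2).
  by apply: Rintegral_ge0 => t _; exact: sqr_ge0.
rewrite RintegralD//; move: e2 e3 e4.
move: (\int[mu]_(t in _) _) (\int[mu]_(t in _) _) (\int[mu]_(t in _) _) (\int[mu]_(t in _) _) => a b c d; lra.
Qed.

End optimal_orbit.

Lemma fb_mildP v t : 0 < t -> mild (Api v) (fun s => fb (Phi s v)) t (Phi t (Api v)).
Proof. by move=> t0; have [uh opt] := opt_ex (Api v); exact: fb_mild opt t t0. Qed.

(** Comparison with the zero control, whose trajectory is the free orbit and costs at most a
    multiple of the squared initial norm. *)
Lemma fb_energy : exists2 K, 0 <= K & forall v T, 0 < T ->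
  \int[mu]_(t in `]0, T[) (nrm (fb (Phi t v)) ^+ 2) <= K * nrm (Api v) ^+ 2.
Proof.
case: (bR) => _ [c c0 hc]; exists ((c * M) ^+ 2 / w).
  by rewrite mulr_ge0 ?sqr_ge0// invr_ge0 ltW.
move=> v T T0; have [uh opt] := opt_ex (Api v); apply: le_trans (fb_sq_le opt T0) _.
have [i1 i2] := obs_sq (Api v) hS; apply: le_trans (i2 c c0 hc).
have v0 : vmeasurable `[0, +oo[ (fun _ : R => 0 : U) by apply: vmeas_pos0; exact: pos_cont_cst.
have s0 : intg `]0, +oo[ (fun _ : R => nrm (0 : U) ^+ 2).
  by apply: (@sq_intg _ 0 w) => // [t _|t _]; [exact: cst_continuous|rewrite nrm0 expr0n normr0 mul0r].
have m0 t : 0 < t -> mild (Api v) (fun _ => 0) t (S t (Api v)).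
  move=> t0 z; rewrite [X in _ = _ + X]Rint_0eq ?addr0// => s _; exact: ip0l.
have cS : pos_cont (fun t => S t (Api v)) by exact: (rsg_cont hS).
case: opt => _ _ _ /(_ (fun _ => 0) (fun t => S t (Api v)) v0 s0 cS i1 m0) h.
apply: (le_trans h); rewrite le_eqVlt; apply/orP; left; apply/eqP.
by apply: eq_Rintegral => t _; rewrite nrm0 expr0n addr0.
Qed.

(** The closed-loop equation written with inverses. The mild formula is divided by [t] and sent to
    0: difference quotients give the generators, and the mean of the feedback against the kernel
    tends to its value at 0. *)
Lemma Api_eq v : Api v = Ai v - D (fb v).
Proof.
pose x := Api v; have bd := blin_radj bD.
suff e z : ip v (radj Ai z) - ip x z = ip (fb v) (radj D z).
  have {}e z : ip (Ai v - D (fb v)) z = ip x z.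
    by rewrite ipBl (radjP bAi) (radjP bD) -e; ring.
  by apply: ip_eq => z; rewrite e.
have c1 : (fun t => t^-1 * \int[mu]_(s in `]0, t[) ip (fb (Phi s v)) (radj D (S' (t - s) z))) @ (0 : R)^'+
    --> ip (fb v) (radj D z).
  have r1 : (fun s => fb (Phi s v)) @ (0 : R)^'+ --> fb v.
    by apply: blin_cvg; [exact: fb_blin|case: hP].
  have r2 : (fun s => radj D (S' s z)) @ (0 : R)^'+ --> radj D z.
    by apply: blin_cvg => //; case: hSd.
  apply: (avg_lim (f := fun t s => ip (fb (Phi s v)) (radj D (S' (t - s) z)))).
    move=> t t0; have [_ [c c0 hc]] := bd; have [_ [k k0 hk]] := fb_blin.
    have cS : forall s, `]0, t[%classic s -> {for s, continuous (fun s => radj D (S' (t - s) z))}.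
      move=> s; rewrite /= in_itv/= => /andP[s0 st].
      apply: (blin_cvg bd).
      have c1 : {for s, continuous (fun r : R => t - r)} by apply: cvgB; [exact: cvg_cst|exact: cvg_id].
      have c2 : {for t - s, continuous (fun r => S' r z)}.
        by apply: (rsg_cont hSd); rewrite subr_gt0.
      exact: (continuous_comp c1 c2).
    apply: (@intg_le _ _ _ (cst (k * (Mp * nrm v) * (c * (M * nrm z))))) => //; last exact: intg_cst.
      apply: meas_ip => //; first by move=> r /=; rewrite !in_itv/= andbT => /andP[].
      apply: (vmeasS (mble_itv _) _ (vmeas_pos (@fb_cont v))).
      by move=> r /=; rewrite !in_itv/= andbT => /andP[].
    move=> s; rewrite /= in_itv/= => /andP[s0 st]; apply: le_trans (ip_le _ _) _.
    apply: ler_pM; rewrite ?nrm_ge0//.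
      by apply: le_trans (hk _) _; rewrite ler_wpM2l//; apply: (rsg_le hP); exact: ltW.
    apply: le_trans (hc _) _; rewrite ler_wpM2l//; apply: (rsg_le hSd).
    by rewrite subr_ge0 ltW.
  move=> e e0; have [r r0 hr] := near0_ip r1 r2 e0; exists r => // t s s0 st tr.
  by apply: hr => //; rewrite ?subr_gt0// ?(lt_trans st tr)// ltrBlDr (lt_trans tr)// ltrDl.
have c2 : (fun t : R => ip (t^-1%:C *: (Phi t x - x)) (radj Ai z)
    - ip (t^-1%:C *: (S t (Ai x) - Ai x)) z) @ (0 : R)^'+ --> ip v (radj Ai z) - ip x z.
  apply: cvgB; apply: cvg_ip; try exact: cvg_cst; [exact: (isgen_Ainvs hP)|exact: (isgen_Ainvs hS)].
suff h : (fun t : R => ip (t^-1%:C *: (Phi t x - x)) (radj Ai z)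
    - ip (t^-1%:C *: (S t (Ai x) - Ai x)) z) @ (0 : R)^'+ --> ip (fb v) (radj D z).
  by apply: (cvg_unique _ c2 h); exact: Rhausdorff.
apply: cvg_trans c1; apply: near_eq_cvg; near=> t.
have t0 : 0 < t by near: t; exact: nbhs_right_gt.
rewrite !ipZl -mulrBr; congr (_ * _).
rewrite !ipBl (SAinvs hS) ?(ltW t0)// (fb_mildP v t0 z) -(radjP bAi) -(radjP bAi).
by rewrite -/x; ring.
Unshelve. all: by end_near. Qed.

End Feedback.

(** * The gain operator on the domain of the fractional power *)

Lemma ip_le_dense (R : realType) (V W : hilbertType R) (K : set V) (T : V -> W) (d : V) (C : R) :
  (forall y (e : R), 0 < e -> exists2 x, K x & nrm (y - x) < e) -> blin T -> 0 <= C ->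
  (forall x, K x -> ip d x <= C * nrm (T x)) -> forall z, ip d z <= C * nrm (T z).
Proof.
move=> hK bT C0 h z; apply/ler_addgt0Pr => e e0; case: (bT) => _ [c c0 hc].
have X0 : 0 < C * c + nrm d + 1 by rewrite ltr_wpDl// addr_ge0 ?nrm_ge0// mulr_ge0.
have [x Kx xz] := hK z _ (divr_gt0 e0 X0).
have zE : z = x + (z - x) by rewrite addrC subrK.
have h1 : ip d z <= ip d x + nrm d * nrm (z - x) by rewrite {1}zE ipDr lerD2l ip_le_nrm.
have h2 : nrm (T x) <= nrm (T z) + c * nrm (z - x).
  have -> : T x = T z - T (z - x) by rewrite -(blinB _ _ bT) subKr.
  by apply: le_trans (nrmB _ _) _; rewrite lerD2l.
have {}xz : (C * c + nrm d) * nrm (z - x) <= e.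
  have : (C * c + nrm d + 1) * nrm (z - x) <= e by rewrite mulrC -ler_pdivlMr// ltW.
  by apply: le_trans; rewrite ler_wpM2r ?nrm_ge0// lerDl.
have h3 := h x Kx; have h4 := ler_wpM2l C0 h2.
by move: h1 h2 h3 h4 xz; rewrite mulrDl mulrDr mulrA; lra.
Qed.

Section Gain.
Context {R : realType} {Y U Z : hilbertType R}.
Notation mu := (@lebesgue_measure R).
Context (S S' : R -> Y -> Y) (M w : R).
Hypothesis hS : rsg S M w.
Hypothesis hS' : forall t, 0 <= t -> S' t = radj (S t).
Context (D : U -> Y) (Rb : Y -> Z).
Hypotheses (bD : blin D) (bR : blin Rb).
Context (Phi : R -> Y -> Y) (Mp wp : R).
Hypothesis hP : rsg Phi Mp wp.
Let M0 : 0 <= M. Proof. by case: hS => _ _ _ _ [h _ _]; apply: le_trans h. Qed.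
Let w0 : 0 < w. Proof. by case: hS => _ _ _ _ []. Qed.
Let Mp0 : 0 <= Mp. Proof. by case: hP => _ _ _ _ [h _ _]; apply: le_trans h. Qed.
Let bAi := Ainvs_blin hS.
Let bApi := Ainvs_blin hP.
Let hSd := rsg_adj hS hS'.
Notation Ai := (Ainvs S).
Notation Api := (Ainvs Phi).
Context (P : Y -> Y).
Hypotheses (bP : blin P)
  (PE : forall x z, ip (P x) z = \int[mu]_(t in `]0, +oo[) ip (Rb (Phi t x)) (Rb (S t z))).
Hypothesis opt_ex : forall x, exists uh, optimal S S' D Rb x uh (Phi ^~ x).
Notation fb := (fb D Rb Phi P).
Let bfb : blin fb. Proof. exact: (fb_blin bD bR hP bP). Qed.

(* [J], [Q] and [N1] stand for [A^-eps], [A'^eps R'R A^-eps] and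
   [A^eps A_P^-1], a prime denoting the adjoint. *)
Context (J : Y -> Y).
Hypotheses (bJ : blin J) (JAi : forall x, Ai (J x) = J (Ai x))
  (JS : forall t x, 0 <= t -> S t (J x) = J (S t x))
  (J_inj : forall y, J y = 0 -> y = 0) (radjJ_inj : forall z, radj J z = 0 -> z = 0).
Context (k : R -> R).
Hypotheses (k_cont : pos_cont k) (k_ge0 : forall t, 0 < t -> 0 <= k t)
  (k_intg : intg `]0, +oo[ k)
  (k_bound : forall t y v, 0 < t -> radj J y = radj Ai v ->
     nrm (radj D (S' t v)) <= k t * nrm y).
Context (Q N1 : Y -> Y).
Hypotheses (bQ : blin Q) (QE : forall y, radj Rb (Rb (J y)) = radj J (Q y))
  (bN : blin N1) (NE : forall v, Api v = J (N1 v)).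
Context (q Kq : R).
Hypotheses (q_gt1 : 1 < q) (q_lt2 : q < 2) (Kq_ge0 : 0 <= Kq)
  (Kq_bound : forall v, intg `]0, +oo[ (fun t => nrm (radj D (S' t v)) `^ q) /\
    \int[mu]_(t in `]0, +oo[) (nrm (radj D (S' t v)) `^ q) <= Kq * nrm (radj J (radj Ai v)) `^ q).

Notation Eop := (Eop S D J).
Let bE t : 0 < t -> blin (Eop t).
Proof. by move=> t0; exact: (Eop_blin hS hS' bD bJ JAi k_ge0 k_bound). Qed.
Let E_le t y : 0 < t -> nrm (Eop t y) <= k t * nrm y.
Proof. by move=> t0; exact: (Eop_le hS hS' bD bJ JAi k_ge0 k_bound). Qed.
Let E_cont (a : R -> Y) : pos_cont a -> pos_cont (fun t => Eop t (a t)).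
Proof. by move=> ca; exact: (Eop_cont hS hS' bD bJ JAi JS k_cont k_ge0 k_bound). Qed.

Let J_injE y y' : J y = J y' -> y = y'.
Proof.
by move=> e; apply/eqP; rewrite -subr_eq0; apply/eqP/J_inj; rewrite (blinB _ _ bJ) e subrr.
Qed.

Let kI := \int[mu]_(t in `]0, +oo[) k t.
Let kI0 : 0 <= kI.
Proof. by apply: Rintegral_ge0 => t; rewrite /= in_itv/= andbT; exact: k_ge0. Qed.

Let pos t : `]0, +oo[%classic t -> 0 < t :> R.
Proof. by rewrite /= in_itv/= andbT. Qed.

Lemma PhiJ t v : 0 <= t -> Phi t (J (N1 v)) = J (N1 (Phi t v)).
Proof. by move=> t0; rewrite -!NE (SAinvs hP). Qed.

Lemma E_in_Lp1 (a : R -> Y) C : pos_cont a -> (forall t, 0 < t -> nrm (a t) <= C) ->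
  in_Lp 1 `]0, +oo[ (fun t => Eop t (a t)).
Proof.
move=> ca aC; apply: (@in_Lp1_dom _ _ _ _ (fun t => C * k t)) => //.
- by apply: vmeas_pos; exact: E_cont.
- exact: intgZ.
move=> t /pos t0; apply: le_trans (E_le _ t0) _; rewrite mulrC ler_wpM2r ?k_ge0//.
exact: aC.
Qed.

(** Formally the feedback is [- B'P A_P^-1 v]. Replacing [B u], the generator at [z = D u], by the
    difference quotients [wh n] keeps [P] apart from [B']: the pairing of [P x] with [wh n] tends to
    the integral of [Eop] by domination, and to [- ip (fb v) u] by [P_shift]. *)
Lemma fb_gain v u : ip (fb v) u =
  - \int[mu]_(t in `]0, +oo[) ip (Eop t (Q (N1 (Phi t v)))) u.
Proof.
pose x := Api v; pose z := D u; pose yt t := Q (N1 (Phi t v)).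
have [_ [cn cn0 hcn]] := bN; have [_ [cq cq0 hcq]] := bQ.
pose C := cq * (cn * (Mp * nrm v)).
have C0 : 0 <= C by rewrite !mulr_ge0// nrm_ge0.
have yC t : 0 < t -> nrm (yt t) <= C.
  move=> t0; apply: le_trans (hcq _) _; rewrite ler_wpM2l//.
  apply: le_trans (hcn _) _; rewrite ler_wpM2l//.
  by apply: (rsg_le hP); exact: ltW.
have cy : pos_cont yt by do 2!(apply: pos_cont_blin => //); exact: (rsg_cont hP).
pose hn (n : nat) : R := n.+1%:R^-1.
have hn0 n : 0 < hn n by rewrite invr_gt0.
pose wh n := (hn n)^-1%:C *: (S (hn n) z - z).
have E0 t : 0 < t -> Ai (Eadj S D J t u) = J (S t z).
  by move=> t0; exact: (EadjP hS hS' bD bJ JAi k_ge0 k_bound).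
pose fn n t := ip (yt t) ((hn n)^-1%:C *: (S (hn n) (Ai (Eadj S D J t u)) - Ai (Eadj S D J t u))).
have fnE n t : 0 < t -> fn n t = ip (Rb (Phi t x)) (Rb (S t (wh n))).
  move=> t0; have b := rsg_blin hS (ltW t0).
  have JQ a p : ip (Rb (J p)) (Rb a) = ip (Q p) (J a).
    by rewrite ipC (radjP bR) QE -(radjP bJ) ipC.
  rewrite /x NE (PhiJ _ (ltW t0)) JQ; congr ip; rewrite E0//.
  rewrite /wh (blinZ _ _ b) (blinB _ _ b) (blinZ _ _ bJ) (blinB _ _ bJ) (JS _ (ltW (hn0 n))).
  by rewrite (rsgC hS _ (ltW t0) (ltW (hn0 n))).
(* Uniform in [n]: difference quotients on the range of [Ai] are bounded by [M] times the norm of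
   the preimage, here [Eadj], which [k] controls. *)
have fn_le n t : `]0, +oo[%classic t -> `|fn n t| <= C * (M * nrm u) * k t.
  move=> /pos t0; apply: le_trans (ip_le _ _) _.
  have e1 : nrm (Eadj S D J t u) <= k t * nrm u.
    exact: (Eadj_le hS hS' bD bJ JAi k_ge0 k_bound).
  rewrite -mulrA; apply: ler_pM; rewrite ?nrm_ge0 ?yC//.
  rewrite nrmZ gtr0_norm ?invr_gt0// ler_pdivrMl//.
  apply: le_trans (SAinvs_lip hS _ (ltW (hn0 n))) _.
  have -> : hn n * (M * nrm u * k t) = M * hn n * (k t * nrm u) by ring.
  by rewrite ler_wpM2l// mulr_ge0// ltW.
have fn_meas n : measurable_fun (`]0, +oo[ : set (measurableTypeR R)) (fn n).
  apply: (eq_measurable_fun (fun t => ip (Rb (Phi t x)) (Rb (S t (wh n))))).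
    by move=> t /set_mem/pos t0; rewrite fnE.
  exact: (intg_meas (obs_intg hS bR hP _ _)).
have f_meas : measurable_fun (`]0, +oo[ : set (measurableTypeR R)) (fun t => ip (Eop t (yt t)) u).
  by apply: msub_pos => //; apply: pos_cont_ip; [exact: E_cont|exact: pos_cont_cst].
have hnc : hn @ \oo --> (0 : R)^'+.
  move=> A [r /= r0 hr]; have /cvgrPdist_lt/(_ _ r0) := @cvg_harmonic R.
  by apply: filterS => n hn1; apply: hr => //=; exact: hn0.
have c1 : (fun n => \int[mu]_(t in `]0, +oo[) fn n t) @ \oo -->
    \int[mu]_(t in `]0, +oo[) ip (Eop t (yt t)) u.
  apply: (Rint_cvg (mble_itv _) fn_meas f_meas (intgZ _ (mble_itv _) k_intg) fn_le _).2.
  move=> t /pos t0.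
  have -> : ip (Eop t (yt t)) u = ip (yt t) (Eadj S D J t u).
    by rewrite ipC -(radjP (Eadj_blin hS hS' bD bJ JAi k_ge0 k_bound t0)) ipC.
  apply: cvg_ip; first exact: cvg_cst.
  apply: (@cvg_comp _ _ _ hn (fun h => h^-1%:C *: (S h (Ai (Eadj S D J t u)) - Ai (Eadj S D J t u))) _ _ _ hnc).
  exact: (isgen_Ainvs hS).
have e1 n : \int[mu]_(t in `]0, +oo[) fn n t =
    - ip (P ((hn n)^-1%:C *: (Phi (hn n) x - x))) (S (hn n) z) -
    (hn n)^-1 * \int[mu]_(t in `]0, hn n[) ip (Rb (Phi t x)) (Rb (S t z)).
  transitivity (ip (P x) (wh n)).
    by rewrite PE; apply: eq_Rintegral => t; rewrite inE => /pos; exact: fnE.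
  rewrite /wh ipZr (blinZ _ _ bP) (blinB _ _ bP) ipZl ipBl ipBr.
  rewrite (P_shift hS bR hP PE _ _ (ltW (hn0 n))); ring.
pose F2 (h : R) : R := - ip (P (h^-1%:C *: (Phi h x - x))) (S h z) -
    h^-1 * \int[mu]_(t in `]0, h[) ip (Rb (Phi t x)) (Rb (S t z)).
have c2 : F2 @ (0 : R)^'+ --> - ip (P v) z - ip (Rb x) (Rb z).
  apply: cvgB.
    apply: cvgN; apply: cvg_ip; last by case: hS.
    by apply: blin_cvg => //; exact: (isgen_Ainvs hP).
  apply: (avg_lim (f := fun _ t => ip (Rb (Phi t x)) (Rb (S t z)))).
    move=> t t0; apply: intgS (obs_intg hS bR hP x z) => //.
    by move=> r /=; rewrite !in_itv/= andbT => /andP[].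
  have r1 : (fun s => Rb (Phi s x)) @ (0 : R)^'+ --> Rb x by apply: blin_cvg => //; case: hP.
  have r2 : (fun s => Rb (S s z)) @ (0 : R)^'+ --> Rb z by apply: blin_cvg => //; case: hS.
  move=> e e0; have [r r0 hr] := near0_ip r1 r2 e0; exists r => // t s s0 st tr.
  by apply: hr => //; exact: lt_trans st tr.
have c3 := @cvg_comp _ _ _ hn F2 _ _ _ hnc c2.
have -> : \int[mu]_(t in `]0, +oo[) ip (Eop t (yt t)) u = - ip (P v) z - ip (Rb x) (Rb z).
  apply: (cvg_unique _ c1 _); first exact: Rhausdorff.
  by apply: cvg_trans c3; apply: near_eq_cvg; apply: nearW => n; rewrite e1.
rewrite /fb ipC -(radjP bD) ipC ipDl -/z -/x opprB opprK addrC; congr (_ + _).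
by rewrite [LHS]ipC -(radjP bR) ipC.
Qed.

(* The vectors [d] below are the differences between the resolvents of the
   optimal and of the free semigroup. *)
Lemma resolvent_gap (e : R) : 0 < e -> exists2 L, 0 <= L & forall l d u, L <= l ->
  d + D u = l%:C *: Ai d -> exists2 d', J d' = d & nrm d' <= e * nrm u.
Proof.
move=> e0; pose eta := e / (2 * (Kq + 1)).
have K1 : 0 < Kq + 1 by rewrite ltr_wpDl.
have eta0 : 0 < eta by rewrite divr_gt0// mulr_gt0.
have [C C0 hC] := young_small q_gt1 q_lt2 eta0.
(* [eta] leaves half of [e] to the integral of [q]-th powers; this threshold makes [C / (2 l)], the
   integral of [C exp(-2 l t)], at most the other half. *)
exists ((C + 1) / e); first by rewrite divr_ge0 ?addr_ge0 ?(ltW e0).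
move=> l d u Ll dE.
have l0 : 0 < l by apply: lt_le_trans Ll; rewrite divr_gt0// ltr_wpDl.
(* The equation for [d] says that [l - A] sends [Ai d] to [D u]. *)
have AdE : Ai d = @resol R Y S l (D u).
  rewrite -[LHS](resol_Ainvs hS _ (ltW l0)) -dE addrAC subrr add0r//.
(* Paired with [radj Ai v], the gap becomes a Laplace transform of the observation kernel.
   [young_small] with [a = exp(-l t)] and [b] the kernel divided by [nu] splits it into the two
   halves above. *)
have main v : ip d (radj Ai v) <= e * nrm u * nrm (radj J (radj Ai v)).
  set nu := nrm (radj J (radj Ai v)).
  rewrite -(radjP bAi) AdE /resol (wintP hS)//; last exact: (weight_expR hS (ltW l0)).
  have [ib lb] := Kq_bound v; rewrite -/nu in lb.
  have : 0 <= nu by exact: nrm_ge0.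
  rewrite le_eqVlt => /predU1P[nu0|nu0].
    have v0 : v = 0.
      apply: (radj_Ainvs_inj hS); rewrite (blin0 (blin_radj bAi)).
      by apply: radjJ_inj; apply: nrm0_eq0.
    by rewrite Rint_0eq -?nu0 ?mulr0// => t _; rewrite v0 ip0r mulr0.
  pose g t := nu * nrm u * (eta * nu `^ (- q) * nrm (radj D (S' t v)) `^ q + C * expR (- (2 * l) * t)).
  have [ie ee] := intg_expR (mulr_gt0 (ltr0Sn R 1) l0).
  have i1 : intg `]0, +oo[ (fun t => eta * nu `^ (- q) * nrm (radj D (S' t v)) `^ q) by exact: intgZ.
  have i2 : intg `]0, +oo[ (fun t => C * expR (- (2 * l) * t)) by exact: intgZ.
  have ig : intg `]0, +oo[ g by apply: intgZ => //; exact: intgD.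
  apply: (@le_trans _ _ (\int[mu]_(t in `]0, +oo[) g t)).
    apply: le_trans (ler_norm _) _; apply: Rint_abs_le => //.
      by apply: (wint_intg hS); exact: (weight_expR hS (ltW l0)).
    move=> t /pos t0; rewrite normrM gtr0_norm ?expR_gt0//.
    have -> : ip (S t (D u)) v = ip u (radj D (S' t v)).
      by rewrite (radjP (rsg_blin hS (ltW t0))) (radjP bD) hS' ?(ltW t0).
    have n0 := nrm_ge0 (radj D (S' t v)).
    have h1 := hC (expR (- l * t)) (nrm (radj D (S' t v)) / nu) (expR_ge0 _) _ (divr_ge0 n0 (ltW nu0)).
    have ex1 : expR (- l * t) <= 1 by rewrite -expR0 ler_expR mulNr oppr_le0 mulr_ge0// ltW.
    have {}h1 := h1 ex1.
    have e2 : expR (- l * t) ^+ 2 = expR (- (2 * l) * t) by rewrite expr2 -expRD; congr expR; ring.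
    rewrite e2 powRM ?invr_ge0 ?(ltW nu0)// -powR_inv1 ?(ltW nu0)// -powRrM mulN1r in h1.
    apply: le_trans (ler_wpM2l (expR_ge0 _) (ip_le _ _)) _.
    have -> : expR (- l * t) * (nrm u * nrm (radj D (S' t v))) =
        nu * nrm u * (expR (- l * t) * (nrm (radj D (S' t v)) * nu^-1)).
      by field; rewrite gt_eqF.
    rewrite powR_inv1 ?(ltW nu0)// in h1.
    rewrite /g ler_wpM2l ?mulr_ge0 ?nrm_ge0 ?(ltW nu0)//; apply: (le_trans h1).
    by rewrite -mulrA [nu `^ (- q) * _]mulrC.
  rewrite /g RintegralZl//; last exact: intgD.
  rewrite RintegralD// !RintegralZl// ee.
  have -> : e * nrm u * nu = nu * nrm u * e by ring.
  rewrite ler_wpM2l ?mulr_ge0 ?nrm_ge0 ?(ltW nu0)//.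
  have h2 : eta * nu `^ (- q) * \int[mu]_(t in `]0, +oo[) nrm (radj D (S' t v)) `^ q <= e / 2.
    have -> : e / 2 = eta * nu `^ (- q) * ((Kq + 1) * nu `^ q).
      have : nu `^ (- q) * nu `^ q = 1 by rewrite powRN mulVf// gt_eqF// powR_gt0.
      rewrite /eta; move: (nu `^ _) (nu `^ _) => a b ab.
      have -> : e / (2 * (Kq + 1)) * b * ((Kq + 1) * a) = e / 2 * (b * a) by field; rewrite gt_eqF.
      by rewrite ab mulr1.
    have en0 : 0 <= eta * nu `^ (- q) by apply: mulr_ge0; [exact: ltW|exact: powR_ge0].
    apply: (ler_wpM2l en0); apply: (le_trans lb).
    by rewrite ler_wpM2r ?powR_ge0// lerDl.
  have h3 : C / (2 * l) <= e / 2.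
    rewrite ler_pdivrMr ?mulr_gt0//; move: Ll; rewrite ler_pdivrMr// => Ll.
    have -> : e / 2 * (2 * l) = l * e by field.
    by apply: le_trans Ll; rewrite lerDl.
  by apply: le_trans (lerD h2 h3) _; rewrite -splitr.
apply: (douglas bJ); first by rewrite mulr_ge0 ?nrm_ge0// ltW.
apply: (ip_le_dense (K := range (radj Ai))); [|exact: blin_radj|by rewrite mulr_ge0 ?nrm_ge0// ltW|].
  by move=> y r r0; have [v hv] := dense_range_Ainvs_adj hS y r0; exists (radj Ai v).
by move=> _ [v _ <-].
Qed.

(** In [fb_gain] the operators [Eop t] are bounded by the integrable kernel [k]. The constant is
    taken strictly positive to be divided by in [N1_orbit]. *)
Let fb_le : exists2 c, 0 < c & forall v f, (forall t, 0 <= t -> nrm (N1 (Phi t v)) <= f) ->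
  nrm (fb v) <= c * f.
Proof.
have [_ [cq cq0 hcq]] := bQ; exists (kI * cq + 1); first by rewrite ltr_wpDl// mulr_ge0.
move=> v f hf; have f0 : 0 <= f by apply: le_trans (hf 0 _); rewrite ?nrm_ge0.
apply: (@le_trans _ _ (kI * cq * f)); last by rewrite ler_wpM2r// lerDl.
apply: nrm_le_ip; first by rewrite !mulr_ge0.
move=> u; rewrite fb_gain.
have ca : pos_cont (fun t => Q (N1 (Phi t v))).
  by do 2!(apply: pos_cont_blin => //); exact: (rsg_cont hP).
have aC t : 0 < t -> nrm (Q (N1 (Phi t v))) <= cq * f.
  by move=> t0; apply: le_trans (hcq _) _; rewrite ler_wpM2l// hf// ltW.
have iE := intg_ip u (mble_itv _) (E_in_Lp1 ca aC).
apply: le_trans (ler_norm _) _; rewrite normrN.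
have -> : kI * cq * f * nrm u = \int[mu]_(t in `]0, +oo[) (cq * f * nrm u * k t).
  by rewrite RintegralZl// -/kI; ring.
apply: Rint_abs_le => //; first exact: intgZ.
move=> t /pos t0; apply: le_trans (ip_le _ _) _.
have -> : cq * f * nrm u * k t = k t * (cq * f) * nrm u by ring.
rewrite ler_wpM2r ?nrm_ge0//; apply: le_trans (E_le _ t0) _.
by rewrite ler_wpM2l ?k_ge0 ?aC.
Qed.

Let dense_JAi y (e : R) : 0 < e -> exists2 x, range (radj J \o radj Ai) x & nrm (y - x) < e.
Proof.
move=> e0.
have b : blin (Ai \o J) by exact: blin_comp.
have inj z : (Ai \o J) z = 0 -> z = 0.
  by move=> /= h; apply: J_inj; apply: (Ainvs_inj hS); rewrite h (blin0 bAi).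
have [v hv] := dense_range_radj b inj y e0; rewrite (radj_comp bAi bJ) in hv.
by exists (radj J (radj Ai v)); first by exists v.
Qed.

Let ip_mild v t z : 0 < t -> ip (N1 (Phi t v)) (radj J (radj Ai z)) =
  ip (S t (N1 v)) (radj J (radj Ai z)) +
  \int[mu]_(s in `]0, t[) ip (fb (Phi s v)) (radj D (S' (t - s) z)).
Proof.
move=> t0; have := fb_mildP hS hS' bD bR hP bP PE opt_ex v t0 z.
by rewrite NE PhiJ ?(ltW t0)// JS ?(ltW t0)// !(radjP bJ).
Qed.

Let kern_sub t : `]0, t[ `<=` (`]0, +oo[%classic : set R).
Proof. by move=> r /=; rewrite !in_itv/= andbT => /andP[]. Qed.

(* The gain is absorbed by interpolating between its energy, controlled by the
   optimality of [Phi], and its supremum along the orbit. *)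
Let conv_bound (eta : R) : 0 < eta -> exists2 C, 0 <= C & forall v t z A, 0 < t -> 0 < A ->
  (forall s, 0 <= s -> nrm (fb (Phi s v)) <= A) ->
  \int[mu]_(s in `]0, t[) ip (fb (Phi s v)) (radj D (S' (t - s) z)) <=
  (eta * A + C * nrm (N1 v) ^+ 2 / A) * nrm (radj J (radj Ai z)).
Proof.
move=> eta0; have K1 : 0 < Kq + 1 by rewrite ltr_wpDl.
have [C C0 hC] := young_small q_gt1 q_lt2 (divr_gt0 eta0 K1).
have [K K0 hK] := fb_energy hS hS' bD bR hP bP PE opt_ex.
have [_ [cj cj0 hcj]] := bJ.
exists (C * (K * cj ^+ 2)); first by rewrite !mulr_ge0// sqr_ge0.
move=> v t z A t0 A0 fA; set nu := nrm (radj J (radj Ai z)).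
have cS s : `]0, t[%classic s -> {for s, continuous (fun s => radj D (S' (t - s) z))}.
  rewrite /= in_itv/= => /andP[s0 st]; apply: (blin_cvg (blin_radj bD)).
  have c1 : {for s, continuous (fun r : R => t - r)} by apply: cvgB; [exact: cvg_cst|exact: cvg_id].
  have c2 : {for t - s, continuous (fun r => S' r z)}.
    by apply: (rsg_cont hSd); rewrite subr_gt0.
  exact: (continuous_comp c1 c2).
have cf : pos_cont (fun s => fb (Phi s v)).
  by apply: pos_cont_blin => //; exact: (rsg_cont hP).
have m1 : measurable_fun (`]0, t[ : set (measurableTypeR R))
    (fun s => ip (fb (Phi s v)) (radj D (S' (t - s) z))).
  apply: meas_ip => //.
  exact: (vmeasS (mble_itv _) (@kern_sub t) (vmeas_pos cf)).
have [ib lb] := Kq_bound z; rewrite -/nu in lb.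
have : 0 <= nu by exact: nrm_ge0.
rewrite le_eqVlt => /predU1P[nu0|nu0].
  have z0 : z = 0.
    apply: (radj_Ainvs_inj hS); rewrite (blin0 (blin_radj bAi)).
    by apply: radjJ_inj; apply: nrm0_eq0.
  rewrite Rint_0eq -?nu0 ?mulr0// => s; rewrite /= in_itv/= => /andP[_ st].
  have st0 : 0 <= t - s by rewrite subr_ge0 ltW.
  by rewrite z0 (blin0 (rsg_blin hSd st0)) (blin0 (blin_radj bD)) ip0r.
pose e1 := eta / (Kq + 1).
have e10 : 0 < e1 by rewrite divr_gt0.
have i1 : intg `]0, t[ (fun s => nrm (radj D (S' (t - s) z)) `^ q).
  have i0 : intg `]0, t[ (fun s => nrm (radj D (S' s z)) `^ q) by exact: intgS ib.
  by have := intg_refl t i0; rewrite subrr subr0.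
have l1 : \int[mu]_(s in `]0, t[) (nrm (radj D (S' (t - s) z)) `^ q) <= Kq * nu `^ q.
  have i0 : intg `]0, t[ (fun s => nrm (radj D (S' s z)) `^ q) by exact: intgS ib.
  have := Rint_refl t i0; rewrite subrr subr0 => ->.
  by apply: le_trans lb; apply: Rint_subset => // s _; exact: powR_ge0.
have i2 : intg `]0, t[ (fun s => nrm (fb (Phi s v)) ^+ 2).
  apply: (@intg_le _ _ _ (cst (A ^+ 2))) => //; last exact: intg_cst.
    by apply: msub_pos; [exact: kern_sub|apply: pos_contM; exact: pos_cont_nrm].
  move=> s /kern_sub/pos s0; rewrite ger0_norm ?sqr_ge0// ler_sqr ?nnegrE ?nrm_ge0 ?(ltW A0)//.
  by apply: fA; exact: ltW.
have l2 : \int[mu]_(s in `]0, t[) (nrm (fb (Phi s v)) ^+ 2) <= K * cj ^+ 2 * nrm (N1 v) ^+ 2.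
  apply: le_trans (hK v t t0) _; rewrite -mulrA ler_wpM2l// -exprMn ler_sqr ?nnegrE ?mulr_ge0 ?nrm_ge0//.
  by rewrite NE.
(* [young_small] with [a = |fb| / A], at most 1, and [b] the norm of the kernel over [nu]; the
   prefactor undoes both normalizations. *)
pose g s := A * nu * (e1 * nu `^ (- q) * nrm (radj D (S' (t - s) z)) `^ q
   + C * A ^- 2 * nrm (fb (Phi s v)) ^+ 2).
have ii1 := intgZ (e1 * nu `^ (- q)) (mble_itv _) i1.
have ii2 := intgZ (C * A ^- 2) (mble_itv _) i2.
have ig : intg `]0, t[ g by apply: intgZ => //; exact: intgD.
have gle s : `]0, t[%classic s -> `|ip (fb (Phi s v)) (radj D (S' (t - s) z))| <= g s.
  move=> Ds; have s0 := pos (kern_sub Ds); apply: le_trans (ip_le _ _) _.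
  set a := nrm _; set b := nrm _.
  have a0 : 0 <= a / A by rewrite divr_ge0 ?nrm_ge0// ltW.
  have a1 : a / A <= 1 by rewrite ler_pdivrMr// mul1r fA// ltW.
  have b0 : 0 <= b / nu by rewrite divr_ge0 ?nrm_ge0// ltW.
  have h1 := hC _ _ a0 a1 b0.
  have -> : a * b = A * nu * (a / A * (b / nu)) by field; rewrite !gt_eqF.
  rewrite /g ler_wpM2l ?mulr_ge0 ?(ltW nu0) ?(ltW A0)//; apply: (le_trans h1).
  rewrite powRM ?invr_ge0 ?nrm_ge0 ?(ltW nu0)// -powR_inv1 ?(ltW nu0)// -powRrM mulN1r.
  rewrite expr_div_n -/e1 -/a -/b le_eqVlt; apply/orP; left; apply/eqP; ring.
have if1 : intg `]0, t[ (fun s => ip (fb (Phi s v)) (radj D (S' (t - s) z))).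
  exact: (intg_le (mble_itv _) m1 gle ig).
apply: le_trans (ler_norm _) _; apply: le_trans (Rint_abs_le (mble_itv _) if1 ig gle) _.
rewrite /g RintegralZl//; last exact: intgD.
rewrite RintegralD// !RintegralZl//.
have h2 : e1 * nu `^ (- q) * \int[mu]_(s in `]0, t[) (nrm (radj D (S' (t - s) z)) `^ q) <= eta.
  have -> : eta = e1 * nu `^ (- q) * ((Kq + 1) * nu `^ q).
    have : nu `^ (- q) * nu `^ q = 1 by rewrite powRN mulVf// gt_eqF// powR_gt0.
    rewrite /e1; move: (nu `^ (- q)) (nu `^ q) => a b ab.
    have -> : eta / (Kq + 1) * a * ((Kq + 1) * b) = eta * (a * b) by field; rewrite gt_eqF.
    by rewrite ab mulr1.
  have en0 : 0 <= e1 * nu `^ (- q) by apply: mulr_ge0; [exact: ltW|exact: powR_ge0].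
  apply: (ler_wpM2l en0); apply: (le_trans l1).
  by rewrite ler_wpM2r ?powR_ge0// lerDl.
have CA0 : 0 <= C * A ^- 2 by rewrite mulr_ge0// invr_ge0 sqr_ge0.
have h3 := lerD h2 (ler_wpM2l CA0 l2).
have An0 : 0 <= A * nu by rewrite mulr_ge0// ltW.
apply: le_trans (ler_wpM2l An0 h3) _; rewrite le_eqVlt; apply/orP; left; apply/eqP.
by field; rewrite gt_eqF.
Qed.

(** The supremum [f] of the orbit is finite because [N1] is bounded. The feedback stays below
    [c1 f], so [conv_bound] with [eta = 1 / (2 c1)] returns [f / 2] plus a multiple of
    [|N1 v|^2 / f], hence of [|N1 v|], and [f / 2] is absorbed. *)
Lemma N1_orbit : exists2 c, 0 <= c & forall v t, 0 <= t -> nrm (N1 (Phi t v)) <= c * nrm (N1 v).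
Proof.
have [c1 c10 hc1] := fb_le.
have [|C C0 hC] := @conv_bound ((2 * c1)^-1); first by rewrite invr_gt0 mulr_gt0.
exists (2 * (M + C / c1)); first by rewrite mulr_ge0// addr_ge0// divr_ge0// ltW.
move=> v.
have [_ [cn cn0 hcn]] := bN.
pose E := [set r | exists2 t, 0 <= t & r = nrm (N1 (Phi t v))].
have E0 : E (nrm (N1 v)) by exists 0; rewrite // (rsg0 hP).
have Eub : has_ubound E.
  exists (cn * (Mp * nrm v)) => _ [t t0 ->]; apply: le_trans (hcn _) _.
  by rewrite ler_wpM2l//; exact: (rsg_le hP).
have Es : has_sup E by split => //; exists (nrm (N1 v)).
pose f := sup E.
have hf t : 0 <= t -> nrm (N1 (Phi t v)) <= f.
  by move=> t0; apply: sup_upper_bound => //; exists t.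
suff ff : f <= 2 * (M + C / c1) * nrm (N1 v).
  by move=> t t0; exact: le_trans (hf t t0) ff.
have n0 := nrm_ge0 (N1 v).
have nf : nrm (N1 v) <= f by have := hf 0 (lexx _); rewrite (rsg0 hP).
have [f0|f0] := leP f 0.
  apply: le_trans f0 _; by rewrite !mulr_ge0// addr_ge0// divr_ge0// ltW.
have A0 : 0 < c1 * f by rewrite mulr_gt0.
have fA s : 0 <= s -> nrm (fb (Phi s v)) <= c1 * f.
  by move=> s0; apply: hc1 => t t0; rewrite -(rsgD hP)//; apply: hf; exact: addr_ge0.
have M1 : 1 <= M by case: hS => _ _ _ _ [].
have X : (2 * c1)^-1 * (c1 * f) + C * nrm (N1 v) ^+ 2 / (c1 * f) <= f / 2 + C / c1 * nrm (N1 v).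
  apply: lerD; first by rewrite le_eqVlt; apply/orP; left; apply/eqP; field; rewrite gt_eqF.
  have -> : C * nrm (N1 v) ^+ 2 / (c1 * f) = C / c1 * nrm (N1 v) * (nrm (N1 v) / f).
    by field; rewrite !gt_eqF.
  rewrite ler_piMr ?mulr_ge0 ?invr_ge0 ?(ltW c10)//.
  by rewrite ler_pdivrMr// mul1r.
have step t : 0 <= t -> nrm (N1 (Phi t v)) <= M * nrm (N1 v) + (f / 2 + C / c1 * nrm (N1 v)).
  have B0 : 0 <= f / 2 + C / c1 * nrm (N1 v).
    by apply: addr_ge0; [rewrite divr_ge0// ltW|rewrite mulr_ge0// divr_ge0// ltW].
  rewrite le_eqVlt => /predU1P[<-|t0].
    rewrite (rsg0 hP); apply: (@le_trans _ _ (M * nrm (N1 v))); first by rewrite ler_peMl.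
    by rewrite lerDl.
  apply: nrm_le_ip; first by rewrite addr_ge0// mulr_ge0.
  have bid : blin (fun y : Y => y) by split => //; exists 1 => // y; rewrite mul1r.
  apply: (ip_le_dense dense_JAi bid); first by rewrite addr_ge0// mulr_ge0.
  move=> _ [z _ <-] /=; rewrite ip_mild// mulrDl; apply: lerD.
    apply: le_trans (ip_le_nrm _ _) _; rewrite ler_wpM2r ?nrm_ge0//.
    by apply: (rsg_le hS); exact: ltW.
  apply: le_trans (hC v t z _ t0 A0 fA) _.
  by rewrite ler_wpM2r ?nrm_ge0.
have : f <= M * nrm (N1 v) + (f / 2 + C / c1 * nrm (N1 v)).
  by apply: sup_le_ub; [exists (nrm (N1 v))|move=> _ [t t0 ->]; exact: step].
by move: (C / c1) => c; lra.
Qed.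

Lemma fb_N1 : exists2 c, 0 <= c & forall v, nrm (fb v) <= c * nrm (N1 v).
Proof.
have [c c0 hc] := fb_le; have [d d0 hd] := N1_orbit.
by exists (c * d); [rewrite mulr_ge0// ltW|move=> v; rewrite -mulrA; apply: hc => t; exact: hd].
Qed.

(** The vectors [l (l - A_P)^-1 J y = J (N1 v)] and [l (l - A)^-1 J y = J s] differ by a gap for
    [resolvent_gap]. It is small relative to the feedback, hence to [N1 v] by [fb_N1], while [s]
    tends to [y]. *)
Lemma N1_dense y (e : R) : 0 < e -> exists2 x, range N1 x & nrm (y - x) < e.
Proof.
move=> e0; have [c c0 hc] := fb_N1.
pose r := e / 2; have r0 : 0 < r by rewrite divr_gt0.
pose B := nrm y + r; have B0 : 0 < B by rewrite ltr_wpDl// nrm_ge0.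
(* The bound [1 / 2] absorbs [|d'| <= de |N1 v|] and gives [|N1 v| <= 2 B]; the other bound then
   yields [|d'| <= e / 4]. *)
pose de := Num.min 2^-1 (e / (8 * B)).
have de0 : 0 < de by rewrite lt_min invr_gt0 ltr0n/= divr_gt0// mulr_gt0.
have de1 : de <= 2^-1 by rewrite ge_min lexx.
have de2 : de * B <= e / 8.
  have : de <= e / (8 * B) by rewrite ge_min lexx orbT.
  by rewrite -(ler_pM2r B0) => /le_trans; apply; rewrite le_eqVlt; apply/orP; left;
    apply/eqP; field; rewrite gt_eqF.
have c1 : 0 < c + 1 by rewrite ltr_wpDl.
have [L L0 hL] := resolvent_gap (divr_gt0 de0 c1).
have [L' L'0 hL'] := resol_approx hS y r0.
pose l := Num.max L L'; have l0 : 0 <= l by rewrite le_max L0.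
have Ll : L <= l by rewrite le_max lexx.
have Ll' : L' <= l by rewrite le_max lexx orbT.
pose x := J y; pose rp := @resol R Y Phi l x; pose s := l%:C *: @resol R Y S l y.
(* Since [A_P rp = l rp - x], this is [A_P] at [l rp]. *)
pose v := l%:C *: (l%:C *: rp - x).
have E1 : Api v = l%:C *: rp by rewrite (blinZ _ _ bApi) (Ainvs_resol hP x l0).
have E2 : J s = l%:C *: Ai (J s) - l%:C *: Ai x.
  rewrite /x -scalerBr -(blinB _ _ bAi) -(blinB _ _ bJ) JAi (Ainvs_resol hS y l0).
  by rewrite -(blinZ _ _ bJ).
have dE : (l%:C *: rp - J s) + D (fb v) = l%:C *: Ai (l%:C *: rp - J s).
  have h : D (fb v) = l%:C *: Ai (l%:C *: rp) - l%:C *: Ai x - l%:C *: rp.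
    have e1 := Api_eq hS hS' bD bR hP bP PE opt_ex v; rewrite E1 in e1.
    have AvE : Ai v = l%:C *: Ai (l%:C *: rp) - l%:C *: Ai x.
      by rewrite {1}/v (blinZ _ _ bAi) (blinB _ _ bAi) scalerBr.
    by rewrite -AvE e1; vec.
  by rewrite h {1}E2 (blinB _ _ bAi) scalerBr; vec.
have [d' d1 d2] := hL _ _ _ Ll dE.
have d'E : d' = N1 v - s by apply: J_injE; rewrite (blinB _ _ bJ) -NE E1.
have h1 := hL' l Ll'; rewrite -/s in h1.
have n1 : nrm (N1 v) <= nrm d' + B.
  have -> : N1 v = d' + (y + (s - y)) by rewrite d'E; vec.
  apply: le_trans (nrmD _ _) _; rewrite lerD2l; apply: le_trans (nrmD _ _) _.
  by rewrite lerD2l ltW.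
have n2 : nrm d' <= de * nrm (N1 v).
  apply: (le_trans d2).
  have ce : de / (c + 1) * (c * nrm (N1 v)) <= de * nrm (N1 v).
    have -> : de / (c + 1) * (c * nrm (N1 v)) = de * nrm (N1 v) * (c / (c + 1)).
      by field; rewrite gt_eqF.
    rewrite ler_piMr ?mulr_ge0 ?nrm_ge0 ?(ltW de0)//.
    by rewrite ler_pdivrMr// mul1r lerDl.
  apply: le_trans ce; rewrite ler_wpM2l ?hc//.
  by rewrite divr_ge0 ?(ltW de0) ?(ltW c1).
have n0 := nrm_ge0 (N1 v).
have n3 : nrm d' <= e / 4.
  have : nrm (N1 v) <= 2 * B.
    have : de * nrm (N1 v) <= 2^-1 * nrm (N1 v) by rewrite ler_wpM2r.
    by move: n1 n2; lra.
  move=> /(ler_wpM2l (ltW de0)) h; apply: (le_trans n2); apply: (le_trans h).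
  by rewrite mulrCA; move: de2; lra.
exists (N1 v); first by exists v.
have -> : y - N1 v = - (s - y) - d' by rewrite d'E; vec.
apply: le_lt_trans (nrmB _ _) _; rewrite nrmN.
by move: h1 n3; rewrite /r; lra.
Qed.

(** For [y] in the dense range of [N1], the adjoint estimate required by [douglas] is [N1_orbit];
    density extends it to all [y]. *)
Lemma Psi_ex : exists2 c, 0 <= c & forall t y, 0 <= t ->
  exists2 p, J p = Phi t (J y) & nrm p <= c * nrm y.
Proof.
have [c c0 hc] := N1_orbit; exists c => // t y t0.
have bPt := rsg_blin hP t0.
have bPJ : blin (Phi t \o J) by exact: blin_comp.
apply: (douglas bJ); first by rewrite mulr_ge0// nrm_ge0.
move=> z; rewrite ipC [leLHS]ipC (radjP bPJ) [leLHS]ipC mulrAC.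
have bid : blin (fun y : Y => y) by split => //; exists 1 => // x; rewrite mul1r.
apply: (ip_le_dense N1_dense bid); first by rewrite mulr_ge0// nrm_ge0.
move=> _ [v _ <-]; rewrite ipC -(radjP bPJ) /= PhiJ// (radjP bJ).
apply: le_trans (ip_le_nrm _ _) _; rewrite mulrAC ler_wpM2r ?nrm_ge0//.
exact: hc.
Qed.

(** This is [A^eps Phi(t) A^-eps], read off through the injectivity of [J]. *)
Definition Psi t y := xget 0 [set p | J p = Phi t (J y)].

Lemma JPsi t y : 0 <= t -> J (Psi t y) = Phi t (J y).
Proof.
move=> t0; apply: (@xgetPP _ [set p | J p = Phi t (J y)]).
by have [c _ /(_ t y t0) [p pE _]] := Psi_ex; exists p.
Qed.

Lemma Psi_blin t : 0 <= t -> blin (Psi t).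
Proof.
move=> t0; split.
  by move=> r x y; apply: J_injE; rewrite JPsi// bJ.1 (rsg_blin hP t0).1 bJ.1 !JPsi.
have [c c0 hc] := Psi_ex; exists c => // y; have [p pE pl] := hc t y t0.
by rewrite (_ : Psi t y = p)//; apply: J_injE; rewrite JPsi.
Qed.

Lemma Psi_le : exists2 c, 0 <= c & forall t y, 0 <= t -> nrm (Psi t y) <= c * nrm y.
Proof.
have [c c0 hc] := Psi_ex; exists c => // t y t0; have [p pE pl] := hc t y t0.
by rewrite (_ : Psi t y = p)//; apply: J_injE; rewrite JPsi.
Qed.

Lemma Psi_N1 t v : 0 <= t -> Psi t (N1 v) = N1 (Phi t v).
Proof. by move=> t0; apply: J_injE; rewrite JPsi// PhiJ. Qed.

(** Orbits starting in the range of [N1] are continuous by [Psi_N1]; the uniform bound and density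
    give the rest. *)
Lemma Psi_cont y : pos_cont (Psi ^~ y).
Proof.
move=> t0 t00; apply/cvg_nrmP/cvgrPdist_le => e e0.
have [c c0 hc] := Psi_le; have c1 : 0 < 4 * (c + 1) by rewrite mulr_gt0// ltr_wpDl.
have [_ [v _ <-] hv] := N1_dense y (divr_gt0 e0 c1).
have cN : (fun t => N1 (Phi t v)) @ t0 --> N1 (Phi t0 v).
  by apply: blin_cvg => //; exact: (rsg_cont hP).
have e2 : 0 < e / 2 by rewrite divr_gt0.
move/cvg_nrmP/cvgrPdist_le : cN => /(_ _ e2) h.
near=> t.
have t1 : 0 < t by near: t; exact: lt_nbhsr.
have h1 : `|0 - nrm (N1 (Phi t v) - N1 (Phi t0 v))| <= e / 2 by near: t.
rewrite sub0r normrN ger0_norm ?nrm_ge0// in h1.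
rewrite sub0r normrN ger0_norm ?nrm_ge0//.
have b t' : 0 < t' -> nrm (Psi t' (y - N1 v)) <= e / 4.
  move=> t'0; apply: le_trans (hc _ _ (ltW t'0)) _.
  have : (c + 1) * nrm (y - N1 v) <= e / 4.
    rewrite mulrC -ler_pdivlMr ?ltr_wpDl//; apply: (le_trans (ltW hv)).
    by rewrite le_eqVlt; apply/orP; left; apply/eqP; field; rewrite gt_eqF// ltr_wpDl.
  by have := nrm_ge0 (y - N1 v); move: (nrm _) => a; lra.
have -> : Psi t y - Psi t0 y = Psi t (y - N1 v) + (N1 (Phi t v) - N1 (Phi t0 v)) - Psi t0 (y - N1 v).
  rewrite (blinB _ _ (Psi_blin (ltW t1))) (blinB _ _ (Psi_blin (ltW t00))).
  by rewrite !Psi_N1 ?ltW//; vec.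
apply: le_trans (nrmB _ _) _; apply: le_trans (lerD (nrmD _ _) (lexx _)) _.
by have := b t t1; have := b t0 t00; move: h1; lra.
Unshelve. all: by end_near. Qed.

(** This is [B'P A^-eps]: in the integral defining the gain at [J y], the vector [R'R Phi(t) J y] is
    [radj J] of [Q (Psi t y)]. *)
Definition gain y : U := vintegral `]0, +oo[ (fun t => Eop t (Q (Psi t y))).

Let QPsi_cont y : pos_cont (fun t => Q (Psi t y)).
Proof. by apply: pos_cont_blin => //; exact: Psi_cont. Qed.

Lemma gain_in_Lp1 y : in_Lp 1 `]0, +oo[ (fun t => Eop t (Q (Psi t y))).
Proof.
have [c c0 hc] := Psi_le; have [_ [cq cq0 hcq]] := bQ.
apply: (E_in_Lp1 (@QPsi_cont y) (C := cq * (c * nrm y))) => t t0.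
by apply: le_trans (hcq _) _; rewrite ler_wpM2l// hc// ltW.
Qed.

Lemma gainP y u : ip (gain y) u = \int[mu]_(t in `]0, +oo[) ip (Eop t (Q (Psi t y))) u.
Proof. by rewrite (vintegralP (mble_itv _) (gain_in_Lp1 y)). Qed.

Lemma gainB x y : gain (x - y) = gain x - gain y.
Proof.
apply: ip_eq => u; have i1 := intg_ip u (mble_itv _) (gain_in_Lp1 x).
have i2 := intg_ip u (mble_itv _) (gain_in_Lp1 y).
rewrite gainP [RHS]ipBl (gainP x) (gainP y); apply: etrans (RintegralB (mble_itv _) i1 i2).
apply: eq_Rintegral => t; rewrite inE => /pos t0.
by rewrite (blinB _ _ (Psi_blin (ltW t0))) (blinB _ _ bQ) (blinB _ _ (bE t0)) ipBl.
Qed.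

Lemma gain_le : exists2 c, 0 <= c & forall y, nrm (gain y) <= c * nrm y.
Proof.
have [c c0 hc] := Psi_le; have [_ [cq cq0 hcq]] := bQ.
exists (cq * c * kI); first by rewrite !mulr_ge0.
move=> y; have -> : cq * c * kI * nrm y = \int[mu]_(t in `]0, +oo[) (cq * c * nrm y * k t).
  by rewrite RintegralZl// -/kI; ring.
apply: (vintegral_le (mble_itv _) (gain_in_Lp1 y)); first exact: intgZ.
move=> t /pos t0; apply: le_trans (E_le _ t0) _; rewrite mulrC ler_wpM2r ?k_ge0//.
by apply: le_trans (hcq _) _; rewrite -mulrA ler_wpM2l// hc// ltW.
Qed.

Lemma gain_N1 v : gain (N1 v) = - fb v.
Proof.
apply: ip_eq => u; rewrite gainP ipNl fb_gain opprK; apply: eq_Rintegral => t.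
by rewrite inE => /pos t0; rewrite Psi_N1// ltW.
Qed.

Lemma range_Api x : (exists v, x = Api v) <->
  (exists2 y, x = J y & exists v, x - D (gain y) = Ai v).
Proof.
have aE := Api_eq hS hS' bD bR hP bP PE opt_ex.
split=> [[v ->]|[y -> [v vE]]].
  exists (N1 v) => //; exists v; rewrite gain_N1 (blinN _ bD) aE.
  by vec.
have [c c0 hc] := gain_le; have c1 : 0 < 2 * (c + 1) by rewrite mulr_gt0// ltr_wpDl.
(* This accuracy outweighs the norm of the gain and leaves [|d'| <= |d'| / 2]. *)
have i0 : 0 < (2 * (c + 1))^-1 by rewrite invr_gt0.
have [l l0 hl] := resolvent_gap i0.
pose f := l%:C *: J y - v; pose r := @resol R Y Phi l f; pose v' := l%:C *: r - f.
have E1 : Api v' = r by rewrite (Ainvs_resol hP f l0).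
(* Subtracting the equation of [r], an instance of [Api_eq], from that of [J y] eliminates [A_P];
   the gap is driven by the difference of the two gains. *)
have dE : (J y - r) + D (gain (N1 v') - gain y) = l%:C *: Ai (J y - r).
  have e1 : r - D (gain (N1 v')) = Ai v' by rewrite -E1 gain_N1 (blinN _ bD) aE; vec.
  rewrite (blinB _ _ bD).
  have vE' (a b c' d : Y) : a - b + (c' - d) = (a - d) - (b - c') by vec.
  rewrite vE' e1 vE /v' /f (blinB _ _ bAi) (blinZ _ _ bAi) (blinB _ _ bAi) (blinZ _ _ bAi) (blinB _ _ bAi).
  by vec.
have [d' d1 d2] := hl _ _ _ (lexx _) dE.
have d'E : d' = y - N1 v' by apply: J_injE; rewrite (blinB _ _ bJ) -NE E1.
have : nrm d' <= 0.
  have h1 : nrm (gain (N1 v') - gain y) <= c * nrm d'.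
    by rewrite d'E nrmBC -gainB; exact: hc.
  have h2 : (2 * (c + 1))^-1 * (c * nrm d') <= 2^-1 * nrm d'.
    have -> : (2 * (c + 1))^-1 * (c * nrm d') = 2^-1 * nrm d' * (c / (c + 1)).
      by field; rewrite gt_eqF// ltr_wpDl.
    rewrite ler_piMr ?mulr_ge0 ?nrm_ge0//.
    by rewrite ler_pdivrMr ?ltr_wpDl// mul1r lerDl.
  have h3 := ler_wpM2l (ltW i0) h1.
  by have := nrm_ge0 d'; move: d2 h2 h3; lra.
move=> h; have d0 : d' = 0 by apply: nrm0_eq0; apply/le_anti; rewrite h nrm_ge0.
exists v'; apply/eqP; rewrite -subr_eq0 E1 -d1 d0; apply/eqP; exact: (blin0 bJ).
Qed.

End Gain.

(** * From the operators of the theorem to bounded operators *)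

Section ComplexLinear.
Context {R : realType}.

Lemma linear_i (V W : hilbertType R) (T : V -> W) x : linear T -> T ('i%C *: x) = 'i%C *: T x.
Proof.
move=> lT; have T0 : T 0 = 0.
  have := lT 1 0 0; rewrite scaler0 addr0 scale1r => h.
  by apply: (@addrI _ (T 0)); rewrite addr0 -h.
by have := lT 'i%C x 0; rewrite !addr0 T0 addr0.
Qed.

Lemma hdot_radj (V W : hilbertType R) (T : V -> W) x y : blin T ->
  (forall x, T ('i%C *: x) = 'i%C *: T x) -> hdot (T x) y = hdot x (radj T y).
Proof.
move=> bT Ti; apply: hdot_eq; first exact: radjP.
by apply: oppr_inj; rewrite -!ipiN -Ti radjP.
Qed.

Lemma radj_i (V W : hilbertType R) (T : V -> W) y : blin T ->
  (forall x, T ('i%C *: x) = 'i%C *: T x) -> radj T ('i%C *: y) = 'i%C *: radj T y.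
Proof.
move=> bT Ti; apply: radj_unique => // x.
by apply: oppr_inj; rewrite -!ipiN -Ti radjP.
Qed.

Lemma hdot_inj (V : hilbertType R) (y y' : V) : (forall x, hdot x y = hdot x y') -> y = y'.
Proof. by move=> h; apply: ip_eq => x; rewrite ![ip _ x]ipC /ip h. Qed.

Lemma hdot_injl (V : hilbertType R) (y y' : V) : (forall x, hdot y x = hdot y' x) -> y = y'.
Proof. by move=> h; apply: ip_eq => x; rewrite /ip h. Qed.

Lemma blin_i (V : hilbertType R) : blin (fun x : V => 'i%C *: x).
Proof.
split=> [r x y|]; first by rewrite scalerDr !scalerA mulrC.
by exists 1 => // x; rewrite nrmi mul1r.
Qed.

Lemma C0_rsg (V : hilbertType R) (S : R -> V -> V) : C0_semigroup S -> exp_stable S ->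
  exists M w, rsg S M w.
Proof.
move=> [h1 h2 h3 h4] [M [w [M1 w0 hw]]]; exists M, w; split => //.
by move=> t t0; apply: bounded_op_blin; exact: h1.
Qed.

Lemma vmeasurable_eq (V : hilbertType R) (D : set R) (f g : R -> V) :
  (forall t, D t -> f t = g t) -> vmeasurable D f -> vmeasurable D g.
Proof.
move=> fg vf O oO; have -> : D `&` g @^-1` O = D `&` f @^-1` O; last exact: vf.
by apply/seteqP; split=> t [Dt /=]; rewrite fg.
Qed.

Lemma vintegral_eq (V : hilbertType R) (D : set R) (f g : R -> V) : mble D ->
  (forall t, D t -> f t = g t) -> in_Lp 1 D g -> vintegral D f = vintegral D g.
Proof.
move=> mD fg hg; have [vg ig] := (in_Lp1P _ mD).1 hg.
apply: vintegral_unique.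
  apply/in_Lp1P => //; split; first by apply: vmeasurable_eq vg => t /fg.
  by apply: eq_integrable ig => // t /set_mem Dt; rewrite /= fg.
move=> z; rewrite vintegralP//; apply: eq_Rintegral => t /set_mem Dt.
by rewrite fg.
Qed.

Section generator.
Context {V : hilbertType R} (S : R -> V -> V) (M w : R).
Hypothesis hS : rsg S M w.
Notation Ai := (Ainvs S).

Lemma generator_Ainvs y : generator S (Ai y) = y.
Proof. by apply: cvg_lim; [exact: norm_hausdorff|exact: (isgen_Ainvs hS)]. Qed.

Lemma dom_generator x : dom (generator S) x <-> exists y, x = Ai y.
Proof.
split=> [h|[y ->]]; last by apply/cvg_ex; exists y; exact: (isgen_Ainvs hS).
by exists (generator S x); apply/(isgenP hS).
Qed.

Hypothesis lS : forall t, 0 <= t -> linear (S t).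
Let bAi := Ainvs_blin hS.

Lemma Ainvs_i x : Ai ('i%C *: x) = 'i%C *: Ai x.
Proof.
rewrite (Ainvs_comm hS _ (blin_i V))// => t y t0.
by rewrite linear_i//; apply: lS; exact: ltW.
Qed.

(** Every [y] is the generator at [Ai y], so the condition defining the adjoint reads
    [hdot y z = hdot (Ai y) v] for all [y]. *)
Lemma adj_generatorP z v : (forall x, dom (generator S) x -> hdot (generator S x) z = hdot x v)
  <-> z = radj Ai v.
Proof.
split=> [h|-> x /dom_generator[y ->]].
  apply: hdot_inj => y; rewrite -(hdot_radj _ _ bAi Ainvs_i) -h.
    by rewrite generator_Ainvs.
  by apply/dom_generator; exists y.
by rewrite generator_Ainvs (hdot_radj _ _ bAi Ainvs_i).
Qed.

Lemma dom_adj_generator z : dom (adj_op (generator S)) z <-> exists v, z = radj Ai v.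
Proof.
by split=> -[v hv]; exists v; apply/adj_generatorP.
Qed.

Lemma adj_generator_radj v : adj_op (generator S) (radj Ai v) = v.
Proof.
rewrite /=; set E := (X in xget 0 X).
have /adj_generatorP/(radj_Ainvs_inj hS) // : E (xget 0 E).
by apply: xgetPP; exists v; apply/adj_generatorP.
Qed.

End generator.

End ComplexLinear.

Section System.
Context {R : realType} {Y U Z : hilbertType R}.
Notation mu := (@lebesgue_measure R).
Context (S : R -> Y -> Y) (M w : R).
Hypotheses (hS : rsg S M w) (bS : forall t, 0 <= t -> bounded_op (S t)).
Context (B : U -> Y -> R[i]).
Hypothesis B_control : control_op S B.
Notation Ai := (Ainvs S).
Notation S' := (adj_semigroup S).
Notation Astar := (adj_op (generator S)).
Let bAi := Ainvs_blin hS.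
Let lS t : 0 <= t -> linear (S t). Proof. by move=> /bS[]. Qed.

Lemma adj_semigroup_radj t : 0 <= t -> S' t = radj (S t).
Proof. by move=> /bS; exact: adj_radj. Qed.

Let hSd := rsg_adj hS adj_semigroup_radj.

Lemma adj_semigroup_i t v : 0 <= t -> S' t ('i%C *: v) = 'i%C *: S' t v.
Proof.
move=> t0; rewrite adj_semigroup_radj//; apply: radj_i; first exact: (rsg_blin hS).
by move=> x; apply: linear_i; exact: lS.
Qed.

Lemma adj_semigroup_Ai t v : 0 <= t -> S' t (radj Ai v) = radj Ai (S' t v).
Proof.
move=> t0; rewrite adj_semigroup_radj//; apply: ip_eq => x.
have b := rsg_blin hS t0.
by rewrite ![ip _ x]ipC -!radjP// (SAinvs hS).
Qed.

Lemma dom_Astar v : dom Astar (radj Ai v).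
Proof. by apply/(dom_adj_generator hS lS); exists v. Qed.

Lemma B_i u v : B u (radj Ai ('i%C *: v)) = - 'i%C * B u (radj Ai v).
Proof.
have [dB _ _] := B_control; have [aB _] := dB u.
have B0 : B u 0 = 0.
  have d0 : dom Astar 0 by have := dom_Astar 0; rewrite (blin0 (blin_radj bAi)).
  have := aB 1 0 0 d0 d0; rewrite scaler0 addr0 conjCE conjc1 mul1r => h.
  by apply: (@addrI _ (B u 0)); rewrite addr0 -h.
rewrite (radj_i _ bAi (Ainvs_i hS lS)).
have := aB 'i%C _ 0 (dom_Astar v) (_ : dom Astar 0).
rewrite addr0 B0 addr0 => -> //; first by congr (_ * _); apply/eqP; rewrite conjCE eq_complex /= oppr0 !eqxx.
by have := dom_Astar 0; rewrite (blin0 (blin_radj bAi)).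
Qed.

(** [D] is [A^-1 B]. The graph norm of [radj Ai v] is controlled by the norm of [v], so the pairing
    is a bounded form in [u] and [v]; its real part defines [D], and [B_i] restores the complex
    identity. *)
Lemma control_repr : exists2 D : U -> Y, blin D &
  (forall u v, B u (radj Ai v) = hdot (D u) v) /\ (forall u, D ('i%C *: u) = 'i%C *: D u).
Proof.
have [dB lB [C hC]] := B_control.
have [_ [ca ca0 hca]] := blin_radj bAi.
have [|r x y z|r x y z|x z|D bD DE] := @bilin_op R U Y (fun u v => complex.Re (B u (radj Ai v))) (`|C| * (ca + 1)).
- by rewrite mulr_ge0// addr_ge0.
- by rewrite lB ?ReD ?ReZ//; exact: dom_Astar.
- have [aB _] := dB x; rewrite (blin_radj bAi).1 aB; try exact: dom_Astar.
  by rewrite conjCE conjc_real ReD ReZ.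
- have h1 : complex.Re (B x (radj Ai z)) <= nrm (B x (radj Ai z)).
    by case: (B x _) => a b; rewrite /nrm normc_def/= (le_trans (ler_norm _))// -sqrtr_sqr ler_wsqrtr// lerDl sqr_ge0.
  apply: (le_trans h1); apply: (le_trans (hC _ _ (dom_Astar z))).
  rewrite /graph_norm (adj_generator_radj hS lS).
  have -> : `|C| * (ca + 1) * nrm x * nrm z = `|C| * nrm x * (ca * nrm z + nrm z) by ring.
  have g0 : 0 <= nrm (radj Ai z) + nrm z by rewrite addr_ge0 ?nrm_ge0.
  apply: (@le_trans _ _ (`|C| * nrm x * (nrm (radj Ai z) + nrm z))).
    by rewrite ler_wpM2r// ler_wpM2r ?nrm_ge0 ?ler_norm.
  by rewrite ler_wpM2l ?mulr_ge0 ?nrm_ge0// lerD2r.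
have hD u v : B u (radj Ai v) = hdot (D u) v.
  rewrite hdotE !DE B_i; case: (B u _) => a b.
  have -> : - 'i%C * (a +i* b) = b +i* - a; last by [].
  by apply/eqP; rewrite eq_complex /=; apply/andP; split; apply/eqP; ring.
exists D => //; split => // u; apply: hdot_injl => v.
rewrite -hD.
have := lB 'i%C u 0 (radj Ai v) (dom_Astar v).
have B0 : B 0 (radj Ai v) = 0 by rewrite hD (blin0 bD) linear0l.
by rewrite addr0 B0 addr0 => ->; rewrite hD linearZl.
Qed.

Context (D : U -> Y).
Hypotheses (bD : blin D) (BD : forall u v, B u (radj Ai v) = hdot (D u) v)
  (Di : forall u, D ('i%C *: u) = 'i%C *: D u).

Lemma Ainv_B u : Ainv S (B u) = D u.
Proof.
set E := [set y | forall z, dom Astar z -> hdot y (Astar z) = B u z].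
have ED y : E y -> y = D u.
  move=> h; apply: hdot_injl => v; have := h _ (dom_Astar v).
  by rewrite (adj_generator_radj hS lS) BD.
apply: ED; apply: xgetPP; exists (D u) => z /(dom_adj_generator hS lS)[v ->].
by rewrite (adj_generator_radj hS lS) BD.
Qed.

Lemma Bstar_radj v : Bstar B (radj Ai v) = radj D v.
Proof.
set E := [set x | forall u, hdot u x = B u (radj Ai v)].
have h : E (radj D v) by move=> u; rewrite BD (hdot_radj _ _ bD Di).
have : E (Bstar B (radj Ai v)) by apply: xgetPP; exists (radj D v).
by move=> h'; apply: hdot_inj => u; rewrite h' h.
Qed.

(** Test vectors have the form [radj Ai v], and taking [i v] for [v] turns the imaginary part into
    another real instance. *)
Lemma mild_valueP x (u : R -> U) t y : 0 <= t ->
  mild_value S B x u t y <-> mild S S' D x u t y.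
Proof.
move=> t0.
have Bk s v : `]0%R, t[%classic s -> B (u s) (S' (t - s) (radj Ai v)) = hdot (D (u s)) (S' (t - s) v).
  by rewrite /= in_itv/= => /andP[_ st]; rewrite adj_semigroup_Ai ?BD// subr_ge0 ltW.
have RE v : \int[mu]_(s in `]0, t[) complex.Re (B (u s) (S' (t - s) (radj Ai v))) =
    \int[mu]_(s in `]0, t[) ip (u s) (radj D (S' (t - s) v)).
  by apply: eq_Rintegral => s /set_mem st; rewrite Bk// -(radjP bD).
have IM v : \int[mu]_(s in `]0, t[) complex.Im (B (u s) (S' (t - s) (radj Ai v))) =
    \int[mu]_(s in `]0, t[) ip (u s) (radj D (S' (t - s) ('i%C *: v))).
  apply: eq_Rintegral => s /set_mem st; rewrite Bk// hdotE/= -(radjP bD).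
  rewrite adj_semigroup_i//; move: st; rewrite /= in_itv/= => /andP[_ st].
  by rewrite subr_ge0 ltW.
split=> [h v|h z /(dom_adj_generator hS lS)[v ->]].
  have := h _ (dom_Astar v) => /(congr1 (@complex.Re R)).
  by rewrite ReD /cintegral /= RE.
have h1 := h v; have h2 := h ('i%C *: v); rewrite (radj_i _ bAi (Ainvs_i hS lS)) in h2.
by rewrite !hdotE h1 h2 /cintegral RE IM.
Qed.

Lemma integral_pos0 (g : R -> R) : (forall t, 0 <= t -> 0 <= g t) ->
  measurable_fun (`[0, +oo[ : set (measurableTypeR R)) g ->
  (\int[mu]_(t in `[0%R, +oo[) (g t)%:E = \int[mu]_(t in `]0%R, +oo[) (g t)%:E)%E.
Proof.
move=> g0 mg; rewrite integral_itv_obnd_cbnd//.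
apply/measurable_EFinP; apply: measurable_funS mg => //.
by move=> t /=; rewrite !in_itv/= !andbT; exact: ltW.
Qed.

Lemma in_Lp2P (V : hilbertType R) (u : R -> V) : in_Lp 2 `[0, +oo[ u <->
  vmeasurable `[0, +oo[ u /\ intg `]0, +oo[ (fun t => nrm (u t) ^+ 2).
Proof.
have pE t : nrm (u t) `^ 2 = nrm (u t) ^+ 2 by rewrite powR_mulrn ?nrm_ge0.
have sub : `]0, +oo[ `<=` (`[0, +oo[%classic : set R).
  by move=> t /=; rewrite !in_itv/= !andbT; exact: ltW.
have mE : vmeasurable `[0, +oo[ u ->
    measurable_fun (`[0, +oo[ : set (measurableTypeR R)) (fun t => nrm (u t) ^+ 2).
  move=> vu; apply: measurable_funX; apply: (vmeas_meas (mble_itv _) vu).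
  exact: nrm_continuous.
have iE : vmeasurable `[0, +oo[ u -> (\int[mu]_(t in `[0%R, +oo[) (nrm (u t) `^ 2)%:E =
    \int[mu]_(t in `]0%R, +oo[) (nrm (u t) ^+ 2)%:E)%E.
  move=> vu; rewrite -(integral_pos0 (fun t _ => sqr_ge0 _) (mE vu)).
  by apply: eq_integral => t _; rewrite pE.
rewrite /in_Lp; split=> -[vu h]; split => //.
  apply/integrableP; split.
    by apply/measurable_EFinP; apply: measurable_funS (mE vu).
  rewrite iE// in h; apply: le_lt_trans h; rewrite le_eqVlt; apply/orP; left; apply/eqP.
  by apply: eq_integral => t _; rewrite /= ger0_norm// sqr_ge0.
rewrite iE//; have /integrableP[_] := h; apply: le_lt_trans.
rewrite le_eqVlt; apply/orP; left; apply/eqP.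
by apply: eq_integral => t _; rewrite /= ger0_norm// sqr_ge0.
Qed.

Context (Robs : Y -> Z).
Hypothesis bR : blin Robs.

Lemma cost_Rint (u : R -> U) (y : R -> Y) : vmeasurable `[0, +oo[ u -> vmeasurable `[0, +oo[ y ->
  intg `]0, +oo[ (fun t => nrm (u t) ^+ 2) -> intg `]0, +oo[ (fun t => nrm (Robs (y t)) ^+ 2) ->
  cost Robs u y = (\int[mu]_(t in `]0, +oo[) (nrm (Robs (y t)) ^+ 2 + nrm (u t) ^+ 2))%:E.
Proof.
move=> vu vy iu iy; rewrite /cost.
have cR : continuous Robs by move=> x; apply: blin_cvg => //; exact: cvg_id.
rewrite (integral_pos0 (g := fun t => nrm (Robs (y t)) ^+ 2 + nrm (u t) ^+ 2)).
- rewrite /Rintegral fineK//; apply: integrable_fin_num => //; exact: intgD.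
- by move=> t _; rewrite addr_ge0 ?sqr_ge0.
apply: measurable_funD; apply: measurable_funX.
  apply: (vmeas_meas (phi := fun x => nrm (Robs x)) (mble_itv _) vy) => x.
  exact: (continuous_comp (cR x) (@nrm_continuous _ _ _)).
by apply: (vmeas_meas (mble_itv _) vu); exact: nrm_continuous.
Qed.

Lemma optimal_orbit (Phi : R -> Y -> Y) (Mp wp : R) : rsg Phi Mp wp ->
  optimal_state_semigroup S B Robs Phi ->
  forall x, exists uh, optimal S S' D Robs x uh (Phi ^~ x).
Proof.
move=> hP [_ _ hopt] x; have [u [[[Lu _] hmin] mv]] := hopt x.
have [vu iu] := (in_Lp2P u).1 Lu.
have cP : pos_cont (Phi ^~ x) by exact: (rsg_cont hP).
exists u; split => // [t t0|f z vf i_f cz iz mz].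
  by apply/mild_valueP; [exact: ltW|apply: mv; exact: ltW].
have adm : admissible S B x f z.
  split; first exact/in_Lp2P.
  split; first exact: vmeas_pos0.
  (* The mild formula is given at positive times; the null set [{0}] takes care of the initial
     time. *)
  exists [set 0]; split; [exact: measurable_set1|exact: lebesgue_measure_set1|].
  move=> t /=; apply: contra_notP => /eqP t0 tge.
  by apply/mild_valueP => //; apply: mz; rewrite lt_neqAle eq_sym t0.
have := hmin f z adm.
rewrite (cost_Rint vu (vmeas_pos0 cP) iu (obs_sq bR x hP).1).
by rewrite (cost_Rint vf (vmeas_pos0 cz) i_f iz) lee_fin.
Qed.

Context (eps : R).
Hypotheses (eps_gt0 : 0 < eps) (eps_lt1 : eps < 1).
Notation J := (fracinv S eps).
Let bJ := fracinv_blin hS eps_gt0 (ltW eps_lt1).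

Lemma radjJ : radj J = fracinv S' eps.
Proof. exact: (radj_fracinv hS adj_semigroup_radj eps_gt0 (ltW eps_lt1)). Qed.

Lemma fracpow_fracinv y : fracpow S eps (J y) = y.
Proof.
apply: (fracinv_inj hS eps_gt0 eps_lt1).
by apply: (@xgetPP _ [set x | J x = J y]); exists y.
Qed.

Lemma fracpow_radj y : fracpow S' eps (radj J y) = y.
Proof.
rewrite radjJ; apply: (fracinv_inj hSd eps_gt0 eps_lt1).
by apply: (@xgetPP _ [set x | fracinv S' eps x = fracinv S' eps y]); exists y.
Qed.

Lemma dom_fracpow_adj z : dom (fracpow S' eps) z <-> exists y, z = radj J y.
Proof.
by rewrite radjJ; split=> [[y _ <-]|[y ->]]; exists y.
Qed.

(** Continuity of [Eop t] forces the same limit on every approximating sequence. One exists because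
    the range of [radj Ai] is dense and its image under [radj J] lies in both domains. *)
Lemma BstarS_radj (k : R -> R) t y : (forall t, 0 < t -> 0 <= k t) ->
  (forall t y v, 0 < t -> radj J y = radj Ai v ->
     nrm (radj D (S' t v)) <= k t * nrm y) ->
  0 < t -> BstarS S B eps t (radj J y) = Eop S D J t y.
Proof.
move=> k0 kb t0.
have JAi x : Ai (J x) = J (Ai x) := fracinv_Ainvs hS x eps_gt0 (ltW eps_lt1).
have JS t' x : 0 <= t' -> S t' (J x) = J (S t' x).
  by move=> t'0; apply: (fracinv_S hS) => //; exact: ltW.
have bE := Eop_blin hS adj_semigroup_radj bD bJ JAi k0 kb t0.
have BE y' v : radj J y' = radj Ai v -> Bstar B (S' t (radj J y')) = Eop S D J t y'.
  move=> e; rewrite e adj_semigroup_Ai ?(ltW t0)// Bstar_radj.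
  by rewrite (Eop_eq hS adj_semigroup_radj bD bJ JAi JS k0 kb t0 e).
rewrite /BstarS; set E := (X in xget 0 X).
have Eu v : E v -> v = Eop S D J t y.
  move=> [_ [z_ [dz cz cv]]]; rewrite fracpow_radj in cz.
  have c2 : (fun n => Eop S D J t (fracpow S' eps (z_ n))) @ \oo --> Eop S D J t y.
    exact: blin_cvg.
  have e n : Eop S D J t (fracpow S' eps (z_ n)) = Bstar B (S' t (z_ n)).
    have [/(dom_adj_generator hS lS)[v' e1] /dom_fracpow_adj[y' e2]] := dz n.
    by rewrite e2 fracpow_radj (BE y' v')// -e2.
  rewrite (funext e) in c2; apply: (cvg_unique _ cv c2); exact: norm_hausdorff.
apply: Eu; apply: xgetPP; exists (Eop S D J t y); split; first by apply/dom_fracpow_adj; exists y.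
have hu n : exists u, nrm (y - radj Ai u) < n.+1%:R^-1.
  by apply: (dense_range_Ainvs_adj hS); rewrite invr_gt0.
have [u hu'] := choice hu.
have cu : (fun n => radj Ai (u n)) @ \oo --> y.
  apply/cvg_nrmP/cvgrPdist_lt => e e0; have /cvgrPdist_lt/(_ _ e0) := @cvg_harmonic R.
  apply: filterS => n; rewrite !sub0r !normrN [X in _ -> X < _]ger0_norm ?nrm_ge0// => hn.
  rewrite nrmBC; apply: lt_trans (hu' n) _.
  by apply: le_lt_trans hn; rewrite ler_norm.
have eJ n : radj J (radj Ai (u n)) = radj Ai (radj J (u n)).
  by apply: ip_eq => x; rewrite ![ip _ x]ipC -!radjP// JAi.
exists (fun n => radj J (radj Ai (u n))); split.
- move=> n; split; last by apply/dom_fracpow_adj; exists (radj Ai (u n)).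
  by rewrite eJ; exact: dom_Astar.
- by rewrite fracpow_radj; under eq_fun do rewrite fracpow_radj.
- have c2 : (fun n => Eop S D J t (radj Ai (u n))) @ \oo --> Eop S D J t y by exact: blin_cvg.
  have e n : Eop S D J t (radj Ai (u n)) = Bstar B (S' t (radj J (radj Ai (u n)))).
    by rewrite (BE _ _ (eJ n)).
  by rewrite (funext e) in c2.
Qed.

End System.

Theorem theorem1p9 (R : realType) (Y U Z : hilbertType R)
  (sepY : separable Y) (sepU : separable U) (sepZ : separable Z)
  (S : R -> Y -> Y) (S_C0 : C0_semigroup S) (S_stable : exp_stable S)
  (B : U -> Y -> R[i]) (B_control : control_op S B)
  (Robs : Y -> Z) (Robs_bounded : bounded_op Robs)
  (F G : R -> Y -> U)
  (F_bounded : forall t, 0 < t -> bounded_op (F t))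
  (G_bounded : forall t, 0 < t -> graph_bounded (adj_op (generator S)) (G t))
  (decomposition : forall t x, 0 <= t -> dom (adj_op (generator S)) x ->
    Bstar B (adj_semigroup S t x) = F t x + G t x)
  (gamma N eta : R) (gamma_gt0 : 0 < gamma) (gamma_lt1 : gamma < 1)
  (N_gt0 : 0 < N) (eta_gt0 : 0 < eta)
  (hyp1 : forall t x, 0 < t ->
    nrm (F t x) <= N * t `^ (- gamma) * expR (- eta * t) * nrm x)
  (T : R) (T_gt0 : 0 < T)
  (hyp2 : forall p, 1 <= p ->
    extends_to_Lp (dom (adj_op (generator S))) G p T)
  (eps : R) (eps_gt0 : 0 < eps)
  (hyp3a : exists H : R -> Y -> U,
    [/\ forall t, 0 <= t <= T -> bounded_op (H t),
        forall y, {within `[0, T], continuous (fun t => H t y)},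
        exists C : R, forall t y, 0 <= t <= T -> nrm (H t y) <= C * nrm y
      & forall t y, 0 <= t <= T ->
          dom (adj_op (generator S)) (fracinv (adj_semigroup S) eps y) ->
          H t y = G t (fracinv (adj_semigroup S) eps y)])
  (hyp3b : exists C : R, forall x, dom (fracpow S eps) x ->
    dom (fracpow (adj_semigroup S) eps) (adj Robs (Robs x)) /\
    nrm (fracpow (adj_semigroup S) eps (adj Robs (Robs x)))
      <= C * nrm (fracpow S eps x))
  (hyp3c : exists q : R, [/\ 1 < q, q < 2
    & extends_to_Lp
        [set x | dom (fracpow (adj_semigroup S) eps) x /\
                 dom (adj_op (generator S)) (fracpow (adj_semigroup S) eps x)]
        (fun t x => Bstar B
           (adj_semigroup S t (fracpow (adj_semigroup S) eps x))) q T])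
  (Phi : R -> Y -> Y) (Phi_optimal : optimal_state_semigroup S B Robs Phi)
  (eps_small : eps < 1 - gamma) :
  dom (generator Phi) =
  \bigcap_(th in `]0, 1 - gamma[)
    [set x | dom (fracpow S th) x /\
             dom (generator S) (x - Ainv S (B (gain_op S B eps Robs Phi x)))].
Proof.
have [M [w hS]] := C0_rsg S_C0 S_stable.
have [Phi_C0 Phi_stable _] := Phi_optimal.
have [Mp [wp hP]] := C0_rsg Phi_C0 Phi_stable.
have bS t : 0 <= t -> bounded_op (S t) by case: S_C0 => h _ _ _; exact: h.
have lS t : 0 <= t -> linear (S t) by move=> /bS[].
have hS' := adj_semigroup_radj bS; have hSd := rsg_adj hS hS'.
have bAi := Ainvs_blin hS.
have [D bD [BD Di]] := control_repr hS bS B_control.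
have bR := bounded_op_blin Robs_bounded.
have opt := optimal_orbit hS bS bD BD bR hP Phi_optimal.
have [P bP PE] := Pop_ex hS bR hP.
have bfb := fb_blin bD bR hP bP.
have aE := Api_eq hS hS' bD bR hP bP PE opt.
set S' := adj_semigroup S in hS' hSd opt aE *.
pose Ai := Ainvs S.
have S'Ai t v : 0 <= t -> S' t (radj Ai v) = radj Ai (S' t v) := adj_semigroup_Ai hS bS v.
have BsE v : Bstar B (radj Ai v) = radj D v := Bstar_radj bD BD Di v.
have HFG t v : 0 < t -> radj D (S' t v) = F t (radj Ai v) + G t (radj Ai v).
  move=> t0; rewrite -BsE -S'Ai ?(ltW t0)//; apply: decomposition; first exact: ltW.
  exact: (dom_Astar hS bS).
have g0 : 0 < 1 - gamma by rewrite subr_gt0.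
have range_D th : 0 < th -> th < 1 - gamma ->
    exists2 K, 0 <= K & forall u, exists2 y, fracinv S th y = D u & nrm y <= K * nrm u.
  move=> th0 th1; have th2 : th < 1 by apply: lt_trans th1 _; rewrite gtrBl.
  have [p p1|K K0 hK] := theta_bound hS hS' bD gamma_gt0 gamma_lt1 N_gt0 eta_gt0 T_gt0 hyp1 HFG th0 th1.
    have [E [E1 _ [C [C0 hC]] E3]] := hyp2 p p1.
    (* The extension [E] agrees with [G] almost everywhere, and its norm is the measurable stand-in
       that [theta_bound] asks for. *)
    exists C => // v; exists (fun t => nrm (E (radj Ai v) t)); split.
    - apply: (vmeas_meas (mble_itv _) (E1 _).1); exact: nrm_continuous.
    - by move=> t; exact: nrm_ge0.
    - exact: hC.
    - apply: (@filterS _ _ (ae_filter_ringOfSetsType _) _ _ _ (E3 _ (dom_Astar hS bS v))) => t ht tT.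
      by rewrite -ht.
  exact: (range_frac_D hS hS' bD th0 th2 K0 hK).
have range_Phi th : 0 < th -> th < 1 - gamma ->
    exists2 K, 0 <= K & forall v, exists2 y, fracinv S th y = Ainvs Phi v & nrm y <= K * nrm v.
  move=> th0 th1; have th2 : th < 1 by apply: lt_trans th1 _; rewrite gtrBl.
  have [K1 K10 h1] := range_frac_Ai hS th0 th2; have [K2 K20 h2] := range_D _ th0 th1.
  have [_ [c c0 hc]] := bfb.
  exists (K1 + K2 * c); first by rewrite addr_ge0// mulr_ge0.
  move=> v; have [y1 e1 l1] := h1 v; have [y2 e2 l2] := h2 (fb D Robs Phi P v).
  exists (y1 - y2); first by rewrite (blinB _ _ (fracinv_blin hS th0 (ltW th2))) e1 e2 aE.
  apply: le_trans (nrmB _ _) _; rewrite mulrDl lerD// -mulrA.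
  by apply: le_trans l2 _; rewrite ler_wpM2l.
have eps_lt1 : eps < 1 by apply: lt_trans eps_small _; rewrite gtrBl.
pose J := fracinv S eps.
have bJ : blin J := fracinv_blin hS eps_gt0 (ltW eps_lt1).
have JAi x : Ai (J x) = J (Ai x) := fracinv_Ainvs hS x eps_gt0 (ltW eps_lt1).
have JS t x : 0 <= t -> S t (J x) = J (S t x).
  by move=> t0; apply: (fracinv_S hS) => //; exact: ltW.
have JE : radj J = fracinv S' eps := radjJ hS bS eps_gt0 eps_lt1.
have J_inj y y' : J y = J y' -> y = y' by exact: (fracinv_inj hS eps_gt0 eps_lt1).
have J'_inj y y' : radj J y = radj J y'-> y = y'.
  by rewrite JE; exact: (fracinv_inj hSd eps_gt0 eps_lt1).
have J0 y : J y = 0 -> y = 0 by move=> h; apply: J_inj; rewrite h (blin0 bJ).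
have J'0 y : radj J y = 0 -> y = 0 by move=> h; apply: J'_inj; rewrite h (blin0 (blin_radj bJ)).
have eJ v : radj J (radj Ai v) = radj Ai (radj J v) := radj_JAi hS bJ JAi v.
have [K K0 k_bound] : exists2 K, 0 <= K & forall t y v, 0 < t -> radj J y = radj Ai v ->
    nrm (radj D (S' t v)) <= decay_kernel w gamma K t * nrm y.
  have [H [_ _ [C hC] HG]] := hyp3a.
  apply: (kernel_bound hS hS' N_gt0 eta_gt0 T_gt0 hyp1 HFG bJ JS (normr_ge0 C)).
  move=> t y v t0 tT e; rewrite JE -HG ?(ltW t0)// -?JE; last by rewrite e; exact: (dom_Astar hS bS).
  by apply: le_trans (hC _ _ _) _; rewrite ?(ltW t0)// ler_wpM2r ?nrm_ge0 ?ler_norm.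
have k0 t : 0 < t -> 0 <= decay_kernel w gamma K t by move=> _; exact: kernel_ge0.
have [Q bQ QE] : exists2 Q, blin Q & forall y, radj Robs (Robs (J y)) = radj J (Q y).
  have [C hC] := hyp3b.
  have dJ y : dom (fracpow S eps) (J y) by exists y.
  pose Q y := fracpow S' eps (adj Robs (Robs (J y))).
  have QE y : radj Robs (Robs (J y)) = radj J (Q y).
    have [/(dom_fracpow_adj hS bS eps_gt0 eps_lt1)[z e] _] := hC _ (dJ y).
    rewrite /Q -(adj_radj Robs_bounded) e.
    by rewrite (fracpow_radj hS bS eps_gt0 eps_lt1).
  have bC := blin_comp (blin_radj bR) (blin_comp bR bJ).
  exists Q => //; split.
    move=> r x y; apply: J'_inj; have e := bC.1 r x y.
    rewrite /= QE QE QE in e.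
    by rewrite e ((blin_radj bJ).1 r (Q x) (Q y)).
  exists `|C| => // y; have [_] := hC _ (dJ y).
  rewrite (fracpow_fracinv hS eps_gt0 eps_lt1) => /le_trans; apply.
  by rewrite ler_wpM2r ?nrm_ge0 ?ler_norm.
(* [range_Phi] at the exponent [eps], admissible by [eps_small], gives existence and the bound;
   injectivity of [J] gives linearity. *)
have [N1 bN NE] : exists2 N1, blin N1 & forall v, Ainvs Phi v = J (N1 v).
  have [K1 K10 h1] := range_Phi _ eps_gt0 eps_small.
  pose N1 v := xget 0 [set y | J y = Ainvs Phi v].
  have NE v : J (N1 v) = Ainvs Phi v.
    by apply: (@xgetPP _ [set y | J y = Ainvs Phi v]); have [y e _] := h1 v; exists y.
  exists N1 => //; split.
    by move=> r x y; apply: J_inj; rewrite bJ.1 !NE (Ainvs_blin hP).1.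
  exists K1 => // v; have [y e l] := h1 v.
  by rewrite (_ : N1 v = y)//; apply: J_inj; rewrite NE.
have [q [q1 q2 [E [E1 _ [C [C0 hC]] E3]]]] := hyp3c.
have [v|Kq Kq0 hKq] := Kq_bound hS hS' bD T_gt0 bJ JS q1 C0.
  (* The fractional power cancels [radj J] in this vector, so hypothesis 3(c) bounds the kernel
     [radj D (S' t v)] by the norm of [x]. *)
  pose x := radj J (radj Ai v); apply: le_trans (hC x).
  have Dx : dom (fracpow S' eps) x /\ dom (adj_op (generator S)) (fracpow S' eps x).
    rewrite (fracpow_radj hS bS eps_gt0 eps_lt1); split; last exact: (dom_Astar hS bS).
    by apply/(dom_fracpow_adj hS bS eps_gt0 eps_lt1); exists (radj Ai v).
  have sT : `]0, T[ `<=` (`]0, +oo[%classic : set R).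
    by move=> t /=; rewrite !in_itv/= andbT => /andP[].
  have cD : pos_cont (fun t => nrm (radj D (S' t v))).
    by apply: pos_cont_nrm; apply: pos_cont_blin; [exact: blin_radj|exact: (rsg_cont hSd)].
  have mD := msub_pos sT cD.
  have mE : measurable_fun (`]0, T[ : set (measurableTypeR R)) (fun t => nrm (E x t)).
    by apply: (vmeas_meas (mble_itv _) (E1 x).1); exact: nrm_continuous.
  apply: ae_ge0_le_integral => //.
  - by move=> t _; rewrite lee_fin powR_ge0.
  - by apply/measurable_EFinP; exact: (measurableT_comp (measurable_powR q) mD).
  - by move=> t _; rewrite lee_fin powR_ge0.
  - by apply/measurable_EFinP; exact: (measurableT_comp (measurable_powR q) mE).
  apply: (@filterS _ _ (ae_filter_ringOfSetsType _) _ _ _ (E3 _ Dx)) => t ht tT.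
  have t0 : 0 <= t by move: tT; rewrite /= in_itv/= => /andP[/ltW].
  by rewrite (ht tT) (fracpow_radj hS bS eps_gt0 eps_lt1) -/S' S'Ai// BsE.
have kc := @kernel_cont _ w gamma K.
have ki := kernel_intg hS gamma_gt0 gamma_lt1 K.
have rA := range_Api hS hS' bD bR hP bP PE opt bJ JAi JS J0 J'0 kc k0 ki k_bound bQ QE bN NE
  q1 q2 Kq0 hKq.
have gL := gain_in_Lp1 hS hS' bD bR hP bP PE opt bJ JAi JS J0 J'0 kc k0 ki k_bound bQ QE bN NE
  q1 q2 Kq0 hKq.
have JP := JPsi hS hS' bD bR hP bP PE opt bJ JAi JS J0 J'0 kc k0 ki k_bound bQ QE bN NE
  q1 q2 Kq0 hKq.
have gainE y : gain_op S B eps Robs Phi (J y) = gain S D Phi J Q y.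
  apply: (vintegral_eq (mble_itv _) _ (gL y)) => t; rewrite /= in_itv/= andbT => t0.
  rewrite (adj_radj Robs_bounded) -(JP t y (ltW t0)) QE.
  exact: (BstarS_radj hS bS bD BD Di eps_gt0 eps_lt1 _ k0 k_bound t0).
have AiE := Ainv_B hS bS BD.
apply/seteqP; split=> x.
  move=> /(dom_generator hP)[v xE] th; rewrite /= in_itv/= => /andP[th0 th1]; split.
    by have [K1 _ /(_ v)[y e _]] := range_Phi th th0 th1; exists y; rewrite // xE.
  have [y e [v' e']] := (rA x).1 (ex_intro _ v xE).
  by apply/(dom_generator hS); exists v'; rewrite AiE e gainE -e.
(* The exponent [eps] belongs to []0, 1 - gamma[], so the intersection yields the factorization
   [x = J y] that [range_Api] asks for. *)
move=> h; have [|[y _ e] /(dom_generator hS)[v e']] := h eps.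
  by rewrite /= in_itv/= eps_gt0.
apply/(dom_generator hP)/(rA x).2; exists y; first by rewrite -e.
by exists v; rewrite -e' AiE -gainE -e.
Qed.
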